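(* Suppose $v:\mathbb{R}\to\mathbb{R}$ is globally Lipschitz and $H:\mathbb{R}\to\mathbb{R}$ is locally Lipschitz, and let $T>0$. Then for any sequence $\{\zeta_n\}_n$ of subdivisions of $[0,T]$ such that $|\zeta_n|\to 0$, the sequence of iterated minmax $\{R_{H,\zeta_n}^{0,t}v(x)\}_n$ converges, uniformly on compact subsets, to the viscosity solution of $$\partial_t u+H(\partial_x u)=0,\quad t\in(0,T],\qquad u(0,x)=v(x),\quad x\in\mathbb{R}.$$
   Context: Notation: $\|\partial v\|$ is the Lipschitz constant of a globally Lipschitz function $v:\mathbb{R}\to\mathbb{R}$. Minmax. Let $v$ be globally Lipschitz and $H$ locally Lipschitz. Replace $H$ by a Lipschitz function with compact support that coincides with $H$ on a neighbourhood of $\{|p|\le\|\partial v\|\}$ (still denoted $H$; by convention/known result the value defined below does not depend on this choice). For $t\ge 0$, $x\in\mathbb{R}$, set $$S_t(x,x_0,y_0)=v(x_0)-tH(y_0)+(x-x_0)y_0,\qquad (x_0,y_0)\in\mathbb{R}^2 .$$ Fix $(t,x)$ and let $f=S_t(x,\cdot):\mathbb{R}^2\to\mathbb{R}$; $f$ equals the quadratic form $Q(x_0,y_0)=-x_0y_0$ (of Morse index $1$) plus a globally Lipschitz function. Put $f^c=\{\eta: f(\eta)\le c\}$. For $c$ large the homotopy types of $f^{c}$ and $f^{-c}$ do not depend on $c$; write $f^{\infty},f^{-\infty}$. Then $H_1(f^{\infty},f^{-\infty};\mathbb{Z}_2)\cong\mathbb{Z}_2$, with generator $\Xi$. Define $$R_H^t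 v(x)=\inf\max S_t(x,\cdot):=\inf_{[\sigma]=\Xi}\ \max_{\eta\in|\sigma|}f(\eta),$$ where $\sigma$ runs over relative cycles representing $\Xi$ and $|\sigma|$ is the support of $\sigma$. The function $R_H^tv$ is again globally Lipschitz with $\|\partial(R_H^tv)\|\le\|\partial v\|$, so these operators can be composed. For $s\le t$ write $R_s^t:=R_H^{t-s}$. Iterated minmax. A subdivision of $[0,T]$ is $\zeta=\{0=t_0<t_1<\dots<t_N=T\}$, with $|\zeta|=\max_i|t_{i+1}-t_i|$. For $t\in[0,T]$ let $m$ be such that $t_m\le t<t_{m+1}$ (with $m=N$ if $t=T$). Then $$R_{H,\zeta}^{0,t}v:=R_{t_m}^{t}\circ R_{t_{m-1}}^{t_m}\circ\cdots\circ R_{t_0}^{t_1}v .$$ Viscosity solution. A function $u\in C^0((0,T)\times\mathbb{R})$ is a viscosity subsolution (resp. supersolution) of $\partial_tu+H(\partial_xu)=0$ if for every $\psi\in C^1((0,T)\times\mathbb{R})$ and every point $(t,x)$ at which $u-\psi$ attains a local maximum (resp. minimum), $\partial_t\psi(t,x)+H(\partial_x\psi(t,x))\le 0$ (resp. $\ge 0$). It is a viscosity solution if it is both. ''The'' viscosity solution of the Cauchy problem is the unique uniformly continuous function on $[0,T]\times\mathbb{R}$ that is a viscosity solution on $(0,T)\times\mathbb{R}$ and satisfies $u(0,\cdot)=v$. *)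

(* Defs.v *)
From HB Require Import structures.
From mathcomp Require Import all_boot all_order all_algebra.
From mathcomp Require Import all_classical all_reals all_analysis.
From mathcomp Require Import freeg.

Set Implicit Arguments.
Unset Strict Implicit.
Unset Printing Implicit Defensive.
Import Order.TTheory GRing.Theory Num.Theory.
Import numFieldNormedType.Exports.
Local Open Scope classical_set_scope.
Local Open Scope ring_scope.

Section SingularSimplices.
Variable R : realType.

Definition simplex (n : nat) : set 'rV[R]_n.+1 :=
  [set x | (forall i, 0 <= x 0 i) /\ \sum_i x 0 i = 1].

(* The affine map sending the vertices of the n-simplex, in order, to the
   vertices of the (n+1)-simplex other than the i-th one. *)
Definition face_row (n : nat) (i : 'I_n.+2) (x : 'rV[R]_n.+1) : 'rV[R]_n.+2 :=
  \row_j (if unlift i j is Some k then x 0 k else 0).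

Lemma face_row_simplex n i x : @simplex n x -> @simplex n.+1 (face_row i x).
Proof.
move=> [x0 x1]; split=> [j|].
  by rewrite mxE; case: unlift.
rewrite (bigD1_ord i) //= mxE unlift_none add0r -[RHS]x1.
by apply: eq_bigr => k _; rewrite mxE liftK.
Qed.

Definition face (n : nat) (i : 'I_n.+2) (x : @simplex n) : @simplex n.+1 :=
  SigSub (mem_set (face_row_simplex i (set_valP x))).

Lemma face_row_continuous n (i : 'I_n.+2) : continuous (@face_row n i).
Proof.
move=> x A [P Px PA]; rewrite /= nbhs_simpl /=.
have F : Filter (nbhs x) by exact: nbhs_filter.
have : \forall y \near nbhs x, forall j, P 0 j (face_row i y 0 j); last first.
  by apply: filterS => y Py; apply: PA => k j; rewrite (ord1 k).
apply: filter_forall => j; have := Px 0 j; rewrite mxE.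
case: (unliftP i j) => [k -> Pj|-> Pj].
  have := @coord_continuous R _ _ 0 k x _ Pj; rewrite nbhs_simpl/=.
  by apply: filterS => y; rewrite /preimage /= mxE liftK.
apply: nearW => y; rewrite mxE unlift_none; exact: nbhs_singleton Pj.
Qed.

Lemma face_continuous n (i : 'I_n.+2) : continuous (@face n i).
Proof.
apply/continuous_comp_initial => x.
apply: (@continuous_comp _ _ _ (@set_val _ (@simplex n)) (@face_row n i)).
  exact: initial_continuous.
exact: face_row_continuous.
Qed.

HB.instance Definition _ n (i : 'I_n.+2) :=
  @isContinuous.Build _ _ (@face n i) (@face_continuous n i).

End SingularSimplices.

Section SingularHomology.
Variables (R : realType) (U : topologicalType).

Definition singular_simplex (n : nat) := continuousType (@simplex R n) U.

Definition chain (n : nat) := {freeg (singular_simplex n) / 'F_2}.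

Definition boundary (n : nat) : chain n.+1 -> chain n :=
  fglift (fun s : singular_simplex n.+1 =>
    \sum_(i < n.+2) << (s \o face i : singular_simplex n) >>).

(* The support |c| of a chain: the union of the images of its simplices. *)
Definition carrier (n : nat) (c : chain n) : set U :=
  [set y | exists2 s, s \in dom c & range s y].

Definition relative_cycle (X A : set U) (n : nat) (c : chain n.+1) :=
  carrier c `<=` X /\ carrier (boundary c) `<=` A.

Definition homologous (X A : set U) (n : nat) (c c' : chain n.+1) :=
  exists b : chain n.+2, exists a : chain n.+1,
    [/\ carrier b `<=` X, carrier a `<=` A & c - c' = boundary b + a].

(* k |-> k [c] is an isomorphism from Z_2 onto H_(n+1)(X, A; Z_2). *)
Definition generates_homology (X A : set U) (n : nat) (c : chain n.+1) :=
  relative_cycle X A c /\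
  forall c', relative_cycle X A c' ->
    exists! k : 'F_2, homologous X A c' (k *: c).

End SingularHomology.

Section Minmax.
Variable R : realType.
Implicit Types (f : R * R -> R) (H v : R -> R).

Definition sublevel f (c : R) : set (R * R) := [set z | f z <= c].

(* The values max_{|s|} f, for s a relative cycle in the generating class. *)
Definition maxima f (c : R) : set R :=
  [set m | exists2 s : chain R (R * R)%type 1,
    generates_homology (sublevel f c) (sublevel f (- c)) s &
    (f @` carrier s `&` ubound (f @` carrier s)) m].

(* For c large the pair of sublevel sets is, up to homotopy, independent of c
   and so is the infimum; the limit selects this common value. *)
Definition infmax f : R := lim (inf (maxima f c) @[c --> +oo]).

Definition lipschitz_constant v : R := inf [set k | k.-lipschitz v].

(* Compactly supported Lipschitz functions equal to H near [-L, L]. *)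
Definition truncation H (L : R) : set (R -> R) :=
  [set G | [/\ lipschitz G,
     compact (closure [set p | G p != 0]) &
     set_nbhs [set p : R | `|p| <= L] [set p | G p = H p]]].

Definition generating_function H v (t x : R) (z : R * R) : R :=
  v z.1 - t * H z.2 + (x - z.1) * z.2.

(* [get] selects an arbitrary truncation of H; the value of the minmax does not
   depend on which one. *)
Definition minmax H (t : R) v (x : R) : R :=
  infmax (generating_function
    (get (truncation H (lipschitz_constant v))) v t x).

(* The subdivision {t_0 < t_1 < ... < t_N} is given as t_0 and
   s = [:: t_1; ...; t_N]. *)
Fixpoint iterated_minmax H (t0 : R) (s : seq R) v (t : R) : R -> R :=
  match s with
  | t1 :: s' =>
      if t < t1 then minmax H (t - t0) v
      else iterated_minmax H t1 s' (minmax H (t1 - t0) v) t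
  | [::] => minmax H (t - t0) v
  end.

Definition mesh (t0 : R) (s : seq R) : R :=
  \big[Num.max/0]_(i < size s) `|nth 0 s i - nth 0 (t0 :: s) i|.

End Minmax.

Section Viscosity.
Variable R : realType.
Implicit Types (H v : R -> R) (u psi : R * R -> R) (T : R).

Definition locally_lipschitz H :=
  forall p : R, exists2 U : set R, nbhs p U & [lipschitz H q | q in U].

Definition open_strip T : set (R * R) := [set z | 0 < z.1 < T].
Definition closed_strip T : set (R * R) := [set z | 0 <= z.1 <= T].

Definition C1_on (A : set (R * R)) psi :=
  forall z, A z -> differentiable psi z /\
    forall h, {for z, continuous ('D_h psi)}.

Definition dt psi : R * R -> R := 'D_(1, 0) psi.
Definition dx psi : R * R -> R := 'D_(0, 1) psi.

Definition viscosity_subsolution T H u :=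
  {within open_strip T, continuous u} /\
  forall psi z, C1_on (open_strip T) psi -> open_strip T z ->
    (\forall w \near z, u w - psi w <= u z - psi z) ->
    dt psi z + H (dx psi z) <= 0.

Definition viscosity_supersolution T H u :=
  {within open_strip T, continuous u} /\
  forall psi z, C1_on (open_strip T) psi -> open_strip T z ->
    (\forall w \near z, u w - psi w >= u z - psi z) ->
    dt psi z + H (dx psi z) >= 0.

Definition viscosity_solution T H u :=
  viscosity_subsolution T H u /\ viscosity_supersolution T H u.

Definition cauchy_viscosity_solution T H v u :=
  [/\ unif_continuous (u : subspace (closed_strip T) -> R),
      viscosity_solution T H u &
      forall x, u (0, x) = v x].

End Viscosity.

(* Main.v *)
Require Import Defs.
From mathcomp Require Import all_boot all_order all_algebra.
From mathcomp Require Import all_classical all_reals all_analysis.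
From mathcomp Require Import freeg ring lra.

(** The minmax of S_t (x, .) is a mountain pass level. With x moved to the origin,
    S_t (x, .) reads A (xi) + B (y) - xi * y, where A (xi) = v (x + xi) and B = - t H
    are Lipschitz. Outside a large square such a function is monotone in each
    coordinate ([saddle]). A high sublevel set is contractible, a low one consists
    of two pieces around the two ends of the diagonal xi = y, so that a relative
    1-cycle generates if and only if an odd number of its endpoints lie at the
    upper end ([generatesP]). The diagonal is a generator, and every generator
    crosses the antidiagonal.

    It follows that a continuous map of the plane that lowers one function to
    another one, and does not mix up the ends, compares the two minmax levels
    ([infmax_pushforward]). All properties of the minmax come from maps of this
    kind: translations, the exchange of the coordinates, and shears. The shears
    show that only the values of A at distance at most Lip (B) from 0, and the
    values of B at distance at most Lip (A) from 0, matter
    ([sep_minmax_le_left], [sep_minmax_le_right]). Therefore the minmax does not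
    depend on the truncation of H ([minmaxE]), preserves Lipschitz constants
    ([minmax_lip]) and propagates information at finite speed. If moreover the
    slopes of A stay within kappa of p, then B may be replaced by the constants
    that bound it near p ([sep_minmax_upper], [sep_minmax_lower]): a function
    whose slopes are close to p goes down at a speed close to H (p), and this
    persists under iteration ([iterated_barrier]).

    The iterated minmax functions are thus Lipschitz in space, and Lipschitz in
    time up to a multiple of the mesh. Take a limit u of them along an
    ultrafilter. If a smooth function psi touches u from above at a point z, then
    near z the limit u lies below a cone of opening kappa over the tangent plane
    of psi. This cone is a barrier with slopes near the space derivative of psi,
    so that the equation holds at z as an inequality up to a multiple of kappa
    ([ultralimit_touching]); the situation from below is symmetric. So every such
    limit is a viscosity solution with initial value v.

    Doubling of variables gives a comparison principle in which one of the two
    functions is Lipschitz in space and the other one uniformly continuous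
    ([comparison_strip]); the slopes that occur remain bounded, hence a locally
    Lipschitz H is enough. This yields uniqueness. In particular the limits along
    all ultrafilters and for all sequences of subdivisions agree, which forces
    convergence, and equicontinuity makes it uniform on compact sets. *)

Import Order.TTheory GRing.Theory Num.Theory.
Import numFieldNormedType.Exports.
Local Open Scope classical_set_scope.
Local Open Scope ring_scope.
Set Implicit Arguments.
Unset Strict Implicit.
Unset Printing Implicit Defensive.

(** * Singular chains modulo 2 in low dimensions *)
Section ContinuityToolkit.
Context {R : realType} {T : topologicalType}.
Implicit Types f g : T -> R.

Lemma ctsD f g : continuous f -> continuous g -> continuous (fun x => f x + g x).
Proof. by move=> cf cg x; apply: cvgD; [exact: cf|exact: cg]. Qed.

Lemma ctsN f : continuous f -> continuous (fun x => - f x).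
Proof. by move=> cf x; apply: cvgN; exact: cf. Qed.

Lemma ctsM f g : continuous f -> continuous g -> continuous (fun x => f x * g x).
Proof. by move=> cf cg x; apply: cvgM; [exact: cf|exact: cg]. Qed.

Lemma ctsV f : (forall x, f x != 0) -> continuous f -> continuous (fun x => (f x)^-1).
Proof.
by move=> f0 cf x; apply: (@cvgV _ _ _ (nbhs_filter x)); [exact: f0|exact: cf].
Qed.

Lemma cts_max f g :
  continuous f -> continuous g -> continuous (fun x => Num.max (f x) (g x)).
Proof.
by move=> cf cg x; apply: (@continuous_max _ _ f g); [exact: cf|exact: cg].
Qed.

Lemma cts_min f g :
  continuous f -> continuous g -> continuous (fun x => Num.min (f x) (g x)).
Proof.
by move=> cf cg x; apply: (@continuous_min _ _ f g); [exact: cf|exact: cg].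
Qed.

Lemma cts_pair {V W : topologicalType} (f : T -> V) (g : T -> W) :
  continuous f -> continuous g -> continuous (fun x => (f x, g x)).
Proof. by move=> cf cg x; apply: cvg_pair; [exact: cf|exact: cg]. Qed.

Lemma cts_comp {V W : topologicalType} (f : T -> V) (g : V -> W) :
  continuous g -> continuous f -> continuous (fun x => g (f x)).
Proof. by move=> cg cf x; apply: continuous_comp; [exact: cf|exact: cg]. Qed.

Lemma cts_cst {V : topologicalType} (c : V) : continuous (fun _ : T => c).
Proof. by move=> x; exact: cvg_cst. Qed.

Lemma cts_id : continuous (fun x : T => x).
Proof. by move=> x; exact: cvg_id. Qed.

Lemma cts_fst {V W : topologicalType} (f : T -> V * W) :
  continuous f -> continuous (fun x => (f x).1).
Proof. by move=> cf x; apply: cvg_comp (cf x) _; exact: cvg_fst. Qed.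

Lemma cts_snd {V W : topologicalType} (f : T -> V * W) :
  continuous f -> continuous (fun x => (f x).2).
Proof. by move=> cf x; apply: cvg_comp (cf x) _; exact: cvg_snd. Qed.

End ContinuityToolkit.

Ltac cts_step := lazymatch goal with
  | |- continuous (fun _ => ?c) => exact: cts_cst
  | |- continuous (fun x => x) => exact: cts_id
  | |- continuous (fun x => (@?f x + @?g x)%R) => apply: (@ctsD _ _ f g)
  | |- continuous (fun x => (- @?f x)%R) => apply: (@ctsN _ _ f)
  | |- continuous (fun x => (@?f x * @?g x)%R) => apply: (@ctsM _ _ f g)
  | |- continuous (fun x => Num.max (@?f x) (@?g x)) => apply: (@cts_max _ _ f g)
  | |- continuous (fun x => Num.min (@?f x) (@?g x)) => apply: (@cts_min _ _ f g)
  | |- continuous (fun x => (@?f x, @?g x)) => apply: (@cts_pair _ _ _ f g)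
  | |- continuous (fun x => (@?f x).1) => apply: (@cts_fst _ _ _ f)
  | |- continuous (fun x => (@?f x).2) => apply: (@cts_snd _ _ _ f)
  end.
Ltac cts := repeat first [ assumption | cts_step ].

Section ModTwoChains.

Lemma F2_cases (k : 'F_2) : k = 0 \/ k = 1.
Proof.
by case: k => [[|[|//]]] i; [left|right]; apply: val_inj.
Qed.

Lemma F2_lmod_addxx (M : lmodType 'F_2) (x : M) : x + x = 0.
Proof.
rewrite -[x]scale1r -scalerDl.
have -> : 1 + 1 = 0 :> 'F_2 by apply: val_inj.
by rewrite scale0r.
Qed.

Lemma F2_lmod_opp (M : lmodType 'F_2) (x : M) : - x = x.
Proof. by apply/eqP; rewrite eq_sym -addr_eq0 F2_lmod_addxx. Qed.

Variable K : choiceType.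
Implicit Types c d : {freeg K / 'F_2}.

Lemma chain_sumE c : c = \sum_(s <- dom c) << s >>.
Proof.
rewrite -[LHS]freeg_sumE big_seq [RHS]big_seq; apply: eq_bigr => s.
by rewrite mem_dom => cs; case: (F2_cases (coeff s c)) cs => ->.
Qed.

Variables (M : lmodType 'F_2) (f : K -> M).

Lemma fgliftB c d : fglift f (c - d) = fglift f c - fglift f d.
Proof. exact: lift_is_additive. Qed.

Lemma fglift0 : fglift f 0 = 0.
Proof. by rewrite -[0]subr0 fgliftB subrr. Qed.

Lemma fgliftD c d : fglift f (c + d) = fglift f c + fglift f d.
Proof. by rewrite -{1}[d]F2_lmod_opp fgliftB F2_lmod_opp. Qed.

Lemma fgliftZ k c : fglift f (k *: c) = k *: fglift f c.
Proof.
by case: (F2_cases k) => ->; rewrite ?scale0r ?scale1r// fglift0.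
Qed.

Lemma fglift_big I (r : seq I) (F : I -> {freeg K / 'F_2}) :
  fglift f (\sum_(i <- r) F i) = \sum_(i <- r) fglift f (F i).
Proof.
elim: r => [|i r ih]; first by rewrite !big_nil fglift0.
by rewrite !big_cons fgliftD ih.
Qed.

Lemma fglift1 s : fglift f << s >> = f s.
Proof. by rewrite liftU scale1r. Qed.

Lemma fglift_sum c : fglift f c = \sum_(s <- dom c) f s.
Proof.
by rewrite {1}[c]chain_sumE fglift_big; apply: eq_bigr => s _; rewrite fglift1.
Qed.

End ModTwoChains.

Section Chains.
Variables (R : realType) (U : topologicalType).
Local Notation simp n := (@singular_simplex R U n).
Local Notation chain n := (@chain R U n).

Lemma carrier0 n : carrier (0 : chain n) = set0.
Proof. by apply/seteqP; split => // x [s]; rewrite dom0. Qed.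

Lemma carrierU n (s : simp n) : carrier (<< s >> : chain n) = range s.
Proof.
apply/seteqP; split => [x [t]|x sx].
  by rewrite domU1 mem_seq1 => /eqP ->.
by exists s => //; rewrite domU1 mem_seq1.
Qed.

Lemma carrierD n (c d : chain n) : carrier (c + d) `<=` carrier c `|` carrier d.
Proof.
move=> x [s /domD_subset]; rewrite mem_cat => /orP[] ? ?; [left|right]; by exists s.
Qed.

Lemma carrier_subD n (X : set U) (c d : chain n) :
  carrier c `<=` X -> carrier d `<=` X -> carrier (c + d) `<=` X.
Proof. by move=> cX dX x /carrierD[/cX|/dX]. Qed.

Lemma carrier_subZ n (X : set U) k (c : chain n) :
  carrier c `<=` X -> carrier (k *: c) `<=` X.
Proof.
by case: (F2_cases k) => -> cX; rewrite ?scale1r// scale0r carrier0.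
Qed.

Lemma carrier_sub_big n (X : set U) I (r : seq I) (F : I -> chain n) :
  (forall i, List.In i r -> carrier (F i) `<=` X) ->
  carrier (\sum_(i <- r) F i) `<=` X.
Proof.
elim: r => [|i r ih] rX; first by rewrite big_nil carrier0.
rewrite big_cons; apply: carrier_subD; first by apply: rX; left.
by apply: ih => j jr; apply: rX; right.
Qed.

Lemma mem_In (K : eqType) (s : K) (r : seq K) : List.In s r -> s \in r.
Proof.
elim: r => //= a r ih [->|/ih]; rewrite in_cons ?eqxx// => ->.
by rewrite orbT.
Qed.

Lemma carrier_fglift (W : topologicalType) m n (X : set U)
    (F : @singular_simplex R W m -> chain n) (c : @Defs.chain R W m) :
  (forall s : @singular_simplex R W m, range s `<=` carrier c -> carrier (F s) `<=` X) ->
  carrier (fglift F c) `<=` X.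
Proof.
move=> FX; rewrite fglift_sum; apply: carrier_sub_big => s /mem_In sc.
by apply: FX => x sx; exists s.
Qed.

Lemma boundary_sum n (c : chain n.+1) :
  boundary c = \sum_(s <- dom c) boundary << s >>.
Proof.
by rewrite /boundary fglift_sum; apply: eq_bigr => s _; rewrite fglift1.
Qed.

Lemma boundaryD n (c d : chain n.+1) :
  boundary (c + d) = boundary c + boundary d.
Proof. exact: fgliftD. Qed.

Lemma boundaryZ n k (c : chain n.+1) : boundary (k *: c) = k *: boundary c.
Proof. exact: fgliftZ. Qed.

Lemma boundary_big n I (r : seq I) (F : I -> chain n.+1) :
  boundary (\sum_(i <- r) F i) = \sum_(i <- r) boundary (F i).
Proof. exact: fglift_big. Qed.

Lemma boundaryU n (s : simp n.+1) :
  boundary << s >> = \sum_(i < n.+2) << (s \o face i : simp n) >>.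
Proof. exact: fglift1. Qed.

End Chains.

Section LowSimplices.
Variables (R : realType) (U : topologicalType).
Local Notation simp n := (@singular_simplex R U n).
Local Notation chain n := (@chain R U n).

Lemma simplex_ext n (x y : @simplex R n) :
  (forall i, set_val x 0 i = set_val y 0 i) -> x = y.
Proof.
by move=> xy; apply: val_inj; apply/rowP => i; exact: xy.
Qed.

Lemma simplex_val n (x : 'rV[R]_n.+1) (xS : x \in @simplex R n) :
  set_val (SigSub xS : @simplex R n) = x.
Proof. by []. Qed.

(** Clamping makes the barycentric coordinate of a point of the 1-simplex a
    function defined on the whole line. *)
Definition clamp01 (t : R) : R := Num.max 0 (Num.min t 1).

Lemma clamp01_ge0 t : 0 <= clamp01 t. Proof. by rewrite le_max lexx. Qed.
Lemma clamp01_le1 t : clamp01 t <= 1.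
Proof. by rewrite ge_max ler01 ge_min lexx orbT. Qed.
Lemma clamp01_id t : 0 <= t <= 1 -> clamp01 t = t.
Proof. by move=> /andP[t0 t1]; rewrite /clamp01 min_l// max_r. Qed.
Lemma clamp01_0 t : t <= 0 -> clamp01 t = 0.
Proof. by move=> t0; rewrite /clamp01 max_l// ge_min t0. Qed.
Lemma clamp01_1 t : 1 <= t -> clamp01 t = 1.
Proof. by move=> t1; rewrite /clamp01 min_r// max_r. Qed.

Lemma continuous_clamp01 : continuous clamp01.
Proof. by rewrite /clamp01; cts. Qed.

Definition edge_row (t : R) : 'rV[R]_2 :=
  \row_j (if j == 0 then 1 - clamp01 t else clamp01 t).

Lemma edge_row_simplex t : edge_row t \in @simplex R 1.
Proof.
rewrite inE; split=> [i|].
  rewrite mxE; case: ifP => _; first by rewrite subr_ge0 clamp01_le1.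
  exact: clamp01_ge0.
by rewrite big_ord_recr big_ord1/= !mxE/= subrK.
Qed.

Definition edge (t : R) : @simplex R 1 := SigSub (edge_row_simplex t).

Lemma continuous_row n (V : topologicalType) (f : V -> 'rV[R]_n) :
  (forall j, continuous (fun x => f x 0 j)) -> continuous f.
Proof.
move=> fc x A [P Px PA]; rewrite /= nbhs_simpl /=.
have : \forall y \near nbhs x, forall j, P 0 j (f y 0 j); last first.
  by apply: filterS => y Py; apply: PA => k j; rewrite (ord1 k).
apply: filter_forall => j; exact: (fc j x _ (Px 0 j)).
Qed.

Lemma continuous_edge : continuous edge.
Proof.
apply/continuous_comp_initial; apply: continuous_row => j.
have -> : (fun t => (set_val \o edge) t 0 j) =
    fun t => if j == 0 then 1 - clamp01 t else clamp01 t.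
  by apply/funext => t; rewrite /= simplex_val mxE.
case: (j == 0); last exact: continuous_clamp01.
by cts; exact: continuous_clamp01.
Qed.

Lemma edgeK (x : @simplex R 1) : edge (set_val x 0 1) = x.
Proof.
have [x0 x1] := set_valP x; rewrite big_ord_recr big_ord1/= in x1.
have -> : set_val x 0 1 = set_val x 0 ord_max.
  by congr (_ _ _); apply: val_inj.
have e : set_val x 0 (widen_ord (leqnSn 1) 0) = set_val x 0 0.
  by congr (_ _ _); apply: val_inj.
rewrite e in x1.
have c : clamp01 (set_val x 0 ord_max) = set_val x 0 ord_max.
  apply: clamp01_id; rewrite x0/=; have := x0 0; lra.
apply: simplex_ext => i; rewrite simplex_val mxE c.
case: ifPn => [/eqP->|i0]; first by rewrite -x1; ring.
by congr (_ _ _); apply: val_inj; case: i i0 => -[|[|]].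
Qed.

Lemma vertex_simplex : (\row_(_ < 1) 1 : 'rV[R]_1) \in @simplex R 0.
Proof.
rewrite inE; split=> [i|]; first by rewrite mxE ler01.
by rewrite big_ord1 mxE.
Qed.

Definition vertex : @simplex R 0 := SigSub vertex_simplex.

Lemma simplex0_vertex (x : @simplex R 0) : x = vertex.
Proof.
apply: simplex_ext => i; rewrite simplex_val mxE (ord1 i).
by have [_] := set_valP x; rewrite big_ord1.
Qed.

Definition pt (z : U) : simp 0 := @cst (@simplex R 0) U z.

Lemma simp0_pt (s : simp 0) : s = pt (s vertex).
Proof. by apply/continuousEP => x; rewrite (simplex0_vertex x). Qed.

Lemma face0_vertex : face 0 vertex = edge 1.
Proof.
apply: simplex_ext => i; rewrite !simplex_val !mxE clamp01_1//.
case: (unliftP 0 i) => [k ->|->]; last by rewrite eqxx subrr.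
by rewrite mxE.
Qed.

Lemma face1_vertex : face 1 vertex = edge 0.
Proof.
apply: simplex_ext => i; rewrite !simplex_val !mxE clamp01_0// subr0.
case: (unliftP 1 i) => [k ->|->]; last by [].
by rewrite mxE (ord1 k); case: eqP => // /eqP; rewrite -val_eqE.
Qed.

Lemma boundary1 (s : simp 1) :
  boundary << s >> = << pt (s (edge 1)) >> + << pt (s (edge 0)) >>.
Proof.
rewrite boundaryU big_ord_recr big_ord1/=.
have -> : widen_ord (leqnSn 1) 0 = 0 :> 'I_2 by apply: val_inj.
have -> : ord_max = 1 :> 'I_2 by apply: val_inj.
congr (<< _ >> + << _ >>).
  by rewrite [LHS]simp0_pt/= face0_vertex.
by rewrite [LHS]simp0_pt/= face1_vertex.
Qed.

(** The intersection number of a 0-chain with A. Applied to boundaries it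
    replaces the computation of homology classes below. *)
Definition weight (A : set U) (d : chain 0) : 'F_2 :=
  fglift (fun s : simp 0 => `[< A (s vertex) >]%:R : ('F_2)^o) d.

Lemma weightD A c d : weight A (c + d) = weight A c + weight A d.
Proof. exact: (@fgliftD _ ('F_2)^o). Qed.

Lemma weightZ A k d : weight A (k *: d) = k * weight A d.
Proof. exact: (@fgliftZ _ ('F_2)^o). Qed.

Lemma weightU A z : weight A << pt z >> = `[< A z >]%:R.
Proof. exact: (@fglift1 _ ('F_2)^o). Qed.

Lemma weight_big A I (r : seq I) (F : I -> chain 0) :
  weight A (\sum_(i <- r) F i) = \sum_(i <- r) weight A (F i).
Proof. exact: (@fglift_big _ ('F_2)^o). Qed.

Lemma F2_addxx (k : 'F_2) : k + k = 0.
Proof. exact: (@F2_lmod_addxx ('F_2)^o). Qed.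

(** The two ends of a simplex are both counted or both left out. *)
Lemma weight_boundary A (c : chain 1) :
  (forall s : simp 1, range s `<=` carrier c ->
     A (s (edge 0)) <-> A (s (edge 1))) ->
  weight A (boundary c) = 0.
Proof.
move=> cA; rewrite boundary_sum weight_big big_seq big1// => s sc.
rewrite boundary1 weightD !weightU.
have /cA/propext -> : range s `<=` carrier c by move=> x sx; exists s.
exact: F2_addxx.
Qed.

(** The six corners of the three edges of a triangle coincide in pairs. *)
Lemma weight_boundary2 A (b : chain 2) : weight A (boundary (boundary b)) = 0.
Proof.
rewrite [boundary b]boundary_sum boundary_big weight_big big1_seq// => s _.
rewrite boundaryU boundary_big weight_big 2!big_ord_recr big_ord1/=.
rewrite !boundary1 !weightD !weightU/=.
set i0 := widen_ord _ (widen_ord _ 0); set i1 := widen_ord _ ord_max; set i2 := ord_max.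
have corner i (t : R) j : set_val (face i (edge t)) 0 j =
    if unlift i j is Some k then (if k == 0 then 1 - clamp01 t else clamp01 t)
    else 0.
  by rewrite simplex_val mxE; case: unlift => // k; rewrite -[\val _]/(edge_row t) mxE.
have e01 : face i0 (edge 1) = face i1 (edge 1).
  apply: simplex_ext => j; rewrite !corner (clamp01_1 (lexx 1)).
  by case: j => -[|[|[|//]]] jj;
    do 2 case: unliftP => [[[|[|//]] ?] /(congr1 val)//|/(congr1 val)//]; rewrite /= ?subrr.
have e02 : face i0 (edge 0) = face i2 (edge 1).
  apply: simplex_ext => j; rewrite !corner (clamp01_1 (lexx 1)) (clamp01_0 (lexx 0)).
  by case: j => -[|[|[|//]]] jj;
    do 2 case: unliftP => [[[|[|//]] ?] /(congr1 val)//|/(congr1 val)//]; rewrite /= ?subrr ?subr0.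
have e12 : face i1 (edge 0) = face i2 (edge 0).
  apply: simplex_ext => j; rewrite !corner (clamp01_0 (lexx 0)).
  by case: j => -[|[|[|//]]] jj;
    do 2 case: unliftP => [[[|[|//]] ?] /(congr1 val)//|/(congr1 val)//]; rewrite /= ?subrr ?subr0.
rewrite e01 e02 e12.
set a := _%:R; set b1 := _%:R; set c := _%:R.
rewrite (_ : _ + _ = (a + a) + (b1 + b1) + (c + c)); last by ring.
by rewrite !F2_addxx.
Qed.

End LowSimplices.

(** * Push-forward, separation and cones *)
Section Pushforward.
Variables (R : realType) (U V : topologicalType) (Phi : U -> V).
Hypothesis cPhi : continuous Phi.
Local Notation simp U n := (@singular_simplex R U n).
Local Notation chain U n := (@chain R U n).

Definition push_simplex n (s : simp U n) : simp V n :=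
  (mkcts cPhi : continuousType U V) \o s.

Definition push n (c : chain U n) : chain V n :=
  fglift (fun s : simp U n => << push_simplex s >>) c.

Lemma carrier_push n (c : chain U n) : carrier (push c) `<=` Phi @` carrier c.
Proof.
apply: carrier_fglift => s sc; rewrite carrierU => _ [x _ <-] /=.
by exists (s x) => //; apply: sc; exists x.
Qed.

Lemma boundary_push n (c : chain U n.+1) : boundary (push c) = push (boundary c).
Proof.
rewrite [c in RHS]chain_sumE [push c]fglift_sum !boundary_big [RHS]fglift_big.
apply: eq_bigr => s _; rewrite !boundaryU [RHS]fglift_big; apply: eq_bigr => i _.
by rewrite fglift1; congr << _ >>; apply/continuousEP.
Qed.

Lemma weight_push A (d : chain U 0) : weight A (push d) = weight (Phi @^-1` A) d.
Proof.
rewrite [push d]fglift_sum weight_big [d in RHS]chain_sumE weight_big.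
apply: eq_bigr => s _; rewrite [in RHS](simp0_pt s) weightU.
by rewrite (simp0_pt (push_simplex s)) weightU.
Qed.

End Pushforward.

Section CarrierTopology.
Variables (R : realType) (U : topologicalType).
Local Notation simp n := (@singular_simplex R U n).
Local Notation chain n := (@chain R U n).

Lemma eq_weight (A B : set U) (d : chain 0) :
  (forall z, carrier d z -> A z <-> B z) -> weight A d = weight B d.
Proof.
move=> AB; rewrite [d]chain_sumE !weight_big big_seq [RHS]big_seq.
apply: eq_bigr => s sd; rewrite (simp0_pt s) !weightU.
suff -> : A (s (vertex R)) = B (s (vertex R)) by [].
by apply/propext; apply: AB; exists s => //; exists (vertex R).
Qed.

Lemma compact_carrier (c : chain 1) : compact (carrier c).
Proof.
have -> : carrier c = \big[setU/set0]_(s <- dom c) range s.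
  rewrite -bigcup_seq; apply/seteqP; split => x [s sc sx]; by exists s.
apply: (@bigsetU_compact U _ (fun s : simp 1 => range s)) => s _.
have -> : range s = (s \o @edge R) @` `[0, 1].
  apply/seteqP; split => [_ [x _ <-]|_ [t _ <-]]; last by exists (edge t).
  have [x0 x1] := set_valP x; exists (set_val x 0 1); last by rewrite /= edgeK.
  rewrite /= in_itv/= x0/= -x1 big_ord_recr big_ord1/=.
  have -> : ord_max = 1 :> 'I_2 by apply: val_inj.
  by rewrite lerDr x0.
apply: continuous_compact; last exact: segment_compact.
apply: continuous_subspaceT => t; apply: continuous_comp.
  exact: continuous_edge.
exact: cts_fun.
Qed.

Lemma carrier_max (f : U -> R) (c : chain 1) : continuous f -> carrier c !=set0 ->
  exists2 z, carrier c z & forall z', carrier c z' -> f z' <= f z.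
Proof.
move=> cf c0.
have [z zc fz] := compact_EVT_max c0 (@compact_carrier c) (continuous_subspaceT cf).
exists z; first by rewrite inE in zc.
by move=> z' z'c; apply: fz; rewrite inE.
Qed.

(** A 1-chain that avoids the complement of two disjoint open sets does not
    cross from one to the other, since each of its simplices is connected: the
    endpoints lying in P pair off. *)
Lemma weight_separated (P N : set U) (c : chain 1) : open P -> open N ->
  P `&` N = set0 -> carrier c `<=` P `|` N -> weight P (boundary c) = 0.
Proof.
move=> oP oN PN0 cPN; apply: weight_boundary => s sc.
pose g := s \o @edge R.
have cg : continuous g.
  by move=> t; apply: continuous_comp; [exact: continuous_edge|exact: cts_fun].
have gPN t : P (g t) \/ N (g t) by apply/cPN/sc; exists (edge t).
have notboth t : P (g t) -> N (g t) -> False.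
  by move=> Pt Nt; rewrite -[False]/(set0 (g t)) -PN0.
have conn : connected `[0 : R, 1] by apply: segment_connected.
have key : forall X Y : set U, open X -> open Y -> (forall t, X (g t) \/ Y (g t)) ->
    (forall t, X (g t) -> Y (g t) -> False) -> forall t0 t1,
    `[0, 1]%classic t0 -> `[0, 1]%classic t1 -> X (g t0) -> X (g t1).
  move=> X Y oX oY XY nXY t0 t1 t0I t1I Xt0.
  have E : `[0, 1]%classic `&` g @^-1` X = `[0, 1]%classic.
    apply: conn.
    - by exists t0.
    - exists (g @^-1` X) => //; apply: open_comp => // t _; exact: cg.
    - exists (~` (g @^-1` Y)).
        by apply: open_closedC; apply: open_comp => // t _; exact: cg.
      congr (_ `&` _); apply/seteqP; split => t /=; first by move=> Xt /(nXY t Xt).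
      by case: (XY t).
  by move: t1I; rewrite -{1}E => -[].
have i0 : `[0, 1]%classic (0 : R) by rewrite /= in_itv/= lexx ler01.
have i1 : `[0, 1]%classic (1 : R) by rewrite /= in_itv/= lexx ler01.
by split; apply: (key P N).
Qed.

End CarrierTopology.

Section Cone.
Variables (R : realType) (U : topologicalType).
Local Notation simp n := (@singular_simplex R U n).
Local Notation chain n := (@chain R U n).

Definition mksimplex n (g : 'rV[R]_n.+1 -> U) (cg : continuous g) : simp n :=
  (mkcts cg : continuousType _ _) \o
  (mkcts (@initial_continuous _ _ (@set_val _ (@simplex R n))) :
     continuousType (@simplex R n) _).

Lemma continuous_coord n (j : 'I_n.+1) : continuous (fun x : 'rV[R]_n.+1 => x 0 j).
Proof. by move=> x; exact: coord_continuous. Qed.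

Section Path.
Variable (g : R -> U).
Hypothesis cg : continuous g.

Lemma path_row_continuous : continuous (fun x : 'rV[R]_2 => g (x 0 1)).
Proof. by apply: cts_comp => //; exact: continuous_coord. Qed.

Definition path_simplex : simp 1 := mksimplex path_row_continuous.

Lemma path_simplexE (x : @simplex R 1) : path_simplex x = g (set_val x 0 1).
Proof. by []. Qed.

Lemma boundary_path : boundary << path_simplex >> = << pt R (g 1) >> + << pt R (g 0) >>.
Proof.
rewrite boundary1 !path_simplexE !simplex_val !mxE/=.
by rewrite (clamp01_1 (lexx 1)) (clamp01_0 (lexx 0)).
Qed.

Lemma carrier_path (X : set U) : (forall t, 0 <= t <= 1 -> X (g t)) ->
  carrier << path_simplex >> `<=` X.
Proof.
move=> gX; rewrite carrierU => _ [x _ <-]; rewrite path_simplexE; apply: gX.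
have [x0 x1] := set_valP x; rewrite x0/= -x1 big_ord_recr big_ord1/=.
have -> : ord_max = 1 :> 'I_2 by apply: val_inj.
by rewrite lerDr x0.
Qed.

End Path.

Variables (h : R * U -> U) (base : U).
Hypothesis ch : continuous h.
Hypothesis h0 : forall z, h (0, z) = z.
Hypothesis h1 : forall t z, 2^-1 <= t -> h (t, z) = base.

Lemma spoke_continuous z : continuous (fun t : R => h (1 - t, z)).
Proof. by apply: cts_comp => //; cts. Qed.

(** The contraction has come to rest at time 1/2, so the quotient may be kept
    constant from then on, which keeps it continuous at the apex of the cone. *)
Definition cone_row (s : simp 1) (x : 'rV[R]_3) : U :=
  h (x 0 0, s (edge (x 0 2 / Num.max (1 - x 0 0) 2^-1))).

Lemma cone_row_continuous s : continuous (cone_row s).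
Proof.
apply: cts_comp => //; apply: cts_pair; first exact: continuous_coord.
apply: (@cts_comp _ _ _ _ s); first exact: cts_fun.
apply: cts_comp; first exact: continuous_edge.
apply: ctsM; first exact: continuous_coord.
apply: ctsV.
  by move=> x; rewrite gt_eqF// lt_max invr_gt0 ltr0n orbT.
by cts; exact: continuous_coord.
Qed.

Definition cone (s : simp 1) : simp 2 := mksimplex (@cone_row_continuous s).

Definition spoke (s : simp 0) : simp 1 :=
  path_simplex (@spoke_continuous (s (vertex R))).

Lemma face_lift n (i : 'I_n.+2) (x : @simplex R n) k :
  set_val (face i x) 0 (fintype.lift i k) = set_val x 0 k.
Proof. by rewrite simplex_val mxE liftK. Qed.

Lemma face_at n (i : 'I_n.+2) (x : @simplex R n) : set_val (face i x) 0 i = 0.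
Proof. by rewrite simplex_val mxE unlift_none. Qed.

(** The edge opposite to the apex is the simplex itself, the other two edges are
    the tracks of its ends under the contraction. *)
Lemma boundary_cone s : boundary << cone s >> =
  << s >> + (<< spoke (pt R (s (edge 1))) >> + << spoke (pt R (s (edge 0))) >>).
Proof.
rewrite boundaryU 2!big_ord_recr big_ord1/= -addrA.
have sumx (x : @simplex R 1) : set_val x 0 0 = 1 - set_val x 0 1.
  have [_ <-] := set_valP x; rewrite big_ord_recr big_ord1/=.
  have -> : ord_max = 1 :> 'I_2 by apply: val_inj.
  have -> : widen_ord (leqnSn 1) 0 = 0 :> 'I_2 by apply: val_inj.
  by ring.
have x01 (x : @simplex R 1) : 0 <= set_val x 0 1 <= 1.
  have [x0 _] := set_valP x; have := sumx x; have := x0 0; have := x0 1; lra.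
have half : 2^-1 < 1 :> R by lra.
rewrite (_ : widen_ord _ (widen_ord _ 0) = 0); last exact: val_inj.
rewrite (_ : widen_ord _ ord_max = 1); last exact: val_inj.
have l10 : 0 = fintype.lift (1 : 'I_3) (0 : 'I_2) by apply: val_inj.
have l20 : 0 = fintype.lift (ord_max : 'I_3) (0 : 'I_2) by apply: val_inj.
have l01 : 2 = fintype.lift (0 : 'I_3) (1 : 'I_2) by apply: val_inj.
have l11 : 2 = fintype.lift (1 : 'I_3) (1 : 'I_2) by apply: val_inj.
have max2 : ord_max = 2 :> 'I_3 by apply: val_inj.
congr (<< _ >> + (<< _ >> + << _ >>)); apply/continuousEP => x.
- rewrite [LHS]/(cone_row s (set_val (face _ x))) /cone_row.
  rewrite face_at l01 face_lift subr0 max_l ?(ltW half)// divr1 h0.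
  by rewrite edgeK.
- rewrite [LHS]/(cone_row s (set_val (face _ x))) /cone_row.
  rewrite path_simplexE l10 face_lift l11 face_lift sumx.
  case: (leP 2^-1 (1 - set_val x 0 1)) => xs; first by rewrite !h1.
  rewrite (_ : 1 - (1 - set_val x 0 1) = set_val x 0 1); last by ring.
  rewrite max_l ?divff//=; last 2 first.
    by rewrite gt_eqF//; lra.
    by lra.
- rewrite [LHS]/(cone_row s (set_val (face _ x))) /cone_row.
  rewrite path_simplexE l20 face_lift -max2 face_at mul0r sumx//.
Qed.

Lemma boundary_cone_chain (c : chain 1) :
  boundary (fglift (fun s : simp 1 => << cone s >>) c) =
  c + fglift (fun s : simp 0 => << spoke s >>) (boundary c).
Proof.
rewrite fglift_sum boundary_big boundary_sum fglift_big.
rewrite {2}[c]chain_sumE -big_split/=; apply: eq_bigr => s _.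
by rewrite boundary_cone boundary1 fgliftD !fglift1.
Qed.

(** Coning off a cycle fills it, because the tracks of its boundary points
    cancel. *)
Lemma contractible_cycle_bounds (X : set U) (c : chain 1) :
  (forall t z, 0 <= t <= 1 -> X z -> X (h (t, z))) ->
  carrier c `<=` X -> boundary c = 0 ->
  exists2 b : chain 2, carrier b `<=` X & boundary b = c.
Proof.
move=> hX cX c0; exists (fglift (fun s : simp 1 => << cone s >>) c); last first.
  by rewrite boundary_cone_chain c0 fglift0 addr0.
apply: carrier_fglift => s sc; rewrite carrierU => _ [x _ <-].
rewrite -[cone s x]/(cone_row s (set_val x)); apply: hX; last first.
  by apply: cX; apply: sc; exists (edge (set_val x 0 2 / Num.max (1 - set_val x 0 0) 2^-1)).
have [x0 x1] := set_valP x; rewrite x0/= -x1 2!big_ord_recr big_ord1/=.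
rewrite (_ : widen_ord _ (widen_ord _ 0) = 0); last exact: val_inj.
by rewrite -addrA lerDl addr_ge0.
Qed.

End Cone.

(** * Functions that behave like a saddle at infinity *)
Ltac split_minmax := repeat match goal with
  | |- context [Num.max ?a ?b] =>
    lazymatch a with context [Num.max] => fail | context [Num.min] => fail | _ =>
    lazymatch b with context [Num.max] => fail | context [Num.min] => fail | _ =>
    case: (leP a b) => ? end end
  | |- context [Num.min ?a ?b] =>
    lazymatch a with context [Num.max] => fail | context [Num.min] => fail | _ =>
    lazymatch b with context [Num.max] => fail | context [Num.min] => fail | _ =>
    case: (leP a b) => ? end end
  end.

Section Saddle.
Variable R : realType.
Implicit Types (f : R * R -> R) (M : R) (z : R * R).

(** The behaviour at infinity of -x0 * y0 plus a Lipschitz function: outside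
    the square of half-side M moving one coordinate changes f at least at unit
    speed, in a direction that is prescribed by the sign of the other one. *)
Record saddle M f : Prop := Saddle {
  saddle_gt0 : 0 < M;
  saddle_cts : continuous f;
  saddle_top : forall y a b, M <= y -> a <= b -> f (b, y) <= f (a, y) - (b - a);
  saddle_bot : forall y a b, y <= - M -> a <= b -> f (a, y) <= f (b, y) - (b - a);
  saddle_right : forall x a b, M <= x -> a <= b -> f (x, b) <= f (x, a) - (b - a);
  saddle_left : forall x a b, x <= - M -> a <= b -> f (x, a) <= f (x, b) - (b - a)
}.

Lemma saddle_widen M M' f : M <= M' -> saddle M f -> saddle M' f.
Proof.
move=> MM' [M0 cf t b r l]; split => //.
- exact: lt_le_trans M0 MM'.
- by move=> y a c My; apply: t; apply: le_trans My.
- by move=> y a c My; apply: b; apply: le_trans My _; rewrite lerN2.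
- by move=> y a c My; apply: r; apply: le_trans My.
- by move=> y a c My; apply: l; apply: le_trans My _; rewrite lerN2.
Qed.

Section Bounds.
Variables (M : R) (f : R * R -> R).
Hypothesis Sf : saddle M f.
Let M0 := saddle_gt0 Sf.
Let cf := saddle_cts Sf.
Let ft := saddle_top Sf.
Let fb := saddle_bot Sf.
Let fr := saddle_right Sf.
Let fl := saddle_left Sf.

Lemma box_bounded D : exists C, forall x y, `|x| <= D -> `|y| <= D -> `|f (x, y)| <= C.
Proof.
have cK : compact (`[- D, D]%classic `*` `[- D, D]%classic : set (R * R)).
  by apply: compact_setX; exact: segment_compact.
have : bounded_set (f @` (`[- D, D]%classic `*` `[- D, D]%classic)).
  apply/compact_bounded/continuous_compact => //.
  exact: continuous_subspaceT.
move=> /ex_strict_bound_gt0[C _ Cf]; exists C => x y xD yD; apply/ltW/Cf.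
by exists (x, y) => //; split; rewrite /= in_itv/= -ler_norml.
Qed.

Lemma diag_decr a b : M <= a -> a <= b -> f (b, b) <= f (a, a) - (b - a).
Proof.
move=> Ma ab; have := ft (le_trans Ma ab) ab; have := fr Ma ab; lra.
Qed.

Lemma diag_incr a b : b <= - M -> a <= b -> f (a, a) <= f (b, b) - (b - a).
Proof.
move=> Mb ab; have := fb (le_trans ab Mb) ab; have := fl Mb ab; lra.
Qed.

(** In the quadrants where x and y have opposite signs f is bounded below by its
    value at the corner of the square, so very negative values are only taken
    near the two ends of the diagonal. *)
Lemma far_ends D : M <= D -> exists C, forall x y, f (x, y) <= - C ->
  [\/ D < x /\ - M < y, D < y /\ - M < x, x < - D /\ y < M | y < - D /\ x < M].
Proof.
move=> MD; have [C Cf] := box_bounded D.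
exists (C + 1) => x y fxy.
have [xD|xD] := ltP D x.
  have [yM|yM] := ltP (- M) y; first by apply: Or41.
  have Mx : M <= x by lra.
  have h1 := fb yM Mx; have h2 := fr (lexx M) yM.
  have : `|f (M, - M)| <= C by apply: Cf; rewrite ?normrN ger0_norm ?(ltW M0).
  by rewrite ler_norml => /andP[]; lra.
have [yD|yD] := ltP D y.
  have [xM|xM] := ltP (- M) x; first by apply: Or42.
  have My : M <= y by lra.
  have h1 := ft My xM; have h2 := fl (lexx (- M)) My.
  have : `|f (- M, M)| <= C by apply: Cf; rewrite ?normrN ger0_norm ?(ltW M0).
  by rewrite ler_norml => /andP[]; lra.
have [xD'|xD'] := ltP x (- D).
  have [yM|yM] := ltP y M; first by apply: Or43.
  have Mx : x <= - M by lra.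
  have h1 := ft yM Mx; have h2 := fl (lexx (- M)) yM.
  have : `|f (- M, M)| <= C by apply: Cf; rewrite ?normrN ger0_norm ?(ltW M0).
  by rewrite ler_norml => /andP[]; lra.
have [yD'|yD'] := ltP y (- D).
  have [xM|xM] := ltP x M; first by apply: Or44.
  have My : y <= - M by lra.
  have h1 := fb My xM; have h2 := fr (lexx M) My.
  have : `|f (M, - M)| <= C by apply: Cf; rewrite ?normrN ger0_norm ?(ltW M0).
  by rewrite ler_norml => /andP[]; lra.
have : `|f (x, y)| <= C by apply: Cf; rewrite ler_norml; lra.
by rewrite ler_norml => /andP[]; lra.
Qed.

Definition positive_side : set (R * R) := [set z | 0 < z.1 + z.2].
Definition negative_side : set (R * R) := [set z | z.1 + z.2 < 0].

(** Around the diagonal f is bounded above, because far from the square it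
    decreases towards the ends; very negative values lie strictly on one side of
    the antidiagonal. *)
Lemma saddle_level : exists C,
  [/\ 0 < C,
      forall x y, `|x - y| <= 2 * M -> f (x, y) <= C &
      forall x y, f (x, y) <= - C ->
        (0 < x + y /\ (M <= x \/ M <= y)) \/ (x + y < 0 /\ (x <= - M \/ y <= - M))].
Proof.
have [C1 C1f] := box_bounded (3 * M).
have [C2 C2f] := far_ends (lexx M).
exists (`|C1| + `|C2| + 1); split.
- by rewrite ltr_wpDl// addr_ge0.
- move=> x y; rewrite ler_norml => /andP[xy1 xy2].
  have CM : f (M, M) <= C1 /\ f (- M, - M) <= C1.
    by split; apply: le_trans (ler_norm _) _; apply: C1f;
       rewrite ?normrN ger0_norm ?(ltW M0)//; lra.
  have Cn := ler_norm C1; have C2n := normr_ge0 C2.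
  have [xM|xM] := leP (3 * M) x.
    have Mx : M <= x by lra.
    have My : M <= y by lra.
    have := ft My Mx; have := fr (lexx M) My; lra.
  have [yM|yM] := leP (3 * M) y.
    have Mx : M <= x by lra.
    have My : M <= y by lra.
    have := ft My Mx; have := fr (lexx M) My; lra.
  have [xM'|xM'] := leP x (- (3 * M)).
    have Mx : x <= - M by lra.
    have My : y <= - M by lra.
    have := fb My Mx; have := fl (lexx (- M)) My; lra.
  have [yM'|yM'] := leP y (- (3 * M)).
    have Mx : x <= - M by lra.
    have My : y <= - M by lra.
    have := fb My Mx; have := fl (lexx (- M)) My; lra.
  have := C1f x y; rewrite !ler_norml => h.
  have : - C1 <= f (x, y) <= C1 by apply: h; lra.
  lra.
- move=> x y fxy; have Cn := ler_norm C2; have C2n := normr_ge0 C1.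
  have : f (x, y) <= - C2 by lra.
  move=> /C2f[] [h1 h2].
  + by left; split; [lra|left; lra].
  + by left; split; [lra|right; lra].
  + by right; split; [lra|left; lra].
  + by right; split; [lra|right; lra].
Qed.

End Bounds.

Section Contraction.
Variables (M : R) (f : R * R -> R).
Hypothesis Sf : saddle M f.
Let M0 := saddle_gt0 Sf.
Let cf := saddle_cts Sf.
Let ft := saddle_top Sf.
Let fb := saddle_bot Sf.
Let fr := saddle_right Sf.
Let fl := saddle_left Sf.

Definition soft_threshold (x : R) : R := x - Num.max (- M) (Num.min x M).

Definition corner_shift (x y : R) : R :=
  Num.min (Num.max (- x - M) 0) (Num.max (y - M) 0) -
  Num.min (Num.max (x - M) 0) (Num.max (- y - M) 0).

(** Three moves contract the plane without raising f above a fixed level. The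
    first one empties the open quadrants in which f is large, the second one
    carries what remains to a band around the diagonal, the third one shrinks
    that band to a point. *)
Definition move1 (s : R) z : R * R :=
  (z.1 + s * corner_shift z.1 z.2, z.2 - s * corner_shift z.1 z.2).
Definition move2 (s : R) z : R * R := (z.1 + s * soft_threshold z.2, z.2 + s * soft_threshold z.1).
Definition move3 (s : R) z : R * R := ((1 - s) * z.1, (1 - s) * z.2).

(** The moves take place during the three sixths of the interval [0, 1/2]. *)
Definition saddle_contraction (p : R * (R * R)) : R * R :=
  move3 (clamp01 (6 * p.1 - 2))
    (move2 (clamp01 (6 * p.1 - 1)) (move1 (clamp01 (6 * p.1)) p.2)).

Lemma soft_threshold_cts : continuous soft_threshold.
Proof. by rewrite /soft_threshold; cts. Qed.

Lemma corner_shift_cts : continuous (fun z => corner_shift z.1 z.2).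
Proof. by rewrite /corner_shift; cts. Qed.

Section MoveContinuity.
Variables (T : topologicalType) (s : T -> R) (g : T -> R * R).
Hypotheses (cs : continuous s) (cg : continuous g).

Lemma move1_cts : continuous (fun p => move1 (s p) (g p)).
Proof.
have cd := cts_comp corner_shift_cts cg.
by rewrite /move1; cts.
Qed.

Lemma move2_cts : continuous (fun p => move2 (s p) (g p)).
Proof.
have c1 := cts_comp soft_threshold_cts (cts_fst cg); have c2 := cts_comp soft_threshold_cts (cts_snd cg).
by rewrite /move2; cts.
Qed.

Lemma move3_cts : continuous (fun p => move3 (s p) (g p)).
Proof. by rewrite /move3; cts. Qed.

End MoveContinuity.

Lemma saddle_contraction_cts : continuous saddle_contraction.
Proof.
have c (g : R -> R) : continuous g -> continuous (fun p : R * (R * R) => clamp01 (g p.1)).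
  move=> cg; apply: (cts_comp (@continuous_clamp01 R)).
  exact: cts_comp cg (cts_fst cts_id).
apply: move3_cts; first by apply: (c (fun t => 6 * t - 2)); cts.
apply: move2_cts; first by apply: (c (fun t => 6 * t - 1)); cts.
apply: move1_cts; first by apply: (c (fun t => 6 * t)); cts.
exact: cts_snd cts_id.
Qed.

Lemma saddle_contraction0 z : saddle_contraction (0, z) = z.
Proof.
rewrite /saddle_contraction /= !mulr0 !sub0r !clamp01_0 ?oppr_le0 ?ler0n//.
by rewrite /move3/= /move2/= /move1/= !mul0r !subr0 !addr0 !mul1r; case: z.
Qed.

Lemma saddle_contraction1 t z : 2^-1 <= t -> saddle_contraction (t, z) = (0, 0).
Proof.
move=> t2; rewrite /saddle_contraction /= (@clamp01_1 _ (6 * t - 2)); last by lra.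
by rewrite /move3 subrr !mul0r.
Qed.

Lemma corner_shift_cases (gt0 : 0 < M) x y :
  [\/ x < - M /\ corner_shift x y = Num.min (- x - M) (Num.max (y - M) 0),
      M < x /\ corner_shift x y = - Num.min (x - M) (Num.max (- y - M) 0) |
      - M <= x <= M /\ corner_shift x y = 0].
Proof.
have max_ge0 (a : R) : 0 <= Num.max a 0 by rewrite le_max lexx orbT.
have gone a b : a <= 0 -> Num.min (Num.max a 0) (Num.max b 0) = 0 :> R.
  by move=> a0; rewrite max_r// min_l.
rewrite /corner_shift; have [xM|xM] := ltP x (- M).
  apply: Or31; split=> //; rewrite (gone (x - M)) ?subr0; last by lra.
  by rewrite (max_l (x := - x - M)); last by lra.
have [Mx|Mx] := ltP M x.
  apply: Or32; split=> //; rewrite (gone (- x - M)) ?sub0r; last by lra.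
  by rewrite (max_l (x := x - M)); last by lra.
apply: Or33; have h1 : x - M <= 0 by lra.
have h2 : - x - M <= 0 by lra.
by rewrite (gone _ _ h1) (gone _ _ h2) subrr; split=> //; lra.
Qed.

(** In each of the two quadrants concerned, both coordinates move in a direction
    in which f decreases. *)
Lemma move1_le s z : 0 <= s <= 1 -> f (move1 s z) <= f z.
Proof.
move=> /andP[s0 s1]; case: z => x y; rewrite /move1/=.
have : [\/ [/\ x <= - M, M <= y, 0 <= corner_shift x y,
               corner_shift x y <= - x - M & corner_shift x y <= y - M],
           [/\ M <= x, y <= - M, corner_shift x y <= 0,
               - corner_shift x y <= x - M & - corner_shift x y <= - y - M] |
           corner_shift x y = 0].
  have [[xM ->]|[xM ->]|[_ ->]] := corner_shift_cases M0 x y; last by apply: Or33.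
    by split_minmax; first [by apply: Or33; lra|by apply: Or31; split; lra].
  by split_minmax; first [by apply: Or33; lra|by apply: Or32; split; lra].
set d := corner_shift x y => -[[xM My d0 dx dy]|[Mx yM d0 dx dy]|->].
- have h1 : s * d <= d by rewrite ler_piMl.
  have h2 : 0 <= s * d by rewrite mulr_ge0.
  have h3 : x + s * d <= - M by lra.
  have := @fl (x + s * d) (y - s * d) y h3; have := @ft y x (x + s * d) My; lra.
- have h1 : s * (- d) <= - d by rewrite ler_piMl// oppr_ge0.
  have h2 : 0 <= s * (- d) by rewrite mulr_ge0// oppr_ge0.
  have h3 : M <= x + s * d by lra.
  have := @fr (x + s * d) y (y - s * d) h3; have := @fb y (x + s * d) x yM; lra.
- by rewrite mulr0 addr0 subr0.
Qed.

Let cross z := (z.1 < - M -> z.2 <= M) /\ (M < z.1 -> - M <= z.2).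

Lemma move1_cross z : cross (move1 1 z).
Proof.
have MM := M0; case: z => x y; rewrite /cross /move1/= !mul1r.
have [[xM ->]|[xM ->]|[xM ->]] := corner_shift_cases M0 x y; last by split; lra.
  by split_minmax; split; lra.
by split_minmax; split; lra.
Qed.

Lemma soft_threshold_cases (gt0 : 0 < M) x : [\/ M < x /\ soft_threshold x = x - M,
  x < - M /\ soft_threshold x = x + M | - M <= x <= M /\ soft_threshold x = 0].
Proof.
rewrite /soft_threshold; split_minmax;
first [by apply: Or33; split; lra | by apply: Or31; split; lra | by apply: Or32; split; lra].
Qed.

(** Outside the two emptied quadrants soft thresholds of x and y never have
    opposite signs, and moving each coordinate by the threshold of the other one
    follows the descent of -x * y. *)
Lemma move2_le s z : 0 <= s <= 1 -> cross z -> f (move2 s z) <= f z.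
Proof.
move=> /andP[s0 s1]; case: z => x y; rewrite /cross /move2/= => -[c1 c2].
have MM := M0.
have [[/[dup] xM' /ltW xM ->]|[/[dup] xM' /ltW xM ->]|[/andP[x1 x2] ->]] := soft_threshold_cases M0 x;
have [[/[dup] yM' /ltW yM ->]|[/[dup] yM' /ltW yM ->]|[/andP[y1 y2] ->]] := soft_threshold_cases M0 y;
rewrite ?mulr0 ?addr0.
- have h1 : 0 <= s * (y - M) by rewrite mulr_ge0// subr_ge0.
  have h2 : 0 <= s * (x - M) by rewrite mulr_ge0// subr_ge0.
  have h3 : M <= x + s * (y - M) by lra.
  have := @fr _ y (y + s * (x - M)) h3; have := @ft y x (x + s * (y - M)) yM; lra.
- by have := c2 xM'; lra.
- have h2 : 0 <= s * (x - M) by rewrite mulr_ge0// subr_ge0.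
  by have := @fr x y (y + s * (x - M)) xM; lra.
- by have := c1 xM'; lra.
- have h1 : s * (y + M) <= 0 by rewrite mulr_ge0_le0//; lra.
  have h2 : s * (x + M) <= 0 by rewrite mulr_ge0_le0//; lra.
  have h3 : x + s * (y + M) <= - M by lra.
  have := @fl _ (y + s * (x + M)) y h3; have := @fb y (x + s * (y + M)) x yM; lra.
- have h2 : s * (x + M) <= 0 by rewrite mulr_ge0_le0//; lra.
  by have := @fl x (y + s * (x + M)) y xM; lra.
- have h1 : 0 <= s * (y - M) by rewrite mulr_ge0// subr_ge0.
  by have := @ft y x (x + s * (y - M)) yM; lra.
- have h1 : s * (y + M) <= 0 by rewrite mulr_ge0_le0//; lra.
  by have := @fb y (x + s * (y + M)) x yM; lra.
- by [].
Qed.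

Lemma move2_band z : `|(move2 1 z).1 - (move2 1 z).2| <= 2 * M.
Proof.
case: z => x y; rewrite /move2/= !mul1r ler_norml.
have MM := M0.
by have [[xM ->]|[xM ->]|[/andP[x1 x2] ->]] := soft_threshold_cases M0 x;
have [[yM ->]|[yM ->]|[/andP[y1 y2] ->]] := soft_threshold_cases M0 y; lra.
Qed.

(** The first two moves lower f; the third one stays in the band where f is at
    most C. *)
Lemma saddle_contraction_le C c t z :
  (forall x y, `|x - y| <= 2 * M -> f (x, y) <= C) -> C <= c -> 
  f z <= c -> f (saddle_contraction (t, z)) <= c.
Proof.
move=> fC Cc fzc; rewrite /saddle_contraction/=.
have cl (s : R) : 0 <= clamp01 s <= 1 by rewrite clamp01_ge0 clamp01_le1.
have [t1|t1] := leP t 6^-1.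
  rewrite (@clamp01_0 _ (6 * t - 2)); last by lra.
  rewrite (@clamp01_0 _ (6 * t - 1)); last by lra.
  rewrite /move3 subr0 !mul1r /move2 !mul0r !addr0/=.
  by apply: le_trans fzc; apply: move1_le.
rewrite (@clamp01_1 _ (6 * t)); last by lra.
have z1c : f (move1 1 z) <= c.
  by apply: le_trans fzc; apply: move1_le; rewrite ler01 lexx.
have z1X := move1_cross z.
set z1 := move1 1 z in z1c z1X *.
have [t2|t2] := leP t 3^-1.
  rewrite (@clamp01_0 _ (6 * t - 2)); last by lra.
  rewrite /move3 subr0 !mul1r.
  by apply: le_trans z1c; apply: move2_le.
rewrite (@clamp01_1 _ (6 * t - 1)); last by lra.
apply: le_trans Cc; rewrite /move3; apply: fC.
rewrite -mulrBr normrM.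
have /andP[s0 s1] := cl (6 * t - 2).
rewrite -[leRHS]mul1r ler_pM// ?move2_band//.
by rewrite ger0_norm; lra.
Qed.

End Contraction.
End Saddle.

(** * Generators of the relative homology of a saddle *)
Section Linked.
Variables (R : realType).
Local Notation plane := (R * R)%type.
Local Notation chain n := (@chain R plane n).
Implicit Types (X : set plane) (z w : plane).

(** Sums of chains make this relation transitive without any concatenation of
    paths. *)
Definition linked X z w := exists2 a : chain 1,
  carrier a `<=` X & boundary a = << pt R z >> + << pt R w >>.

Lemma linked_trans X z1 z2 z3 : linked X z1 z2 -> linked X z2 z3 -> linked X z1 z3.
Proof.
move=> [a aX ea] [b bX eb]; exists (a + b); first exact: carrier_subD.
by rewrite boundaryD ea eb -addrA [X in _ + X]addrA F2_lmod_addxx add0r.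
Qed.

Definition segment_map z w (t : R) : plane :=
  (z.1 + t * (w.1 - z.1), z.2 + t * (w.2 - z.2)).

Lemma segment_map_continuous z w : continuous (segment_map z w).
Proof. by rewrite /segment_map; cts. Qed.

Definition segment_chain z w : chain 1 :=
  << path_simplex (@segment_map_continuous z w) >>.

Lemma boundary_segment z w : boundary (segment_chain z w) = << pt R w >> + << pt R z >>.
Proof.
rewrite boundary_path; case: z w => [a b] [c d]; rewrite /segment_map/=.
by rewrite !mul0r !addr0 !mul1r !subrKC.
Qed.

Lemma linked_segment X z w :
  (forall t, 0 <= t <= 1 -> X (segment_map z w t)) -> linked X z w.
Proof.
move=> zwX; exists (segment_chain z w); last by rewrite boundary_segment addrC.
exact: carrier_path.
Qed.

End Linked.

Section Generators.
Variables (R : realType).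
Local Notation plane := (R * R)%type.
Local Notation chain n := (@chain R plane n).
Local Notation P := (@positive_side R).
Local Notation N := (@negative_side R).

Lemma open_positive_side : open P.
Proof.
apply: (@open_comp _ _ (fun z : plane => z.1 + z.2) [set x | 0 < x]); last exact: open_gt.
have c : continuous (fun z : plane => z.1 + z.2) by cts.
by move=> z _; exact: c.
Qed.

Lemma open_negative_side : open N.
Proof.
apply: (@open_comp _ _ (fun z : plane => z.1 + z.2) [set x | x < 0]); last exact: open_lt.
have c : continuous (fun z : plane => z.1 + z.2) by cts.
by move=> z _; exact: c.
Qed.

Lemma sides_disjoint : P `&` N = set0.
Proof.
apply/seteqP; split => // z []; rewrite /positive_side /negative_side/= => ? ?; lra.
Qed.

Variables (M : R) (f : plane -> R).
Hypothesis Sf : saddle M f.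

(** Sublevel sets of f change their topology only between the levels -C and C:
    above C they contain the band onto which the plane retracts, below -C they
    consist of the two ends. *)
Record critical_level (C : R) : Prop := CriticalLevel {
  level_gt0 : 0 < C;
  level_band : forall x y, `|x - y| <= 2 * M -> f (x, y) <= C;
  level_ends : forall x y, f (x, y) <= - C ->
        (0 < x + y /\ (M <= x \/ M <= y)) \/ (x + y < 0 /\ (x <= - M \/ y <= - M))
}.

Lemma critical_level_exists : exists C, critical_level C.
Proof. by have [C [C0 C1 C2]] := saddle_level Sf; exists C. Qed.

Section Level.
Variables (C c : R).
Hypothesis LC : critical_level C.
Hypothesis Cc : C <= c.

Local Notation low := (sublevel f (- c)).
Local Notation high := (sublevel f c).

Lemma low_sub_high : low `<=` high.
Proof. by have CC := Cc; have := level_gt0 LC; move=> C0 z; rewrite /sublevel/=; lra. Qed.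

Lemma low_sides z : low z -> (P z /\ (M <= z.1 \/ M <= z.2)) \/ (N z /\ (z.1 <= - M \/ z.2 <= - M)).
Proof.
by case: z => x y zl; apply: (level_ends LC); apply: le_trans zl _; rewrite lerN2.
Qed.

Lemma low_cover : low `<=` P `|` N.
Proof. by move=> z /low_sides[[]|[]]; [left|right]. Qed.

Lemma weight_low (a : chain 1) : carrier a `<=` low -> weight P (boundary a) = 0.
Proof.
move=> al; apply: (weight_separated open_positive_side open_negative_side sides_disjoint).
by move=> z /al/low_cover.
Qed.

Lemma diagonal_end : exists n, [/\ M <= n, low (n, n) & low (- n, - n)].
Proof.
have M0 := saddle_gt0 Sf; have C0 := level_gt0 LC; have CC := Cc.
(* From a value at most C at the corner, f decreases at unit speed to -c. *)
pose d := 2 * c; exists (M + d); split; first by rewrite /d; lra.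
  rewrite /sublevel/=; have := diag_decr Sf (lexx M) (b := M + d).
  have := level_band LC (x := M) (y := M); rewrite subrr normr0 /d; lra.
rewrite /sublevel/=; have := diag_incr Sf (a := - (M + d)) (lexx (- M)).
have := level_band LC (x := - M) (y := - M); rewrite subrr normr0 /d; lra.
Qed.

Section Ends.
Variable n : R.
Hypothesis Mn : M <= n.
Hypothesis ln : low (n, n).
Hypothesis lNn : low (- n, - n).

(** From a point of an end one coordinate moves outwards until it dominates, then
    the other one until the diagonal is reached; f decreases on the way. Along
    the diagonal f is monotone, hence at most f (n, n) on the way back. *)
Lemma linked_end z : low z -> linked low z (if 0 < z.1 + z.2 then (n, n) else (- n, - n)).
Proof.
have MN := Mn; have M0 := saddle_gt0 Sf; have ft := saddle_top Sf; have fb := saddle_bot Sf.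
have fr := saddle_right Sf; have fl := saddle_left Sf.
case: z => x y zl; have := low_sides zl.
rewrite /positive_side /negative_side/= => -[[xy z_M]|[xy z_M]]; last first.
  rewrite ltNge (ltW xy)/=.
  set m := Num.min (- n) (Num.min x y).
  have mn : m <= - n by rewrite ge_min lexx.
  have mx : m <= x by rewrite !ge_min lexx !orbT.
  have my : m <= y by rewrite !ge_min lexx !orbT.
  have mM : m <= - M by lra.
  apply: (@linked_trans _ _ _ (m, m)); last first.
    apply: linked_segment => t /andP[t0 t1]; rewrite /segment_map/=.
    have t2 : 0 <= t * (- n - m) <= - n - m.
      by rewrite mulr_ge0 ?ler_piMl//; lra.
    have := diag_incr Sf (a := m + t * (- n - m)) (b := - n).
    by move: lNn; rewrite /sublevel/=; lra.
  case: z_M => z_M.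
    apply: (@linked_trans _ _ _ (x, m)); apply: linked_segment => t /andP[t0 t1];
      rewrite /segment_map/= subrr mulr0 addr0.
      have t2 : m - y <= t * (m - y) <= 0.
        by rewrite ler_niMl ?mulr_ge0_le0//; lra.
      by have := fl x (y + t * (m - y)) y z_M; move: zl; rewrite /sublevel/=; lra.
    have t2 : m - x <= t * (m - x) <= 0.
      by rewrite ler_niMl ?mulr_ge0_le0//; lra.
    have := fb m (x + t * (m - x)) x mM; have := fl x m y z_M.
    by move: zl; rewrite /sublevel/=; lra.
  apply: (@linked_trans _ _ _ (m, y)); apply: linked_segment => t /andP[t0 t1];
    rewrite /segment_map/= subrr mulr0 addr0.
    have t2 : m - x <= t * (m - x) <= 0.
      by rewrite ler_niMl ?mulr_ge0_le0//; lra.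
    by have := fb y (x + t * (m - x)) x z_M; move: zl; rewrite /sublevel/=; lra.
  have t2 : m - y <= t * (m - y) <= 0.
    by rewrite ler_niMl ?mulr_ge0_le0//; lra.
  have := fl m (y + t * (m - y)) y mM; have := fb y m x z_M.
  by move: zl; rewrite /sublevel/=; lra.
rewrite xy.
set m := Num.max n (Num.max x y).
have mn : n <= m by rewrite le_max lexx.
have mx : x <= m by rewrite !le_max lexx !orbT.
have my : y <= m by rewrite !le_max lexx !orbT.
have mM : M <= m by lra.
apply: (@linked_trans _ _ _ (m, m)); last first.
  apply: linked_segment => t /andP[t0 t1]; rewrite /segment_map/=.
  have t2 : n - m <= t * (n - m) <= 0.
    by rewrite ler_niMl ?mulr_ge0_le0//; lra.
  have := diag_decr Sf (a := n) (b := m + t * (n - m)).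
  by move: ln; rewrite /sublevel/=; lra.
case: z_M => z_M.
  apply: (@linked_trans _ _ _ (x, m)); apply: linked_segment => t /andP[t0 t1];
    rewrite /segment_map/= subrr mulr0 addr0.
    have t2 : 0 <= t * (m - y) <= m - y.
      by rewrite mulr_ge0 ?ler_piMl//; lra.
    by have := fr x y (y + t * (m - y)) z_M; move: zl; rewrite /sublevel/=; lra.
  have t2 : 0 <= t * (m - x) <= m - x.
    by rewrite mulr_ge0 ?ler_piMl//; lra.
  have := ft m x (x + t * (m - x)) mM; have := fr x y m z_M.
  by move: zl; rewrite /sublevel/=; lra.
apply: (@linked_trans _ _ _ (m, y)); apply: linked_segment => t /andP[t0 t1];
  rewrite /segment_map/= subrr mulr0 addr0.
  have t2 : 0 <= t * (m - x) <= m - x.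
    by rewrite mulr_ge0 ?ler_piMl//; lra.
  by have := ft y x (x + t * (m - x)) z_M; move: zl; rewrite /sublevel/=; lra.
have t2 : 0 <= t * (m - y) <= m - y.
  by rewrite mulr_ge0 ?ler_piMl//; lra.
have := fr m y (y + t * (m - y)) mM; have := ft y x m z_M.
by move: zl; rewrite /sublevel/=; lra.
Qed.

(** The chain along the diagonal, which joins the two ends. *)
Definition diagonal_chain : chain 1 := segment_chain (- n, - n) (n, n).

Lemma diagonal_chain_le z : carrier diagonal_chain z -> f z <= C.
Proof.
apply: (@carrier_path _ _ _ _ [set z | f z <= C]) => t _.
by apply: (level_band LC); rewrite subrr normr0 mulr_ge0// ltW// (saddle_gt0 Sf).
Qed.

Lemma diagonal_chain_relative : relative_cycle high low diagonal_chain.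
Proof.
split=> [z /diagonal_chain_le zC|]; first exact: le_trans zC Cc.
rewrite boundary_segment; apply: carrier_subD; rewrite carrierU => _ [x _ <-] //.
Qed.

Lemma weight_diagonal : weight P (boundary diagonal_chain) = 1.
Proof.
have M0 := saddle_gt0 Sf; have MN := Mn.
rewrite boundary_segment weightD !weightU.
have -> : P (n, n) = True by apply/propext; split => // _; rewrite /positive_side/=; lra.
have -> : P (- n, - n) = False.
  by apply/propext; split => //; rewrite /positive_side/=; lra.
by rewrite asboolT// asboolF// addr0.
Qed.

(** The points of the chain can be brought to the two ends of the diagonal, where
    they cancel in pairs. *)
Lemma low_0cycle_bounds (d : chain 0) : carrier d `<=` low ->
  weight P d = 0 -> weight setT d = 0 ->
  exists2 a : chain 1, carrier a `<=` low & boundary a = d.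
Proof.
move=> dl dP dT.
have /choice[a aP] (s : singular_simplex R plane 0) : exists a : chain 1,
    low (s (vertex R)) -> carrier a `<=` low /\ boundary a = << pt R (s (vertex R)) >> +
     << pt R (if 0 < (s (vertex R)).1 + (s (vertex R)).2 then (n, n) else (- n, - n)) >>.
  have [sl|nsl] := pselect (low (s (vertex R))); last by exists 0.
  by have [a al ea] := linked_end sl; exists a.
have sl s : s \in dom d -> low (s (vertex R)).
  by move=> sd; apply: dl; exists s => //; exists (vertex R).
(* Each point is traded for the end of its side; both ends then occur with
   weights of d that vanish. *)
exists (fglift a d).
  by apply: carrier_fglift => s sd; case: (aP s) => //; apply: dl; apply: sd; exists (vertex R).
rewrite fglift_sum boundary_big big_seq.
pose e (s : singular_simplex R plane 0) : chain 0 := `[< P (s (vertex R)) >]%:R *: << pt R (n, n) >> +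
  (`[< P (s (vertex R)) >]%:R + `[< setT (s (vertex R)) >]%:R) *: << pt R (- n, - n) >>.
rewrite (eq_bigr (fun s : singular_simplex R plane 0 => << s >> + e s)); last first.
  move=> s sd; have [_ ->] := aP s (sl s sd); rewrite -(simp0_pt s); congr (_ + _).
  rewrite /e (asboolT I); case: ifPn => [sP|sP].
    by rewrite asboolT// F2_addxx scale0r addr0 scale1r.
  by rewrite asboolF ?scale0r ?add0r ?scale1r//; apply/negP.
rewrite -big_seq big_split/= -chain_sumE big_split/= -!scaler_suml big_split/=.
have w A : \sum_(s <- dom d) `[< A (s (vertex R)) >]%:R = weight A d.
  rewrite [in RHS](chain_sumE d) weight_big; apply: eq_bigr => s _.
  by rewrite [in RHS](simp0_pt s) weightU.
by rewrite (w P) (w setT) dP dT addr0 !scale0r !addr0.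
Qed.

Lemma high_cycle_bounds (z : chain 1) : carrier z `<=` high -> boundary z = 0 ->
  exists2 b : chain 2, carrier b `<=` high & boundary b = z.
Proof.
apply: (contractible_cycle_bounds (@saddle_contraction_cts _ M)
  (saddle_contraction0 M) (@saddle_contraction1 _ M)).
move=> t w _ fw; exact: (saddle_contraction_le Sf t (level_band LC) Cc fw).
Qed.

Lemma weight_homologous (s s' : chain 1) : homologous high low s s' ->
  weight P (boundary s) = weight P (boundary s').
Proof.
move=> [b [a [_ al]]] /(congr1 (fun x => weight P (boundary (x + s')))).
rewrite subrK !boundaryD !weightD => ->.
by rewrite weight_boundary2 (weight_low al) !add0r.
Qed.

Lemma weightT_boundary (s : chain 1) : weight setT (boundary s) = 0.
Proof. exact: weight_boundary. Qed.

(** The number of endpoints on the positive side is additive, vanishes on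
    boundaries and on chains of the low level set, and is odd for the diagonal:
    this detects relative homology. Conversely two relative cycles with the same
    parity differ by a cycle of the contractible high level set, up to a chain
    of the low one. *)
Lemma generatesP_at (s : chain 1) : relative_cycle high low s ->
  generates_homology high low s <-> weight P (boundary s) = 1.
Proof.
move=> sr; split=> [[_ gs]|s1].
  have [k [+ _]] := gs _ diagonal_chain_relative.
  move=> /weight_homologous; rewrite weight_diagonal boundaryZ weightZ.
  by case: (F2_cases (weight P (boundary s))) => ->; rewrite ?mulr0.
split=> // s' s'r; exists (weight P (boundary s')); split; last first.
  by move=> k /weight_homologous ->; rewrite boundaryZ weightZ s1 mulr1.
set k := weight P (boundary s').
have [a al ea] : exists2 a : chain 1, carrier a `<=` low & boundary a = boundary (s' + k *: s).
  apply: low_0cycle_bounds; last exact: weightT_boundary.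
    rewrite boundaryD boundaryZ; apply: carrier_subD; first by case: s'r.
    by apply: carrier_subZ; case: sr.
  by rewrite boundaryD boundaryZ weightD weightZ s1 mulr1 F2_addxx.
have [b bh eb] : exists2 b : chain 2, carrier b `<=` high & boundary b = s' + k *: s + a.
  apply: high_cycle_bounds; last by rewrite boundaryD ea F2_lmod_addxx.
  apply: carrier_subD; last by move=> z /al/low_sub_high.
  apply: carrier_subD; first by case: s'r.
  by apply: carrier_subZ; case: sr.
exists b, a; split=> //.
by rewrite eb -addrA F2_lmod_addxx addr0 F2_lmod_opp.
Qed.

End Ends.

Lemma generatesP (s : chain 1) :
  generates_homology high low s <->
  relative_cycle high low s /\ weight P (boundary s) = 1.
Proof.
have [n [Mn ln lNn]] := diagonal_end.
split=> [gs|[sr s1]]; last by apply/(generatesP_at Mn ln lNn).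
by have sr := gs.1; split => //; apply/(generatesP_at Mn ln lNn).
Qed.

Lemma maximaP m : maxima f c m <-> exists s : chain 1,
  [/\ relative_cycle high low s, weight P (boundary s) = 1,
      exists2 z, carrier s z & f z = m & forall z, carrier s z -> f z <= m].
Proof.
split=> [[s /generatesP[sr s1] [[z zs zm] sm]]|[s [sr s1 [z zs zm] sm]]]; exists s.
- by split => //; [exists z|move=> w ws; apply: sm; exists w].
- exact/generatesP.
- by split; [exists z|move=> _ [w ws <-]; exact: sm].
Qed.

Lemma carrier_weight1 (s : chain 1) : weight P (boundary s) = 1 -> carrier s !=set0.
Proof.
move=> s1; apply/set0P/eqP => s0; suff : weight P (boundary s) = 0 by rewrite s1.
apply: weight_boundary => t tc; suff : carrier s (t (edge 0)) by rewrite s0.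
by apply: tc; exists (edge 0).
Qed.

Lemma weight1_max (s : chain 1) : weight P (boundary s) = 1 ->
  exists m, [/\ exists2 z, carrier s z & f z = m & forall z, carrier s z -> f z <= m].
Proof.
move=> /carrier_weight1 /(carrier_max (saddle_cts Sf))[z zs zm].
by exists (f z); split => //; exists z.
Qed.

Lemma maxima_nonempty : exists2 m, maxima f c m & m <= C.
Proof.
have [n [Mn ln lNn]] := diagonal_end.
have w1 := weight_diagonal Mn.
have [m [[z zs zm] sm]] := weight1_max w1.
exists m; last by rewrite -zm; exact: diagonal_chain_le zs.
apply/maximaP; exists (diagonal_chain n); split => //; last by exists z.
exact: diagonal_chain_relative.
Qed.

(** Otherwise the antidiagonal would separate the endpoints from each other. *)
Lemma weight1_crosses (s : chain 1) : weight P (boundary s) = 1 ->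
  exists2 z, carrier s z & z.1 + z.2 = 0.
Proof.
move=> s1; apply: contrapT => sn.
suff : weight P (boundary s) = 0 by rewrite s1.
apply: (weight_separated open_positive_side open_negative_side sides_disjoint).
move=> z zs; have [zp|zn|z0] := ltgtP 0 (z.1 + z.2); [by left|by right|].
by exfalso; apply: sn; exists z.
Qed.

Lemma maxima_ge m : maxima f c m -> - C <= m.
Proof.
move=> /maximaP[s [_ s1 _ sm]]; have [z zs z0] := weight1_crosses s1.
apply: le_trans (sm z zs); rewrite leNgt; apply/negP => /ltW.
by case: z z0 {zs} => x y /= xy0 /(level_ends LC) => -[[]|[]]; rewrite xy0 ltxx.
Qed.

End Level.
End Generators.

(** * The minmax level of a saddle *)
Section InfmaxLimit.
Variables (R : realType) (M : R) (f : R * R -> R).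
Hypothesis Sf : saddle M f.
Variable C : R.
Hypothesis LC : critical_level M f C.

Lemma maxima_inf_le c m : C <= c -> maxima f c m -> inf (maxima f c) <= m.
Proof.
move=> Cc mc; apply: ge_inf => //; exists (- C) => x; exact: (maxima_ge Sf LC Cc).
Qed.

Lemma maxima_inf_bounds c : C <= c -> - C <= inf (maxima f c) <= C.
Proof.
move=> Cc; have [m mc mC] := maxima_nonempty Sf LC Cc.
rewrite (le_trans (maxima_inf_le Cc mc) mC) andbT.
by apply: lb_le_inf; [exists m|move=> x; exact: (maxima_ge Sf LC Cc)].
Qed.

(** Raising the level only shrinks the set of competing values below C: a
    relative cycle for the higher level whose maximum is at most C is one for
    the lower level. *)
Lemma maxima_inf_nondecreasing c c' : C <= c -> c <= c' ->
  inf (maxima f c) <= inf (maxima f c').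
Proof.
move=> Cc cc'; have Cc' := le_trans Cc cc'.
have [m0 mc0 _] := maxima_nonempty Sf LC Cc'.
apply: lb_le_inf; first by exists m0.
move=> m /(maximaP Sf LC Cc')[s [[sh sl] s1 sz sm]].
have [mC|/ltW Cm] := leP m C; last first.
  by apply: le_trans Cm; have /andP[] := maxima_inf_bounds Cc.
apply: maxima_inf_le => //; apply/(maximaP Sf LC Cc); exists s; split => //.
split=> z; first by move=> /sm zm; rewrite /sublevel/=; lra.
by move=> /sl; rewrite /sublevel/=; lra.
Qed.

Lemma infmax_is_cvg : cvg (inf (maxima f c) @[c --> +oo]).
Proof.
have nd : nondecreasing_fun (fun c => inf (maxima f (Num.max C c))).
  move=> a b ab; apply: maxima_inf_nondecreasing; first by rewrite le_max lexx.
  by rewrite ge_max le_max lexx/= le_max ab orbT.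
have cv : inf (maxima f (Num.max C c)) @[c --> +oo] -->
    sup (range (fun c => inf (maxima f (Num.max C c)))).
  apply: nondecreasing_cvgr => //.
  exists C => _ [c _ <-].
  have Cm : C <= Num.max C c by rewrite le_max lexx.
  by have /andP[] := maxima_inf_bounds Cm.
apply: cvgP; apply: cvg_trans cv; apply: near_eq_cvg; near=> c.
by rewrite /= max_r.
Unshelve. all: by end_near. Qed.

Lemma maxima_inf_le_infmax c : C <= c -> inf (maxima f c) <= infmax f.
Proof.
move=> Cc; apply: limr_ge; first exact: infmax_is_cvg.
by near=> c'; apply: maxima_inf_nondecreasing.
Unshelve. all: by end_near. Qed.

Lemma infmax_approx c e : C <= c -> 0 < e ->
  exists2 m, maxima f c m & m <= infmax f + e.
Proof.
move=> Cc e0; have [m0 mc0 _] := maxima_nonempty Sf LC Cc.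
have hi : has_inf (maxima f c).
  by split; [exists m0|exists (- C) => x; exact: (maxima_ge Sf LC Cc)].
have [m mc mlt] := inf_adherent e0 hi.
exists m => //; apply: le_trans (ltW mlt) _; rewrite lerD2r.
exact: maxima_inf_le_infmax.
Qed.

Lemma infmax_le b c1 :
  (forall c, c1 <= c -> exists2 m, maxima f c m & m <= b) -> infmax f <= b.
Proof.
move=> h; apply: limr_le; first exact: infmax_is_cvg.
near=> c.
have Cc : C <= c by near: c; apply: nbhs_pinfty_ge; rewrite num_real.
have c1c : c1 <= c by near: c; apply: nbhs_pinfty_ge; rewrite num_real.
by have [m mc mb] := h c c1c; apply: le_trans mb; apply: maxima_inf_le.
Unshelve. all: by end_near. Qed.

Lemma infmax_ge b c1 :
  (forall c m, c1 <= c -> maxima f c m -> b <= m) -> b <= infmax f.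
Proof.
move=> h; apply: limr_ge; first exact: infmax_is_cvg.
near=> c.
have Cc : C <= c by near: c; apply: nbhs_pinfty_ge; rewrite num_real.
have [m0 mc0 _] := maxima_nonempty Sf LC Cc.
apply: lb_le_inf; first by exists m0.
move=> m; apply: h; near: c; apply: nbhs_pinfty_ge; rewrite num_real//.
Unshelve. all: by end_near. Qed.

End InfmaxLimit.

Section Comparison.
Variables (R : realType) (M : R) (f g : R * R -> R).
Hypotheses (Sf : saddle M f) (Sg : saddle M g).

(** The minmax only depends on the way sublevel sets are connected: a continuous
    map that lowers f to g and keeps the two ends apart carries generators to
    generators. *)
Lemma infmax_pushforward (Phi : R * R -> R * R) e c1 : continuous Phi ->
  (forall z, g (Phi z) <= f z + e) ->
  (forall z, f z <= - c1 -> 0 < (Phi z).1 + (Phi z).2 <-> 0 < z.1 + z.2) ->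
  infmax g <= infmax f + e.
Proof.
move=> cPhi gf ends.
have [C LC] := critical_level_exists Sf; have [D LD] := critical_level_exists Sg.
apply/ler_addgt0Pr => d d0.
apply: (infmax_le Sg LD (c1 := `|C| + `|D| + `|c1| + `|infmax f| + `|e| + d)) => c hc.
have nn := (normr_ge0 C, normr_ge0 D, normr_ge0 c1, normr_ge0 (infmax f), normr_ge0 e).
have [[[[n1 n2] n3] n4] n5] := nn.
have a1 := ler_norm C; have a2 := ler_norm D; have a3 := ler_norm c1.
have a4 := ler_norm (infmax f); have a5 := ler_norm e.
have Cc : C <= c + `|e| by lra.
have Dc : D <= c by lra.
have [m /(maximaP Sf LC Cc)[s [[sh sl] s1 [z zs zm] sm]] mle] := infmax_approx Sf LC Cc d0.
have w1 : weight (@positive_side R) (boundary (push cPhi s)) = 1.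
  rewrite boundary_push weight_push -[RHS]s1; apply: eq_weight => w /sl wl.
  by apply: ends; move: wl; rewrite /sublevel/=; lra.
have [m' [[z' z's z'm] sm']] := weight1_max Sg w1.
have m'le : m' <= m + e.
  have [w ws ew] := carrier_push z's.
  by rewrite -z'm -ew; have := gf w; have := sm w ws; lra.
exists m'; last by lra.
apply/(maximaP Sg LD Dc); exists (push cPhi s); split => //; last by exists z'.
split=> w.
  by move=> /sm'; rewrite /sublevel/=; lra.
rewrite boundary_push => /carrier_push[w' w's <-].
by have := sl _ w's; have := gf w'; rewrite /sublevel/=; lra.
Qed.

(** Points very far from the antidiagonal are not carried across it by moves of
    bounded size. *)
Lemma infmax_bounded_move (Phi : R * R -> R * R) e d : continuous Phi ->
  (forall z, g (Phi z) <= f z + e) ->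
  (forall z, `|(Phi z).1 - z.1 + ((Phi z).2 - z.2)| <= d) ->
  infmax g <= infmax f + e.
Proof.
move=> cPhi gf Phid.
have M0 := saddle_gt0 Sf.
have d0 : 0 <= d by apply: le_trans (Phid (0, 0)).
have [C farC] := far_ends Sf (D := M + d + M) ltac:(lra).
apply: (@infmax_pushforward Phi e C) => // -[x y] /farC.
move: (Phid (x, y)); rewrite ler_norml /= => /andP[h1 h2].
by move=> [] [k1 k2]; split => k3; lra.
Qed.

End Comparison.

Section NormalForm.
Variable R : realType.
Implicit Types (A B : R -> R) (k p : R).

Definition lip k A := forall x y, `|A x - A y| <= k * `|x - y|.

Lemma lip_ge0 k A : lip k A -> 0 <= k.
Proof.
by move=> /(_ 1 0); rewrite subr0 normr1 mulr1; apply: le_trans.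
Qed.

Lemma lip_le k k' A : k <= k' -> lip k A -> lip k' A.
Proof. by move=> kk' kA x y; apply: le_trans (kA x y) _; rewrite ler_wpM2r. Qed.

Lemma lip_continuous k A : lip k A -> continuous A.
Proof.
move=> kA x; apply/cvgrPdist_le => e e0.
have k0 := lip_ge0 kA; have k1 : 0 < k + 1 by lra.
near=> y; apply: le_trans (kA x y) _.
have : `|x - y| <= e / (k + 1).
  near: y; apply: (@cvgr_dist_le _ _ _ _ _ id x); first exact: cvg_id.
  by rewrite divr_gt0.
rewrite ler_pdivlMr// => h; have := normr_ge0 (x - y); nra.
Unshelve. all: by end_near. Qed.

Lemma lip_incr k A x y : lip k A -> x <= y ->
  A x - k * (y - x) <= A y <= A x + k * (y - x).
Proof.
by move=> kA xy; have := kA y x; rewrite (ger0_norm (x := y - x)) ?subr_ge0// ler_norml; lra.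
Qed.

Lemma lip_cst k c : 0 <= k -> lip k (fun _ => c).
Proof. by move=> k0 x y; rewrite subrr normr0 mulr_ge0. Qed.

Lemma lip_addc k A c : lip k A -> lip k (fun x => A x + c).
Proof. by move=> kA x y; rewrite opprD addrACA subrr addr0. Qed.

Lemma lip_shift k A p : lip k A -> lip k (fun x => A (x + p)).
Proof. by move=> kA x y; apply: le_trans (kA _ _) _; rewrite opprD addrACA subrr addr0. Qed.

Lemma lip_addl k A p : lip k A -> lip (k + `|p|) (fun x => A x + p * x).
Proof.
move=> kA x y; rewrite opprD addrACA -mulrBr mulrDl -normrM.
by apply: le_trans (ler_normD _ _) _; rewrite lerD2r.
Qed.

Definition normal_form A B (z : R * R) : R := A z.1 + B z.2 - z.1 * z.2.

Lemma normal_form_saddle k A B : lip k A -> lip k B -> saddle (k + 1) (normal_form A B).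
Proof.
move=> kA kB; have k0 := lip_ge0 kA; rewrite /normal_form; split=> /=.
- by lra.
- have cA := cts_comp (lip_continuous kA) (cts_fst (@cts_id (R * R)%type)).
  have cB := cts_comp (lip_continuous kB) (cts_snd (@cts_id (R * R)%type)).
  by cts.
- move=> y a b ky ab; have /andP[] := lip_incr kA ab; nra.
- move=> y a b ky ab; have /andP[] := lip_incr kA ab; nra.
- move=> y a b ky ab; have /andP[] := lip_incr kB ab; nra.
- move=> y a b ky ab; have /andP[] := lip_incr kB ab; nra.
Qed.

(** The minmax of S_t (x, .) has this form, with x moved to the origin: A is the
    initial function near x and B is -t H. *)
Definition sep_minmax A B : R := infmax (normal_form A B).

(** Exchanging the coordinates preserves -x * y as well as the two ends. *)
Lemma sep_minmax_swap_le k A B : lip k A -> lip k B -> sep_minmax B A <= sep_minmax A B.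
Proof.
move=> kA kB; rewrite -[leRHS]addr0.
apply: (@infmax_pushforward _ (k + 1) (normal_form A B) _ _ _
    (fun z => (z.2, z.1)) 0 0); [exact: normal_form_saddle..| | |].
- by cts.
- by move=> z; rewrite /normal_form/= addr0 [B _ + _]addrC [z.2 * _]mulrC.
- by move=> z _ /=; rewrite addrC.
Qed.

Lemma sep_minmax_swap k A B : lip k A -> lip k B -> sep_minmax A B = sep_minmax B A.
Proof. by move=> kA kB; apply: le_anti; rewrite !(@sep_minmax_swap_le k). Qed.

Lemma sep_minmax_addc_le k A B c : lip k A -> lip k B ->
  sep_minmax (fun x => A x + c) B <= sep_minmax A B + c.
Proof.
move=> kA kB; apply: (@infmax_pushforward _ (k + 1) _ _ _ _ id c 0) => //.
- exact: normal_form_saddle.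
- by apply: normal_form_saddle => //; exact: lip_addc.
- exact: cts_id.
- by move=> z; rewrite /normal_form/=; lra.
Qed.

Lemma sep_minmax_addc k A B c : lip k A -> lip k B ->
  sep_minmax (fun x => A x + c) B = sep_minmax A B + c.
Proof.
move=> kA kB; apply: le_anti; rewrite (sep_minmax_addc_le c kA kB)/=.
have := sep_minmax_addc_le (- c) (lip_addc c kA) kB.
have -> : (fun x => A x + c + - c) = A by apply/funext => x; lra.
lra.
Qed.

(** A linear term of A acts as a translation of B, by p * x - x * y = - x * (y - p). *)
Lemma sep_minmax_tilt k A B p : lip k A -> lip k B ->
  sep_minmax (fun x => A x + p * x) B = sep_minmax A (fun y => B (y + p)).
Proof.
move=> kA kB; have k0 := lip_ge0 kA; have p0 := normr_ge0 p.
have S1 : saddle (k + `|p| + 1) (normal_form (fun x => A x + p * x) B).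
  apply: normal_form_saddle; first exact: lip_addl.
  by apply: lip_le kB; lra.
have S2 : saddle (k + `|p| + 1) (normal_form A (fun y => B (y + p))).
  apply: (saddle_widen (M := k + 1)); first by lra.
  by apply: normal_form_saddle => //; exact: lip_shift.
apply: le_anti; apply/andP; split.
- rewrite -[leRHS]addr0.
  apply: (@infmax_bounded_move _ _ _ _ S2 S1 (fun z => (z.1, z.2 + p)) 0 `|p|).
  + by cts.
  + by move=> z; rewrite /normal_form/=; lra.
  + by move=> z /=; rewrite subrr add0r [z.2 + p]addrC addrK.
- rewrite -[leRHS]addr0.
  apply: (@infmax_bounded_move _ _ _ _ S1 S2 (fun z => (z.1, z.2 - p)) 0 `|p|).
  + by cts.
  + by move=> z; rewrite /normal_form/= subrK; lra.
  + by move=> z /=; rewrite subrr add0r [z.2 - p]addrC addrK normrN.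
Qed.

(** The shear term x0 * y created by a translation of the first variable is
    absorbed in B. *)
Lemma infmax_recenter k A B x0 (f : R * R -> R) : lip k A -> lip k B ->
  (forall z, f z = A (z.1 - x0) + B z.2 - (z.1 - x0) * z.2) ->
  infmax f = sep_minmax A B.
Proof.
move=> kA kB fE; have k0 := lip_ge0 kA; have p0 := normr_ge0 x0.
have kB' : lip (k + `|x0|) (fun y => B y + x0 * y) by exact: lip_addl.
have kA' : lip (k + `|x0|) (fun x => A (x - x0)).
  by apply: lip_le (lip_shift _ kA); lra.
have S1 : saddle (k + `|x0| + 1) f.
  have -> : f = normal_form (fun x => A (x - x0)) (fun y => B y + x0 * y).
    by apply/funext => z; rewrite fE /normal_form; lra.
  exact: normal_form_saddle.
have S2 : saddle (k + `|x0| + 1) (normal_form A B).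
  by apply: (saddle_widen (M := k + 1)); [lra|exact: normal_form_saddle].
apply: le_anti; apply/andP; split.
- rewrite -[leRHS]addr0.
  apply: (@infmax_bounded_move _ _ _ _ S2 S1 (fun z => (z.1 + x0, z.2)) 0 `|x0|).
  + by cts.
  + by move=> z; rewrite fE /normal_form/= addrK; lra.
  + by move=> z /=; rewrite subrr addr0 [z.1 + _]addrC addrK.
- rewrite -[leRHS]addr0.
  apply: (@infmax_bounded_move _ _ _ _ S1 S2 (fun z => (z.1 - x0, z.2)) 0 `|x0|).
  + by cts.
  + by move=> z; rewrite fE /normal_form/=; lra.
  + by move=> z /=; rewrite subrr addr0 [z.1 - _]addrC addrK normrN.
Qed.

(** Where |x| > rho > kB the slope of the function in y has the sign of -x, so a
    shear in the y direction, proportional to the distance to the strip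
    |x| <= rho, lowers it as much as needed: only the values of A on the strip
    matter. *)
Lemma sep_minmax_le_left k kB A1 A2 B rho : lip k A1 -> lip k A2 -> lip kB B -> kB < rho ->
  (forall x, `|x| <= rho -> A1 x <= A2 x) -> sep_minmax A1 B <= sep_minmax A2 B.
Proof.
move=> k1 k2 k3 kr A12.
have k0 := lip_ge0 k1; have kB0 := lip_ge0 k3.
pose M := k + kB + 1 + rho.
have S1 : saddle M (normal_form A1 B).
  apply: (saddle_widen (M := k + kB + 1)); first by rewrite /M; lra.
  by apply: normal_form_saddle; [apply: lip_le k1; lra|apply: lip_le k3; lra].
have S2 : saddle M (normal_form A2 B).
  apply: (saddle_widen (M := k + kB + 1)); first by rewrite /M; lra.
  by apply: normal_form_saddle; [apply: lip_le k2; lra|apply: lip_le k3; lra].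
(* The gain of the shear per unit of x must balance the slopes of A1 and A2. *)
pose n := 2 * k / (rho - kB).
have n0 : 0 <= n by rewrite /n divr_ge0//; lra.
have nE : n * (rho - kB) = 2 * k by rewrite /n divfK// gt_eqF//; lra.
have M0 : 0 <= n * M by rewrite mulr_ge0// /M; lra.
have [C farC] := far_ends S2 (D := M + n * M + rho) ltac:(lra).
rewrite -[leRHS]addr0.
apply: (@infmax_pushforward _ _ _ _ S2 S1 (fun z => (z.1, z.2 + n * soft_threshold rho z.1)) 0 C).
- have cs := cts_comp (soft_threshold_cts (M := rho)) (cts_fst (@cts_id (R * R)%type)).
  by cts.
- move=> [x y]; rewrite addr0 /normal_form/=.
  have r0 : 0 < rho by lra.
  have [[xr ->]|[xr ->]|[xr ->]] := soft_threshold_cases r0 x.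
  + have h1 : 0 <= n * (x - rho) by rewrite mulr_ge0//; lra.
    have /andP[_ h2] := lip_incr k1 (ltW xr).
    have /andP[h3 _] := lip_incr k2 (ltW xr).
    have h4 : A1 rho <= A2 rho by apply: A12; rewrite ger0_norm//; lra.
    have yy : y <= y + n * (x - rho) by lra.
    have /andP[_ h5] := lip_incr k3 yy.
    have : n * (x - rho) * (rho - kB) = 2 * k * (x - rho) by rewrite -nE; ring.
    nra.
  + have h1 : n * (x + rho) <= 0 by rewrite mulr_ge0_le0//; lra.
    have xr' : x <= - rho by lra.
    have /andP[h2 _] := lip_incr k1 xr'.
    have /andP[_ h3] := lip_incr k2 xr'.
    have h4 : A1 (- rho) <= A2 (- rho) by apply: A12; rewrite normrN ger0_norm//; lra.
    have yy : y + n * (x + rho) <= y by lra.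
    have /andP[h5 _] := lip_incr k3 yy.
    have : n * (x + rho) * (rho - kB) = 2 * k * (x + rho) by rewrite -nE; ring.
    nra.
  + have h4 : A1 x <= A2 x by apply: A12; rewrite ler_norml.
    by rewrite mulr0 addr0; lra.
- have r0 : 0 < rho by lra.
  move=> [x y] /farC/= h.
  have Mr : rho <= M by rewrite /M; lra.
  have [[xr ->]|[xr ->]|[xr ->]] := soft_threshold_cases r0 x; last by rewrite mulr0 addr0.
  + have h1 : 0 <= n * (x - rho) by rewrite mulr_ge0//; lra.
    have h2 : x < M -> n * (x - rho) <= n * M.
      by move=> xM; rewrite ler_wpM2l//; lra.
    by case: h => [] [h3 h4]; split=> h5; try lra; have := h2 h4; lra.
  + have h1 : n * (x + rho) <= 0 by rewrite mulr_ge0_le0//; lra.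
    have h2 : - M < x -> n * - M <= n * (x + rho).
      by move=> xM; rewrite ler_wpM2l//; lra.
    by rewrite mulrN in h2; case: h => [] [h3 h4]; split=> h5; try lra; have := h2 h4; lra.
Qed.

Lemma sep_minmax_le_right k kA A B1 B2 rho : lip kA A -> lip k B1 -> lip k B2 -> kA < rho ->
  (forall y, `|y| <= rho -> B1 y <= B2 y) -> sep_minmax A B1 <= sep_minmax A B2.
Proof.
move=> kAA k1 k2 kr B12.
have k0 := lip_ge0 k1; have kA0 := lip_ge0 kAA.
have h1 := lip_le (ltac:(lra) : k <= k + kA) k1.
have h2 := lip_le (ltac:(lra) : k <= k + kA) k2.
have h3 := lip_le (ltac:(lra) : kA <= k + kA) kAA.
rewrite (sep_minmax_swap h3 h1) (sep_minmax_swap h3 h2); exact: (sep_minmax_le_left k1 k2 kAA kr).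
Qed.

(** The function -x * y is nonpositive on the diagonal, which generates, and
    nonnegative on the antidiagonal, which every generator crosses. *)
Lemma sep_minmax_zero : sep_minmax (fun _ => 0) (fun _ => 0) = 0.
Proof.
have S : saddle (0 + 1) (normal_form (fun _ : R => 0 : R) (fun _ : R => 0 : R)).
  by apply: normal_form_saddle; apply: lip_cst.
have [C LC] := critical_level_exists S.
apply: le_anti; apply/andP; split.
- apply: (infmax_le S LC (c1 := C)) => c Cc.
  have [n [Mn ln lNn]] := diagonal_end S LC Cc.
  have w1 := weight_diagonal S Mn.
  have [m [[z zs zm] sm]] := weight1_max S w1.
  exists m.
    apply/(maximaP S LC Cc); exists (diagonal_chain n); split => //; last by exists z.
    exact: (diagonal_chain_relative S LC Cc ln lNn).
  rewrite -zm; move: zs.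
  apply: (@carrier_path _ _ _ _ [set z | normal_form _ _ z <= 0]) => t _.
  rewrite /normal_form /segment_map/= add0r sub0r oppr_le0 -expr2.
  exact: sqr_ge0.
- apply: (infmax_ge S LC (c1 := C)) => c m Cc /(maximaP S LC Cc)[s [_ s1 _ sm]].
  have [[x y] zs /= xy] := weight1_crosses s1.
  apply: le_trans (sm _ zs); rewrite /normal_form/= add0r sub0r.
  have -> : y = - x by lra.
  by rewrite mulrN opprK -expr2 sqr_ge0.
Qed.

Lemma sep_minmax_cst a b : sep_minmax (fun _ => a) (fun _ => b) = a + b.
Proof.
have l0 (c : R) : lip 0 (fun _ => c) by exact: lip_cst.
have -> : (fun _ => a) = (fun _ : R => 0 + a) by apply/funext => x; rewrite add0r.
rewrite (@sep_minmax_addc 0 (fun _ => 0) _ a (l0 0) (l0 b)) (sep_minmax_swap (l0 0) (l0 b)).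
have -> : (fun _ => b) = (fun _ : R => 0 + b) by apply/funext => x; rewrite add0r.
by rewrite (@sep_minmax_addc 0 (fun _ => 0) _ b (l0 0) (l0 0)) sep_minmax_zero add0r addrC.
Qed.

(** For constant B the slope in y has the sign of -x up to the axis x = 0, so only
    the germ of A at 0 matters; squeeze A between constants there. *)
Lemma sep_minmax_flat k A b : lip k A -> sep_minmax A (fun _ => b) = A 0 + b.
Proof.
move=> kA; have k0 := lip_ge0 kA.
have near0 d x : `|x| <= d -> `|A x - A 0| <= k * d.
  by move=> xd; apply: le_trans (kA x 0) _; rewrite subr0 ler_wpM2l.
have kc c : lip k (fun _ => c) by exact: lip_cst.
have l0 : lip 0 (fun _ : R => b) by exact: lip_cst.
have ek e : 0 < e -> k * (e / (k + 1)) <= e.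
  by move=> e0; rewrite mulrCA ler_piMr ?(ltW e0)// ler_pdivrMr ?mul1r; lra.
have e1 e : 0 < e -> 0 < e / (k + 1) by move=> e0; rewrite divr_gt0//; lra.
apply: le_anti; apply/andP; split; apply/ler_addgt0Pr => e e0.
- have := sep_minmax_le_left kA (kc (A 0 + e)) l0 (e1 e e0).
  rewrite sep_minmax_cst => h; rewrite addrAC; apply: h => x /near0; rewrite ler_norml.
  by have := ek e e0; lra.
- have := sep_minmax_le_left (kc (A 0 - e)) kA l0 (e1 e e0).
  rewrite sep_minmax_cst => h; rewrite -lerBlDr addrAC; apply: h => x /near0; rewrite ler_norml.
  by have := ek e e0; lra.
Qed.

(** If the slopes of A stay within kappa of p, then after tilting by p only the
    values of B near p matter, and there B may be replaced by a constant. *)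
Lemma sep_minmax_upper k A B p kappa b : lip kappa (fun x => A x - p * x) -> lip k B ->
  0 < kappa -> (forall y, `|y - p| <= 2 * kappa -> B y <= b) -> sep_minmax A B <= A 0 + b.
Proof.
move=> kA kB kp Bb; have k0 := lip_ge0 kB.
have AE : A = (fun x => (A x - p * x) + p * x) by apply/funext => x; rewrite subrK.
rewrite [sep_minmax A B](congr1 (sep_minmax^~ B) AE).
rewrite (@sep_minmax_tilt (k + kappa)); last 2 first.
  by apply: lip_le kA; lra.
  by apply: lip_le kB; lra.
have := sep_minmax_flat b kA; rewrite mulr0 subr0 => <-.
apply: (sep_minmax_le_right kA (lip_shift p kB) (lip_cst b k0) (rho := 2 * kappa)); first by lra.
by move=> y yk; apply: Bb; rewrite addrK.
Qed.

Lemma sep_minmax_lower k A B p kappa b : lip kappa (fun x => A x - p * x) -> lip k B ->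
  0 < kappa -> (forall y, `|y - p| <= 2 * kappa -> b <= B y) -> A 0 + b <= sep_minmax A B.
Proof.
move=> kA kB kp Bb; have k0 := lip_ge0 kB.
have AE : A = (fun x => (A x - p * x) + p * x) by apply/funext => x; rewrite subrK.
rewrite [sep_minmax A B](congr1 (sep_minmax^~ B) AE).
rewrite (@sep_minmax_tilt (k + kappa)); last 2 first.
  by apply: lip_le kA; lra.
  by apply: lip_le kB; lra.
have := sep_minmax_flat b kA; rewrite mulr0 subr0 => <-.
apply: (sep_minmax_le_right kA (lip_cst b k0) (lip_shift p kB) (rho := 2 * kappa)); first by lra.
by move=> y yk; apply: Bb; rewrite addrK.
Qed.

End NormalForm.

(** * Lipschitz functions *)
Section LipschitzData.
Variable R : realType.
Implicit Types (v H G : R -> R) (k L r : R).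

Lemma lip_of_le k G : (forall p q, p <= q -> `|G q - G p| <= k * (q - p)) -> lip k G.
Proof.
move=> h p q; have [pq|/ltW qp] := leP p q.
  by rewrite distrC (ler0_norm (x := p - q)) ?subr_le0// opprB; exact: h.
by rewrite (ger0_norm (x := p - q)) ?subr_ge0//; exact: h.
Qed.

Lemma lip_projection (lo hi : R) : lip 1 (fun p => Num.max lo (Num.min p hi)).
Proof.
have lmax : lip 1 (Num.max lo).
  by apply: lip_of_le => p q pq; rewrite ler_norml; split_minmax; lra.
have lmin : lip 1 (Num.min^~ hi).
  by apply: lip_of_le => p q pq; rewrite ler_norml; split_minmax; lra.
by move=> p q; apply: le_trans (lmax _ _) _; rewrite mul1r; exact: lmin.
Qed.

Lemma klipschitz_lip k v : k.-lipschitz v <-> lip k v.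
Proof.
split=> [kv x y|kv [x y] _]; last exact: kv.
exact: (kv (x, y)).
Qed.

Lemma lipschitz_lip v : lipschitz v -> exists k, lip k v.
Proof.
move=> vl; have [k kv] := @filter_ex _ (+oo : set_system R) _ _ vl.
by exists k; apply/klipschitz_lip.
Qed.

(** The infimum defining the Lipschitz constant is attained. *)
Lemma lipschitz_constant_lip k v : lip k v ->
  lip (lipschitz_constant v) v /\ lipschitz_constant v <= k.
Proof.
move=> kv; set E := [set k | k.-lipschitz v].
have Ek : E k by apply/klipschitz_lip.
have lb : lbound E 0 by move=> x /klipschitz_lip /lip_ge0.
have hi : has_inf E by split; [exists k|exists 0].
split; last by apply: ge_inf => //; exists 0.
move=> x y; have [->|xy] := eqVneq x y; first by rewrite !subrr !normr0 mulr0.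
have d0 : 0 < `|x - y| by rewrite normr_gt0 subr_eq0.
rewrite -ler_pdivrMr//; apply: lb_le_inf; first by exists k.
by move=> z /klipschitz_lip zv; rewrite ler_pdivrMr.
Qed.

Lemma locally_lipschitz_continuous H : locally_lipschitz H -> continuous H.
Proof.
move=> Hl p; have [U Up HU] := Hl p.
have [k kU] := @filter_ex _ (+oo : set_system R) _ _ HU.
have kU' q : U q -> `|H p - H q| <= (`|k| + 1) * `|p - q|.
  move=> Uq; apply: le_trans (kU (p, q) _) _ => /=; first by split=> //; exact: nbhs_singleton.
  by rewrite ler_wpM2r//; have := ler_norm k; lra.
apply/cvgrPdist_le => e e0; have k1 : 0 < `|k| + 1 by rewrite ltr_wpDl.
near=> q; apply: le_trans (kU' q _) _; first by near: q.
have : `|p - q| <= e / (`|k| + 1).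
  near: q; apply: (@cvgr_dist_le _ _ _ _ _ id p); first exact: cvg_id.
  by rewrite divr_gt0.
by rewrite ler_pdivlMr// mulrC.
Unshelve. all: by end_near. Qed.

Definition lip_on r k H := forall x y, `|x| <= r -> `|y| <= r -> `|H x - H y| <= k * `|x - y|.

(** Away from the diagonal of the square the difference quotient is bounded by
    continuity, near the diagonal by the hypothesis. *)
Lemma locally_lipschitz_on H r : locally_lipschitz H -> exists2 k, 0 <= k & lip_on r k H.
Proof.
move=> Hl; have cH := locally_lipschitz_continuous Hl.
pose K : set (R * R) := `[- r, r]%classic `*` `[- r, r]%classic.
have cK : compact K by apply: compact_setX; exact: segment_compact.
pose P (M : R) (q : R * R) := `|H q.1 - H q.2| <= M * `|q.1 - q.2|.
have : \forall M \near +oo, K `<=` P M.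
  move/compact_near_coveringP : cK; apply => -[x y] _.
  have [->{x}|xy] := eqVneq x y.
    have [U Uy kU] := Hl y.
    exists (U `*` U, [set M | forall p, (U `*` U) p -> P M p]).
      by split=> //=; exists (U, U).
    by move=> [[a b] M] /= [[Ua Ub] h]; exact: h.
  have d0 : 0 < `|x - y| by rewrite normr_gt0 subr_eq0.
  set d := `|x - y| in d0.
  have cd : continuous (fun q : R * R => `|q.1 - q.2|).
    by apply: (cts_comp (@norm_continuous _ R)); cts.
  have cHd : continuous (fun q : R * R => `|H q.1 - H q.2|).
    apply: (cts_comp (@norm_continuous _ R)).
    have c1 := cts_comp cH (cts_fst (@cts_id (R * R)%type)).
    have c2 := cts_comp cH (cts_snd (@cts_id (R * R)%type)).
    by cts.
  set e := `|H x - H y|.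
  near=> q M.
  have h1 : d / 2 < `|q.1 - q.2|.
    by near: q; apply: (cvgr_gt _ (cd (x, y))); rewrite /= -/d; lra.
  have h2 : `|H q.1 - H q.2| < e + 1.
    by near: q; apply: (cvgr_lt _ (cHd (x, y))); rewrite /= -/e; lra.
  have h3 : 2 * (e + 1) / d <= M.
    by near: M; apply: nbhs_pinfty_ge; rewrite num_real.
  rewrite /P; apply: le_trans (ltW h2) _.
  have e0 : 0 <= e by exact: normr_ge0.
  have : 2 * (e + 1) / d * (d / 2) <= M * `|q.1 - q.2|.
    apply: ler_pM => //; last by lra.
    + by rewrite divr_ge0//; lra.
    + by lra.
  by rewrite (_ : 2 * (e + 1) / d * (d / 2) = e + 1)//; field; rewrite gt_eqF.
move=> h; have [k [kP k0]] : exists k, K `<=` P k /\ 0 <= k.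
  near +oo_R => k; exists k; split; last by near: k; apply: nbhs_pinfty_ge; rewrite num_real.
  by near: k.
exists k => // x y xr yr; apply: (kP (x, y)).
by rewrite /K/= !in_itv/= -!ler_norml.
Unshelve. all: by end_near. Qed.

End LipschitzData.

(** * Truncated Hamiltonians *)
Section Truncation.
Variable R : realType.
Implicit Types (v H G : R -> R) (k L r t x : R).

Lemma lipschitz_of_lip k G : lip k G -> lipschitz G.
Proof.
move=> kG; rewrite /lipschitz_on; near=> M; apply/klipschitz_lip.
by apply: lip_le kG; near: M; apply: nbhs_pinfty_ge; rewrite num_real.
Unshelve. all: by end_near. Qed.

(** H is made constant outside a segment and then multiplied by a cut-off function. *)
Lemma truncation_exists H L : locally_lipschitz H -> exists G k,
  [/\ lip k G, compact (closure [set p | G p != 0]) &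
      forall p, `|p| <= `|L| + 1 -> G p = H p].
Proof.
move=> Hl; pose r : R := `|L| + 1; have r1 : 1 <= r by rewrite /r lerDr.
rewrite -/r.
have [k k0 kH] := locally_lipschitz_on r Hl.
pose c (p : R) : R := Num.max (- r) (Num.min p r).
pose chi (p : R) : R := clamp01 (r + 1 - `|p|).
have cr p : `|c p| <= r by rewrite ler_norml /c; split_minmax; lra.
have c1 : lip 1 c by exact: lip_projection.
have chi1 : lip 1 chi.
  move=> p q; apply: le_trans (lip_projection 0 1 _ _) _.
  by rewrite opprB addrC addrA subrK distrC !mul1r; exact: ler_dist_dist.
have chib p : `|chi p| <= 1 by rewrite ger0_norm ?clamp01_ge0// clamp01_le1.
pose B : R := `|H 0| + k * r.
have Hb p : `|H (c p)| <= B.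
  have r0 : `|0 : R| <= r by rewrite normr0; lra.
  have := kH _ _ (cr p) r0; rewrite subr0 => h.
  rewrite -[H (c p)](subrK (H 0)); apply: le_trans (ler_normD _ _) _.
  by rewrite addrC /B lerD2l; apply: le_trans h _; rewrite ler_wpM2l.
have B0 : 0 <= B by apply: le_trans (Hb 0).
exists (fun p => H (c p) * chi p), (B + k); split.
- move=> p q.
  have -> : H (c p) * chi p - H (c q) * chi q =
    H (c p) * (chi p - chi q) + (H (c p) - H (c q)) * chi q by ring.
  apply: le_trans (ler_normD _ _) _; rewrite !normrM mulrDl; apply: lerD.
    by apply: ler_pM => //; rewrite -[leRHS]mul1r.
  rewrite -[leRHS]mulr1; apply: ler_pM => //.
  apply: le_trans (kH _ _ (cr p) (cr q)) _.
  by rewrite ler_wpM2l// -[leRHS]mul1r.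
- apply: (@subclosed_compact _ _ `[- (r + 1), r + 1]%classic).
  + exact: closed_closure.
  + exact: segment_compact.
  + rewrite [X in _ `<=` X](_ : _ = closure `[- (r + 1), r + 1]%classic); last first.
      by apply/closure_id; exact: itv_closed.
    apply: closure_subset => p /= Gp; rewrite in_itv/= -ler_norml leNgt.
    apply/negP => rp; move/eqP: Gp; apply.
    by rewrite /chi clamp01_0 ?mulr0//; lra.
- move=> p pr; rewrite /chi clamp01_1 ?mulr1; last by lra.
  by move: pr; rewrite ler_norml /c => /andP[pl pr]; rewrite min_l// max_r.
Qed.

Lemma truncation_nonempty H L : locally_lipschitz H -> exists G, truncation H L G.
Proof.
move=> Hl; have [G [k [kG cG GH]]] := truncation_exists L Hl.
exists G; split=> //; first exact: lipschitz_of_lip kG.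
move=> p /= pL; exists 1 => //= q; rewrite /ball/= => pq; apply: GH.
have := ler_normD p (q - p); rewrite subrKC distrC.
by have := ler_norm L; lra.
Qed.

(** Neighbourhoods of the two endpoints of the segment are enough to enlarge it. *)
Lemma truncation_margin H L G : 0 <= L -> truncation H L G ->
  exists2 e, 0 < e & forall p, `|p| <= L + e -> G p = H p.
Proof.
move=> L0 [_ _ GH].
have [e1 /= e1_gt0 h1] : nbhs L [set p | G p = H p] by apply: GH; rewrite /= ger0_norm.
have [e2 /= e2_gt0 h2] : nbhs (- L) [set p | G p = H p].
  by apply: GH; rewrite /= normrN ger0_norm.
exists (Num.min e1 e2 / 2); first by rewrite divr_gt0// lt_min e1_gt0.
set e := Num.min e1 e2.
have e1e : e <= e1 by rewrite ge_min lexx.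
have e2e : e <= e2 by rewrite ge_min lexx orbT.
have e0 : 0 < e by rewrite lt_min e1_gt0.
move=> p; rewrite ler_norml => /andP[pl pr].
have [pL|Lp] := leP p L; last first.
  by apply: h1; rewrite /ball_/= ltr_norml; lra.
have [pL'|Lp'] := leP (- L) p; last first.
  by apply: h2; rewrite /ball_/= ltr_norml; lra.
have := GH p; rewrite /= ler_norml pL pL' => /(_ isT).
exact: nbhs_singleton.
Qed.

Lemma lip_hamiltonian t k G : lip k G -> lip (`|t| * k) (fun y => - (t * G y)).
Proof.
move=> kG x y; rewrite -opprD normrN -mulrBr normrM -mulrA ler_wpM2l//; exact: kG.
Qed.

(** The slopes of v bound the range of y that the minmax can see, so the chosen
    truncation is replaced by any other extension of H. *)
Lemma minmaxE v H L G k e t x : locally_lipschitz H -> lip L v -> lip k G ->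
  0 < e -> (forall p, `|p| <= L + e -> G p = H p) ->
  minmax H t v x = sep_minmax (fun xi => v (xi + x)) (fun y => - (t * G y)).
Proof.
move=> Hl Lv kG e0 GH; have [cv cL] := lipschitz_constant_lip Lv.
set c := lipschitz_constant v in cv cL.
have c0 := lip_ge0 cv; have k0 := lip_ge0 kG.
rewrite /minmax -/c; set G1 := get _.
have G1t : truncation H c G1 by apply: getPex; exact: truncation_nonempty.
have [k1 k1G] := lipschitz_lip (let: And3 a _ _ := G1t in a).
have k10 := lip_ge0 k1G.
have [e1 e10 G1H] := truncation_margin c0 G1t.
have Av := lip_shift x cv.
pose K := c + `|t| * (k + k1).
have tk : 0 <= `|t| * k by rewrite mulr_ge0.
have tk1 : 0 <= `|t| * k1 by rewrite mulr_ge0.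
have KE : K = c + `|t| * k + `|t| * k1 by rewrite /K mulrDr addrA.
have BG : lip K (fun y => - (t * G y)).
  by apply: lip_le (lip_hamiltonian t kG); rewrite KE; lra.
have BG1 : lip K (fun y => - (t * G1 y)).
  by apply: lip_le (lip_hamiltonian t k1G); rewrite KE; lra.
have AK : lip K (fun xi => v (xi + x)) by apply: lip_le Av; rewrite KE; lra.
rewrite (infmax_recenter (x0 := x) AK BG1); last first.
  by move=> z; rewrite /generating_function subrK; ring.
set d := Num.min e e1.
have de : d <= e by rewrite ge_min lexx.
have de1 : d <= e1 by rewrite ge_min lexx orbT.
have d0 : 0 < d by rewrite lt_min e0.
have GG1 y : `|y| <= c + d -> - (t * G y) = - (t * G1 y).
  by move=> yc; rewrite GH ?G1H//; lra.
apply: le_anti; apply/andP; split.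
- apply: (sep_minmax_le_right Av BG1 BG (rho := c + d)); first by lra.
  by move=> y /GG1 ->.
- apply: (sep_minmax_le_right Av BG BG1 (rho := c + d)); first by lra.
  by move=> y /GG1 ->.
Qed.

End Truncation.

(** The closed strip of half-width kB is enough: enlarging it by d costs at most
    2 k d, by Lipschitz continuity. *)
Lemma sep_minmax_le_local (R : realType) (k kB : R) (A1 A2 B : R -> R) :
  lip k A1 -> lip k A2 -> lip kB B ->
  (forall x, `|x| <= kB -> A1 x <= A2 x) -> sep_minmax A1 B <= sep_minmax A2 B.
Proof.
move=> k1 k2 k3 A12; have k0 := lip_ge0 k1; have kB0 := lip_ge0 k3.
apply/ler_addgt0Pr => e e0; pose d := e / (2 * k + 1).
have k20 : 0 < 2 * k + 1 by lra.
have d0 : 0 < d by rewrite divr_gt0.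
have dE : d * (2 * k + 1) = e by rewrite /d divfK// gt_eqF.
have kd : 2 * (k * d) <= e by nra.
have K3 : lip (k + kB) B by apply: lip_le k3; lra.
have K2 : lip (k + kB) A2 by apply: lip_le k2; lra.
rewrite -(sep_minmax_addc e K2 K3).
apply: (sep_minmax_le_left k1 (lip_addc e k2) k3 (rho := kB + d)); first by lra.
move=> x; rewrite ler_norml => /andP[xl xr].
have [xk|kx] := leP x kB; last first.
  have /andP[_ h1] := lip_incr k1 (ltW kx); have /andP[h2 _] := lip_incr k2 (ltW kx).
  have h3 : A1 kB <= A2 kB by apply: A12; rewrite ger0_norm.
  have h4 : k * (x - kB) <= k * d by rewrite ler_wpM2l//; lra.
  by lra.
have [xk'|kx] := leP (- kB) x; last first.
  have /andP[h1 _] := lip_incr k1 (ltW kx); have /andP[_ h2] := lip_incr k2 (ltW kx).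
  have h3 : A1 (- kB) <= A2 (- kB) by apply: A12; rewrite normrN ger0_norm.
  have h4 : k * (- kB - x) <= k * d by rewrite ler_wpM2l//; lra.
  by lra.
have : A1 x <= A2 x by apply: A12; rewrite ler_norml xk' xk.
by lra.
Qed.

Section Scheme.
Variables (R : realType) (H G : R -> R) (L k : R).
Hypotheses (Hl : locally_lipschitz H) (kG : lip k G).
Hypothesis GH : forall p, `|p| <= L + 1 -> G p = H p.
Implicit Types (w phi : R -> R) (t x p kappa m eps : R) (s : seq R).

Let step t w x := sep_minmax (fun xi => w (xi + x)) (fun y => - (t * G y)).

Lemma minmax_step w t x : lip L w -> minmax H t w x = step t w x.
Proof. by move=> Lw; apply: (minmaxE _ _ Hl Lw kG ltr01). Qed.

(** The minmax is monotone and commutes with translations and with the addition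
    of constants. *)
Lemma minmax_lip w t : lip L w -> lip L (minmax H t w).
Proof.
move=> Lw; have L0 := lip_ge0 Lw.
have h a b : minmax H t w a <= minmax H t w b + L * `|a - b|.
  rewrite !minmax_step// /step.
  have kt := lip_hamiltonian t kG; have kt0 := lip_ge0 kt.
  have B : lip (L + `|t| * k) (fun y => - (t * G y)) by apply: lip_le kt; lra.
  have A : lip (L + `|t| * k) (fun xi => w (xi + b)).
    by apply: lip_le (lip_shift _ Lw); lra.
  rewrite -(sep_minmax_addc _ A B).
  apply: (sep_minmax_le_local (lip_shift a Lw) (lip_addc _ (lip_shift b Lw)) kt) => z _.
  have := Lw (z + a) (z + b); rewrite opprD addrACA subrr add0r ler_norml.
  by move=> /andP[? ?]; lra.
move=> a b; have := h a b; have := h b a; rewrite [`|b - a|]distrC ler_norml; lra.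
Qed.

Lemma step_barrier eps w phi p kappa m t x : eps = 1 \/ eps = -1 ->
  lip L w -> lip kappa (fun y => phi y - p * y) -> 0 < kappa -> 0 <= t ->
  (forall y, `|y - p| <= 2 * kappa -> eps * m <= eps * G y) ->
  (forall z, `|z - x| <= k * t -> eps * w z <= eps * phi z) ->
  eps * minmax H t w x <= eps * (phi x - t * m).
Proof.
move=> eps1 Lw kphi kp t0 mG wphi; rewrite minmax_step// /step.
have L0 := lip_ge0 Lw; have k0 := lip_ge0 kG.
have kt := lip_hamiltonian t kG; rewrite (ger0_norm t0) in kt.
have tk0 := lip_ge0 kt.
have pphi : lip (kappa + `|p|) phi.
  have -> : phi = (fun y => (phi y - p * y) + p * y) by apply/funext => y; rewrite subrK.
  exact: lip_addl.
have p0 := normr_ge0 p.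
have A1 : lip (L + kappa + `|p|) (fun xi => w (xi + x)).
  by apply: lip_le (lip_shift x Lw); lra.
have A2 : lip (L + kappa + `|p|) (fun xi => phi (xi + x)).
  by apply: lip_le (lip_shift x pphi); lra.
have A3 : lip kappa (fun xi => phi (xi + x) - p * xi).
  have -> : (fun xi => phi (xi + x) - p * xi) = (fun xi => (phi (xi + x) - p * (xi + x)) + p * x).
    by apply/funext => xi; ring.
  by apply: lip_addc; exact: (lip_shift x kphi).
have zx z : `|z| <= t * k -> `|z + x - x| <= k * t by rewrite addrK mulrC.
case: eps1 mG wphi => -> mG wphi; rewrite ?mul1r ?mulN1r ?lerN2.
- have h1 : sep_minmax (fun xi => w (xi + x)) (fun y => - (t * G y)) <=
            sep_minmax (fun xi => phi (xi + x)) (fun y => - (t * G y)).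
    apply: (sep_minmax_le_local A1 A2 kt) => z /zx /wphi; by rewrite !mul1r.
  apply: le_trans h1 _.
  have := sep_minmax_upper A3 kt kp (b := - (t * m)); rewrite add0r; apply => y /mG.
  by rewrite !mul1r lerN2 => ?; rewrite ler_wpM2l.
- have h1 : sep_minmax (fun xi => phi (xi + x)) (fun y => - (t * G y)) <=
            sep_minmax (fun xi => w (xi + x)) (fun y => - (t * G y)).
    apply: (sep_minmax_le_local A2 A1 kt) => z /zx /wphi; by rewrite !mulN1r lerN2.
  apply: le_trans h1.
  have := sep_minmax_lower A3 kt kp (b := - (t * m)); rewrite add0r; apply => y /mG.
  by rewrite !mulN1r !lerN2 => ?; rewrite ler_wpM2l.
Qed.

Lemma iterated_lip s t0 t w : lip L w -> lip L (iterated_minmax H t0 s w t).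
Proof.
elim: s t0 w => [|t1 s ih] t0 w Lw /=; first exact: minmax_lip.
by case: ifP => _; [exact: minmax_lip|apply: ih; exact: minmax_lip].
Qed.

(** An upper (eps = 1) or lower (eps = -1) barrier phi with slopes near p goes
    down at least (at most) at speed m at every step. The information it needs
    travels at speed at most k, by locality of the minmax. *)
Lemma iterated_barrier eps p kappa m s t0 t w phi x : eps = 1 \/ eps = -1 ->
  path <%R t0 s -> t0 <= t ->
  lip L w -> lip kappa (fun y => phi y - p * y) -> 0 < kappa ->
  (forall y, `|y - p| <= 2 * kappa -> eps * m <= eps * G y) ->
  (forall z, `|z - x| <= k * (t - t0) -> eps * w z <= eps * phi z) ->
  eps * iterated_minmax H t0 s w t x <= eps * (phi x - (t - t0) * m).
Proof.
move=> eps1 + + + + kp mG; elim: s t0 w phi => [|t1 s ih] t0 w phi /=.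
  by move=> _ tt Lw kphi wphi; apply: step_barrier => //; rewrite subr_ge0.
move=> /andP[t01 t1s] tt Lw kphi wphi; case: (ltP t t1) => tt1.
  by apply: step_barrier => //; rewrite subr_ge0.
have h z : `|z - x| <= k * (t - t1) ->
    eps * minmax H (t1 - t0) w z <= eps * (phi z - (t1 - t0) * m).
  move=> zx; apply: step_barrier => //; first by rewrite subr_ge0 ltW.
  move=> y yz; apply: wphi.
  have -> : y - x = (y - z) + (z - x) by ring.
  by apply: le_trans (ler_normD _ _) _; lra.
have := ih t1 (minmax H (t1 - t0) w) (fun z => phi z - (t1 - t0) * m).
move=> /(_ t1s tt1 (minmax_lip _ Lw)) h'.
have -> : phi x - (t - t0) * m = phi x - (t1 - t0) * m - (t - t1) * m by ring.
apply: h' => //.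
have -> : (fun y => phi y - (t1 - t0) * m - p * y) =
    (fun y => (phi y - p * y) + - ((t1 - t0) * m)) by apply/funext => y; ring.
exact: lip_addc.
Qed.

Definition speed : R := `|G 0| + k * (2 * (L + 1)).

(** The function w is a barrier for itself, with p = 0. *)
Lemma iterated_speed s t0 t w x : path <%R t0 s -> t0 <= t -> lip L w ->
  `|iterated_minmax H t0 s w t x - w x| <= speed * (t - t0).
Proof.
move=> t0s tt Lw; have L0 := lip_ge0 Lw; have k0 := lip_ge0 kG.
have Gs y : `|y - 0| <= 2 * (L + 1) -> `|G y| <= speed.
  move=> yL; rewrite -[G y](subrK (G 0)); apply: le_trans (ler_normD _ _) _.
  rewrite addrC /speed lerD2l; apply: le_trans (kG y 0) _.
  by rewrite ler_wpM2l.
have Lw' : lip (L + 1) (fun y => w y - 0 * y).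
  have -> : (fun y => w y - 0 * y) = w by apply/funext => y; rewrite mul0r subr0.
  by apply: lip_le Lw; lra.
have L1 : 0 < L + 1 by lra.
have := iterated_barrier (eps := 1) (m := - speed) (x := x) (or_introl erefl) t0s tt Lw Lw' L1.
have := iterated_barrier (eps := -1) (m := speed) (x := x) (or_intror erefl) t0s tt Lw Lw' L1.
rewrite !mul1r !mulN1r !lerN2 => h1 h2.
have {}h1 : w x - (t - t0) * speed <= iterated_minmax H t0 s w t x.
  by apply: h1 => [y /Gs|//]; rewrite !mulN1r lerN2 ler_norml => /andP[].
have {}h2 : iterated_minmax H t0 s w t x <= w x - (t - t0) * - speed.
  by apply: h2 => [y /Gs|//]; rewrite !mul1r ler_norml => /andP[].
by rewrite ler_norml; lra.
Qed.

Fixpoint gaps_le mu t0 s : bool :=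
  if s is t1 :: s' then (t1 - t0 <= mu) && gaps_le mu t1 s' else true.

(** The iteration is a semigroup at the nodes of the subdivision only; the node
    just before r serves for both times. *)
Lemma iterated_node mu s t0 r t w : 0 <= mu -> gaps_le mu t0 s -> path <%R t0 s ->
  t0 <= r -> r <= t -> t <= last t0 s -> lip L w ->
  exists t1 s1 w1, [/\ [/\ t1 <= r, r - t1 <= mu & path <%R t1 s1], lip L w1,
    iterated_minmax H t0 s w t = iterated_minmax H t1 s1 w1 t &
    iterated_minmax H t0 s w r = iterated_minmax H t1 [::] w1 r].
Proof.
move=> mu0; elim: s t0 w => [|t1 s ih] t0 w /=.
  move=> _ _ t0r rt tt0 Lw; exists t0, [::], w; split => //; split => //; lra.
move=> /andP[tmu gs] /andP[t01 t1s] t0r rt tl Lw.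
case: (ltP r t1) => [rt1|t1r].
  by exists t0, (t1 :: s), w; split => //; split => //=; [lra|rewrite t01].
rewrite ltNge (le_trans t1r rt)/=.
exact: ih (minmax_lip _ Lw).
Qed.

Lemma iterated_time mu s t0 r t w x : 0 <= mu -> gaps_le mu t0 s -> path <%R t0 s ->
  t0 <= r -> r <= t -> t <= last t0 s -> lip L w ->
  `|iterated_minmax H t0 s w t x - iterated_minmax H t0 s w r x| <=
    speed * (t - r) + 2 * speed * mu.
Proof.
move=> mu0 gs t0s t0r rt tl Lw.
have L0 := lip_ge0 Lw; have k0 := lip_ge0 kG.
have sp0 : 0 <= speed by rewrite addr_ge0// mulr_ge0//; lra.
have [t1 [s1 [w1 [[t1r rt1 ps1] Lw1 -> ->]]]] := iterated_node mu0 gs t0s t0r rt tl Lw.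
have h1 := iterated_speed x ps1 (le_trans t1r rt) Lw1.
have h2 := iterated_speed x (isT : path <%R t1 [::]) t1r Lw1.
have h3 : speed * (r - t1) <= speed * mu by rewrite ler_wpM2l.
move: h1 h2; rewrite !ler_norml => /andP[? ?] /andP[? ?]; lra.
Qed.

(** A barrier given at a time r that is not a node is moved back to the preceding
    node, at a cost proportional to the mesh. *)
Lemma iterated_barrier_from mu eps p kappa m s t0 r t w phi x : 0 <= mu ->
  gaps_le mu t0 s -> eps = 1 \/ eps = -1 ->
  path <%R t0 s -> t0 <= r -> r <= t -> t <= last t0 s ->
  lip L w -> lip kappa (fun y => phi y - p * y) -> 0 < kappa ->
  (forall y, `|y - p| <= 2 * kappa -> eps * m <= eps * G y) ->
  (forall z, `|z - x| <= k * (t - r + mu) ->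
     eps * iterated_minmax H t0 s w r z <= eps * phi z) ->
  eps * iterated_minmax H t0 s w t x <=
    eps * (phi x - (t - r) * m) + (speed + `|m|) * mu.
Proof.
move=> mu0 gs eps1 t0s t0r rt tl Lw kphi kp mG wphi.
have L0 := lip_ge0 Lw; have k0 := lip_ge0 kG.
have sp0 : 0 <= speed by rewrite addr_ge0// mulr_ge0//; lra.
have [t1 [s1 [w1 [[t1r rt1 ps1] Lw1 e1 e2]]]] := iterated_node mu0 gs t0s t0r rt tl Lw.
rewrite e1; rewrite e2 in wphi.
have ee : eps * eps = 1 by case: eps1 => ->; rewrite ?mulr1// mulrNN mulr1.
have := @iterated_barrier eps p kappa m s1 t1 t w1 (fun z => phi z + eps * (speed * mu)) x
  eps1 ps1 (le_trans t1r rt) Lw1.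
have -> : (fun y => phi y + eps * (speed * mu) - p * y) =
  (fun y => (phi y - p * y) + eps * (speed * mu)) by apply/funext => y; ring.
move=> /(_ (lip_addc _ kphi) kp mG) h.
have {}h : eps * iterated_minmax H t1 s1 w1 t x <=
    eps * (phi x - (t - r) * m) + speed * mu - eps * m * (r - t1).
  have -> : eps * (phi x - (t - r) * m) + speed * mu - eps * m * (r - t1) =
    eps * (phi x + eps * (speed * mu) - (t - t1) * m) + (1 - eps * eps) * (speed * mu).
    by ring.
  rewrite ee subrr mul0r addr0; apply: h => z zx.
  have zx' : `|z - x| <= k * (t - r + mu).
    by apply: le_trans zx _; rewrite ler_wpM2l//; lra.
  rewrite mulrDr mulrA ee mul1r.
  have := wphi z zx'; have := iterated_speed z (isT : path <%R t1 [::]) t1r Lw1.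
  have h3 : speed * (r - t1) <= speed * mu by rewrite ler_wpM2l.
  by rewrite ler_norml => /andP[]; case: eps1 => ->; rewrite ?mul1r ?mulN1r; lra.
apply: le_trans h _.
have : `|eps * m * (r - t1)| <= `|m| * mu.
  rewrite !normrM; have -> : `|eps| = 1 by case: eps1 => ->; rewrite ?normrN normr1.
  rewrite mul1r ler_wpM2l// ger0_norm//; lra.
by rewrite ler_norml => /andP[? ?]; lra.
Qed.

End Scheme.

(** * Test functions and uniform continuity on the strip *)
Section TestFunctions.
Variables (R : realType) (T : R).

Lemma open_open_strip : open (@open_strip R T).
Proof.
have -> : @open_strip R T = (fst @^-1` [set t : R | 0 < t]) `&` (fst @^-1` [set t : R | t < T]).
  apply/seteqP; split => z; rewrite /open_strip/=; first by move=> /andP[].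
  by move=> [-> ->].
apply: openI.
  by apply: open_comp; [move=> z _; exact: cvg_fst|exact: open_gt].
by apply: open_comp; [move=> z _; exact: cvg_fst|exact: open_lt].
Qed.

Variables (alpha beta dalpha dbeta : R -> R).
Hypothesis alpha_drv : forall t : R, 0 < t < T -> is_derive t (1 : R) alpha (dalpha t).
Hypothesis dalpha_cts : forall t : R, 0 < t < T -> {for t, continuous dalpha}.
Hypothesis beta_drv : forall x : R, is_derive x (1 : R) beta (dbeta x).
Hypothesis dbeta_cts : continuous dbeta.

Let psi (z : R * R) := alpha z.1 + beta z.2.

Lemma separated_diff z : open_strip T z ->
  is_diff z psi (fun h => dalpha z.1 * h.1 + dbeta z.2 * h.2).
Proof.
move=> zT.
have fst_diff : is_diff z (fst : R * R -> R) (fst : R * R -> R).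
  have c : continuous (fst : R * R -> R) by move=> ?; exact: cvg_fst.
  by apply: DiffDef; [exact: linear_differentiable|exact: diff_lin].
have snd_diff : is_diff z (snd : R * R -> R) (snd : R * R -> R).
  have c : continuous (snd : R * R -> R) by move=> ?; exact: cvg_snd.
  by apply: DiffDef; [exact: linear_differentiable|exact: diff_lin].
have drv_diff (g : R -> R) (x d : R) : is_derive x (1 : R) g d -> is_diff x g (fun h => d * h).
  move=> gd; apply: DiffDef; first by apply/derivable1_diffP.
  rewrite deriv1E// derive1E derive_val; apply/funext => h.
  by rewrite [LHS]mulrC.
have a_diff := drv_diff _ _ _ (alpha_drv zT).
have b_diff := drv_diff _ _ _ (beta_drv z.2).
have h1 := is_diff_comp fst_diff a_diff.
have h2 := is_diff_comp snd_diff b_diff.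
exact: is_diffD h1 h2.
Qed.

Lemma separated_derive z h : open_strip T z ->
  'D_h psi z = dalpha z.1 * h.1 + dbeta z.2 * h.2.
Proof.
move=> /separated_diff d; rewrite deriveE; last exact: ex_diff.
by rewrite diff_val.
Qed.

Lemma separated_C1 : C1_on (open_strip T) psi.
Proof.
move=> z zT; split=> [|h].
  by have d := separated_diff zT; exact: ex_diff.
have : (fun w => dalpha w.1 * h.1 + dbeta w.2 * h.2) @ z -->
    dalpha z.1 * h.1 + dbeta z.2 * h.2.
  apply: cvgD; apply: cvgM; try exact: cvg_cst.
  - by apply: (@cvg_comp _ _ _ fst dalpha _ (nbhs z.1)); [exact: cvg_fst|exact: dalpha_cts].
  - by apply: (@cvg_comp _ _ _ snd dbeta _ (nbhs z.2)); [exact: cvg_snd|exact: dbeta_cts].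
have zn : nbhs z (open_strip T).
  by apply: open_nbhs_nbhs; split => //; exact: open_open_strip.
rewrite -(separated_derive h zT); apply: cvg_trans; apply: near_eq_cvg; near=> w.
by rewrite separated_derive//; near: w; exact: zn.
Unshelve. all: by end_near. Qed.

Lemma separated_dt z : open_strip T z -> dt psi z = dalpha z.1.
Proof. by move=> zT; rewrite /dt separated_derive//= mulr1 mulr0 addr0. Qed.

Lemma separated_dx z : open_strip T z -> dx psi z = dbeta z.2.
Proof. by move=> zT; rewrite /dx separated_derive//= mulr1 mulr0 add0r. Qed.

End TestFunctions.

Section Expansion.
Variable R : realType.

Lemma diff_pair (psi : R * R -> R) z a b : differentiable psi z ->
  'd psi z (a, b) = a * dt psi z + b * dx psi z.
Proof.
move=> d; rewrite /dt /dx !deriveE//.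
have -> : (a, b) = a *: ((1, 0) : R * R) + b *: ((0, 1) : R * R).
  apply: injective_projections => /=.
    by rewrite [a *: 1]mulr1 [b *: 0]mulr0 addr0.
  by rewrite [a *: 0]mulr0 [b *: 1]mulr1 add0r.
by rewrite linearD !linearZ.
Qed.

Lemma diff_expansion (psi : R * R -> R) z kappa : differentiable psi z -> 0 < kappa ->
  \forall w \near z, `|psi w - psi z - ((w.1 - z.1) * dt psi z + (w.2 - z.2) * dx psi z)| <=
    kappa * (`|w.1 - z.1| + `|w.2 - z.2|).
Proof.
move=> d k0; have /diff_locallyP[_ h] := d.
have /eqaddoP/(_ _ k0)/nbhs_ballP[e /= e0 he] := h.
apply/nbhs_ballP; exists e => //= w [wz1 wz2].
have zw1 : `|z.1 - w.1| < e := wz1.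
have zw2 : `|z.2 - w.2| < e := wz2.
have : ball (0 : R * R) e (w - z).
  split; first by rewrite -[ball _ _ _]/(is_true (`|0 - (w.1 - z.1)| < e)) sub0r normrN distrC.
  by rewrite -[ball _ _ _]/(is_true (`|0 - (w.2 - z.2)| < e)) sub0r normrN distrC.
move=> /he.
rewrite [X in `|X| <= _](_ : _ = psi w - psi z - 'd psi z (w - z)); last first.
  by rewrite -[LHS]/(psi (w - z + z) - (psi z + 'd psi z (w - z))) subrK opprD addrA.
rewrite (diff_pair (w.1 - z.1) (w.2 - z.2) d : 'd psi z (w - z) = _) => /le_trans; apply.
rewrite ler_wpM2l ?(ltW k0)// prod_normE/= ge_max.
by rewrite lerDl lerDr !normr_ge0.
Qed.

End Expansion.

Section UniformContinuity.
Variables (R : realType) (T : R).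
Hypothesis T0 : 0 < T.

Definition uc_strip (u : R * R -> R) := forall e, 0 < e -> exists2 d, 0 < d &
  forall t x s y, 0 <= t <= T -> 0 <= s <= T -> `|t - s| < d -> `|x - y| < d ->
    `|u (t, x) - u (s, y)| < e.

Lemma unif_continuous_strip u :
  unif_continuous (u : subspace (closed_strip T) -> R) <-> uc_strip u.
Proof.
rewrite unif_continuousP; split=> h e e0; have [d d0 hd] := h e e0; exists d => //.
  move=> t x s y tT sT ts xy.
  have := hd ((t, x), (s, y)); rewrite /ball/= /subspace_ball mem_set//; apply.
  by split => //; split.
move=> [[t x] [s y]]; rewrite /ball/= /subspace_ball; case: ifPn => [tT [sT [ts xy]]|_ ->].
  by apply: hd => //; move: tT; rewrite inE.
by rewrite subrr normr0.
Qed.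

(** Cut a segment of the strip into short steps. *)
Lemma uc_strip_growth u : uc_strip u -> exists2 C, 0 <= C &
  forall t x s y, 0 <= t <= T -> 0 <= s <= T ->
    `|u (t, x) - u (s, y)| <= C * (1 + `|x - y|).
Proof.
move=> ucu; have [d d0 hd] := ucu 1 ltr01; have TT := T0.
have steps n : forall t x s y, 0 <= t <= T -> 0 <= s <= T ->
    `|t - s| < n.+1%:R * d -> `|x - y| < n.+1%:R * d -> `|u (t, x) - u (s, y)| <= n.+1%:R.
  elim: n => [|n ih] t x s y tT sT ts xy.
    by rewrite !mul1r in ts xy; apply/ltW/hd.
  have n1 : 0 < n.+1%:R :> R by rewrite ltr0n.
  have n2 : (n.+2%:R : R) = n.+1%:R + 1 by rewrite -[n.+2]addn1 natrD.
  rewrite n2 in ts xy *.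
  set N : R := n.+1%:R in n1 ih n2 ts xy *.
  pose l := N / (N + 1).
  have N1 : 0 < N + 1 by lra.
  have l0 : 0 <= l <= 1.
    by apply/andP; split; [rewrite divr_ge0//; lra|rewrite ler_pdivrMr// mul1r lerDl].
  have lE : l * (N + 1) = N by rewrite /l divfK// gt_eqF.
  have ll : 0 < l by rewrite /l divr_gt0.
  clearbody l.
  have dist a b : `|a - b| < (N + 1) * d -> `|a - (a + l * (b - a))| < N * d /\
      `|a + l * (b - a) - b| < d.
    move=> ab; have -> : a - (a + l * (b - a)) = l * (a - b) by ring.
    have -> : a + l * (b - a) - b = (1 - l) * (a - b) by ring.
    rewrite !normrM (ger0_norm (x := l)); last by case/andP: l0.
    rewrite (ger0_norm (x := 1 - l)); last by case/andP: l0 => _ l1; rewrite subr_ge0.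
    have l1 : (1 - l) * (N + 1) = 1 by rewrite mulrBl lE; ring.
    have ll1 : 0 < 1 - l by rewrite -(pmulr_lgt0 _ N1) l1.
    split.
      by rewrite (_ : N * d = l * ((N + 1) * d)); [rewrite ltr_pM2l|rewrite mulrA lE].
    by rewrite [ltRHS](_ : d = (1 - l) * ((N + 1) * d)); [rewrite ltr_pM2l|rewrite mulrA l1 mul1r].
  have [ts1 ts2] := dist _ _ ts; have [xy1 xy2] := dist _ _ xy.
  have rT : 0 <= t + l * (s - t) <= T by nra.
  have h1 := ih t x _ _ tT rT ts1 xy1.
  have h2 := hd _ _ s y rT sT ts2 xy2.
  rewrite -(subrKA (u (t + l * (s - t), x + l * (y - x)))).
  by apply: le_trans (ler_normD _ _) _; apply: lerD => //; exact: ltW.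
exists (T / d + 1 / d + 1); first by rewrite !addr_ge0// divr_ge0// ltW.
move=> t x s y tT sT.
pose r := (T + `|x - y|) / d.
have xy0 := normr_ge0 (x - y).
have r0 : 0 <= r by rewrite divr_ge0 ?ltW//; lra.
have /andP[n1 n2] := truncn_itv r0.
have rE : r * d = T + `|x - y| by rewrite /r divfK// gt_eqF.
have rn : T + `|x - y| < (Num.truncn r).+1%:R * d by rewrite -rE ltr_pM2r.
have := steps (Num.truncn r) t x s y tT sT.
have ts : `|t - s| <= T by rewrite ler_norml; lra.
move=> /(_ (le_lt_trans (_ : _ <= _) rn) (le_lt_trans (_ : _ <= _) rn)) h.
apply: le_trans (h _ _) _; [by lra|by lra|].
rewrite -addn1 natrD; apply: le_trans (_ : r + 1 <= _); first by rewrite lerD2r.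
rewrite /r mulrDl; have e1 : 0 <= T / d * `|x - y| by rewrite mulr_ge0// divr_ge0// ltW.
have -> : (T / d + 1 / d + 1) * (1 + `|x - y|) =
  T / d + `|x - y| / d + 1 + (T / d * `|x - y| + 1 / d + `|x - y|) by ring.
have d1 : 0 <= 1 / d by rewrite divr_ge0// ltW.
by rewrite lerDl; lra.
Qed.

Definition clamp_time (t : R) : R := Num.max 0 (Num.min t T).

Lemma clamp_time_in t : 0 <= clamp_time t <= T.
Proof. by rewrite /clamp_time; have := T0; split_minmax; lra. Qed.

Lemma clamp_time_id t : 0 <= t <= T -> clamp_time t = t.
Proof. by move=> /andP[? ?]; rewrite /clamp_time min_l// max_r. Qed.

Lemma uc_strip_continuous u : uc_strip u ->
  continuous (fun z => u (clamp_time z.1, z.2)).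
Proof.
move=> ucu z; apply/cvgrPdist_le => e e0; have [d d0 hd] := ucu e e0.
near=> w.
have ts : `|z.1 - w.1| < d.
  by near: w; apply: (@cvgr_dist_lt _ _ _ _ _ fst z.1) => //; exact: cvg_fst.
have xy : `|z.2 - w.2| < d.
  by near: w; apply: (@cvgr_dist_lt _ _ _ _ _ snd z.2) => //; exact: cvg_snd.
apply/ltW/hd; rewrite ?clamp_time_in//.
by apply: le_lt_trans ts; rewrite -[leRHS]mul1r; exact: lip_projection.
Unshelve. all: by end_near. Qed.

End UniformContinuity.

(** * Comparison of viscosity subsolutions and supersolutions *)
Section SmoothPieces.
Variables (R : realType) (T : R).

Lemma is_derive_parabola (c a x : R) :
  is_derive x (1 : R) (fun y => c * (y - a) ^+ 2) (2 * c * (x - a)).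
Proof.
have h : is_derive x (1 : R) (fun y => y - a) (1 - 0).
  exact: is_deriveB.
have h3 := is_deriveZ c (is_deriveM h h).
have -> : (fun y => c * (y - a) ^+ 2) = c \*: ((fun y => y - a) * (fun y => y - a)).
  by apply/funext => y; rewrite expr2.
apply: is_derive_eq h3 _.
rewrite /GRing.scale/=; ring.
Qed.

Lemma is_derive_barrier (eta t : R) : t < T ->
  is_derive t (1 : R) (fun r => eta * (T - r)^-1) (eta * (T - t) ^- 2).
Proof.
move=> tT; have t0 : T - t != 0 by rewrite gt_eqF// subr_gt0.
have h : is_derive t (1 : R) (fun r => T - r) (0 - 1) by exact: is_deriveB.
have dh : derivable (fun r : R => T - r) t 1 by exact: ex_derive.
have h2 : is_derive t (1 : R) (fun r => (T - r)^-1) ((T - t) ^- 2).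
  apply: DeriveDef; first exact: derivableV.
  by rewrite deriveV// derive_val sub0r [LHS]mulrN1 opprK.
by have := is_deriveZ eta h2.
Qed.

Lemma barrier_cts (eta c a t : R) : t < T ->
  {for t, continuous (fun r => 2 * c * (r - a) + eta * (T - r) ^- 2)}.
Proof.
move=> tT.
have c1 : continuous (fun r : R => 2 * c * (r - a)) by cts.
have c2 : continuous (fun r : R => (T - r) * (T - r)) by cts.
apply: cvgD; first exact: c1.
apply: cvgM; first exact: cvg_cst.
apply: (@cvgV _ _ _ (nbhs_filter t)); first by rewrite expf_neq0// gt_eqF// subr_gt0.
by have := c2 t; rewrite /continuous_at -expr2; under eq_fun do rewrite -expr2.
Qed.

End SmoothPieces.

(** Divide by h and let h tend to 0 from both sides. *)
Lemma small_slope (R : realType) (p c L r : R) : 0 < r -> 0 <= c ->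
  (forall h, `|h| <= r -> p * h - c * h ^+ 2 <= L * `|h|) -> `|p| <= L.
Proof.
move=> r0 c0 hp; apply/ler_addgt0Pr => e e0.
pose h := Num.min r (e / (c + 1)).
have c1 : 0 < c + 1 by lra.
have h0 : 0 < h by rewrite lt_min r0 divr_gt0.
have hr : h <= r by rewrite ge_min lexx.
have he : c * h <= e.
  have : h <= e / (c + 1) by rewrite ge_min lexx orbT.
  by rewrite ler_pdivlMr// => ?; nra.
clearbody h.
have [p0|p0] := leP 0 p.
  have := hp h; rewrite ger0_norm ?(ltW h0)// => /(_ hr) k.
  by rewrite ger0_norm// -(ler_pM2r h0); nra.
have := hp (- h); rewrite normrN ger0_norm ?(ltW h0)// sqrrN => /(_ hr) k.
by rewrite ltr0_norm// -(ler_pM2r h0); nra.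
Qed.

(** A quadratic penalty that is bounded by an affine function of |D| bounds D, and
    then every penalty. *)
Lemma penalties_bounded (R : realType) (C al D E dx et : R) : 0 <= C -> 1 <= al -> 0 <= dx -> 0 <= et ->
  al * D ^+ 2 + al * E ^+ 2 + dx + et <= C * (1 + `|D|) ->
  [/\ `|D| <= C + 1, al * D ^+ 2 <= C * (C + 2), al * E ^+ 2 <= C * (C + 2),
      dx <= C * (C + 2) & et <= C * (C + 2)].
Proof.
move=> C0 al1 dx0 et0 h.
have D2 : `|D| ^+ 2 = D ^+ 2 by exact: (real_normK (num_real D)).
have aD0 : D ^+ 2 <= al * D ^+ 2 by rewrite ler_peMl ?sqr_ge0.
have aE0 : 0 <= al * E ^+ 2 by rewrite mulr_ge0 ?sqr_ge0//; lra.
have d0 : 0 <= D ^+ 2 by exact: sqr_ge0.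
have DC : `|D| <= C + 1.
  rewrite leNgt; apply/negP => DC.
  have : `|D| ^+ 2 <= C * (1 + `|D|) by rewrite D2; lra.
  by rewrite expr2; clear - C0 DC; nra.
have tot : C * (1 + `|D|) <= C * (C + 2) by rewrite ler_wpM2l//; lra.
by split; lra.
Qed.

Lemma sqr_small (R : realType) (al d r C : R) : 0 < al -> 0 < d -> C < al * d ^+ 2 -> al * r ^+ 2 <= C ->
  `|r| < d.
Proof.
move=> al0 d0 Cd rC; rewrite ltNge; apply/negP => dr.
have : al * d ^+ 2 <= al * r ^+ 2.
  rewrite ler_wpM2l ?(ltW al0)// -(real_normK (num_real r)) ler_sqr ?nnegrE//.
  exact: ltW.
by lra.
Qed.

Lemma weighted_sqr_bound (R : realType) (del C x : R) : 0 < del -> 0 <= C -> del * x ^+ 2 <= C ->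
  `|x| <= 1 + C / del.
Proof.
move=> del0 C0; rewrite -(real_normK (num_real x)) => h; rewrite leNgt; apply/negP => xq.
have qE : C / del * del = C by rewrite divfK// gt_eqF.
have q0 : 0 <= C / del by rewrite divr_ge0// ltW.
set q := C / del in qE q0 xq; clearbody q; move: h; rewrite expr2 -qE.
set X := `|x| in xq *; clearbody X => h.
have qX : q < X * X by nra.
have : del * q < del * (X * X) by rewrite ltr_pM2l.
by rewrite [del * q]mulrC; lra.
Qed.

Section Comparison.
Variables (R : realType) (T L : R) (H : R -> R) (a b : R * R -> R).
Hypothesis (T0 : 0 < T).
Hypothesis Hl : locally_lipschitz H.
Hypothesis uca : uc_strip T a.
Hypothesis ucb : uc_strip T b.
Hypothesis sub : viscosity_subsolution T H a.
Hypothesis sup : viscosity_supersolution T H b.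
Hypothesis init : forall x, a (0, x) <= b (0, x).

(** Lipschitz continuity of one function is enough to keep the slopes bounded: at
    a maximum of the doubled function both share the same slope. *)
Hypothesis spatial : (forall t, 0 <= t <= T -> lip L (fun x => a (t, x))) \/
  (forall t, 0 <= t <= T -> lip L (fun x => b (t, x))).

(** The initial order absorbs the growth of the two functions themselves. *)
Lemma difference_growth : exists2 C, 0 <= C & forall t x s y,
  0 <= t <= T -> 0 <= s <= T -> a (t, x) - b (s, y) <= C * (1 + `|x - y|).
Proof.
have TT := T0.
have [Ca Ca0 ha] := uc_strip_growth T0 uca; have [Cb Cb0 hb] := uc_strip_growth T0 ucb.
exists (Ca + Cb); first exact: addr_ge0.
move=> t x s y tT sT.
have z0 : 0 <= (0 : R) <= T by lra.
have := ha t x 0 x tT z0; have := hb 0 x s y z0 sT.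
rewrite subrr normr0 !ler_norml => /andP[_ h1] /andP[_ h2].
have := init x; have xy := normr_ge0 (x - y); nra.
Qed.

(** The penalties bring the two points together, confine x and keep t away from
    T. *)
Definition doubled (al del eta t x s y : R) : R :=
  a (t, x) - b (s, y) -
  (al * (x - y) ^+ 2 + al * (t - s) ^+ 2 + del * x ^+ 2 + eta * (T - t)^-1).

Definition doubled_max (al del eta T' rho t x s y : R) : Prop :=
  forall t' x' s' y', 0 <= t' <= T' -> `|x'| <= rho -> 0 <= s' <= T' -> `|y'| <= rho ->
    doubled al del eta t' x' s' y' <= doubled al del eta t x s y.

Lemma doubled_max_exists al del eta T' rho : 0 < T' < T -> 0 <= rho ->
  exists t x s y, [/\ 0 <= t <= T', `|x| <= rho, 0 <= s <= T', `|y| <= rho &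
    doubled_max al del eta T' rho t x s y].
Proof.
move=> /andP[T'0 T'T] rho0.
pose Phi (p : (R * R) * (R * R)) : R :=
  a (clamp_time T p.1.1, p.1.2) - b (clamp_time T p.2.1, p.2.2)
  - (al * ((p.1.2 - p.2.2) * (p.1.2 - p.2.2)) + al * ((p.1.1 - p.2.1) * (p.1.1 - p.2.1))
     + del * (p.1.2 * p.1.2) + eta * (Num.max (T - p.1.1) (T - T'))^-1).
have cPhi : continuous Phi.
  have ca := cts_comp (uc_strip_continuous T0 uca) (cts_fst (@cts_id ((R * R) * (R * R))%type)).
  have cb := cts_comp (uc_strip_continuous T0 ucb) (cts_snd (@cts_id ((R * R) * (R * R))%type)).
  rewrite /Phi; cts; apply: ctsV; last by cts.
  by move=> p; rewrite gt_eqF// lt_max [0 < T - T']subr_gt0 T'T orbT.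
pose I : set (R * R) := `[0, T']%classic `*` `[- rho, rho]%classic.
pose K := I `*` I.
have cK : compact K.
  by apply: compact_setX; apply: compact_setX; exact: segment_compact.
have KE t x s y : K ((t, x), (s, y)) <->
    [/\ 0 <= t <= T', `|x| <= rho, 0 <= s <= T' & `|y| <= rho].
  rewrite /K /I/= !in_itv/= -!ler_norml; split; first by move=> [[? ?] [? ?]].
  by move=> [? ? ? ?].
have K1 : K ((0, 0), (0, 0)).
  by apply/KE; rewrite lexx normr0 (ltW T'0) rho0.
have [[[t x] [s y]] + Pmax] := compact_EVT_max (ex_intro _ _ K1) cK (continuous_subspaceT cPhi).
rewrite inE => /KE[tT' xr sT' yr].
have PhiE t' x' s' y' : 0 <= t' <= T' -> 0 <= s' <= T' -> Phi ((t', x'), (s', y')) =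
    doubled al del eta t' x' s' y'.
  move=> /andP[t'0 t'T] /andP[s'0 s'T].
  have t'I : 0 <= t' <= T by rewrite t'0 (le_trans t'T (ltW T'T)).
  have s'I : 0 <= s' <= T by rewrite s'0 (le_trans s'T (ltW T'T)).
  rewrite /Phi/= (clamp_time_id t'I) (clamp_time_id s'I).
  by rewrite max_l ?lerD2l ?lerN2// -!expr2.
exists t, x, s, y; split => // t' x' s' y' ? ? ? ?.
by rewrite -!PhiE//; apply: Pmax; rewrite inE; apply/KE.
Qed.

Section InteriorMaximum.
Variables (al del eta T' rho t x s y : R).
Hypotheses (al0 : 0 < al) (del0 : 0 < del) (T'T : T' < T).
Hypotheses (tT' : 0 < t < T') (sT' : 0 < s < T').
Hypotheses (xr : `|x| < rho) (yr : `|y| < rho).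
Hypothesis tmax : doubled_max al del eta T' rho t x s y.

Let p := 2 * al * (x - y).
Let q := 2 * del * x.

Let tT : 0 <= t <= T'. Proof. by case/andP: tT' => /ltW -> /ltW ->. Qed.
Let sT : 0 <= s <= T'. Proof. by case/andP: sT' => /ltW -> /ltW ->. Qed.

(** Whichever of the two functions is Lipschitz in space, optimality in its space
    variable bounds the common slope. *)
Lemma doubled_slope : `|p| <= L + `|q|.
Proof.
have tI : 0 <= t <= T by case/andP: tT => -> k; rewrite (le_trans k (ltW T'T)).
have sI : 0 <= s <= T by case/andP: sT => -> k; rewrite (le_trans k (ltW T'T)).
case: spatial => lipx.
  have : `|- (p + q)| <= L.
    apply: (@small_slope _ _ (al + del) _ (rho - `|x|)) => [||h hr].
    - by rewrite subr_gt0.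
    - by rewrite addr_ge0 ?ltW.
    have xh : `|x + h| <= rho by apply: le_trans (ler_normD _ _) _; rewrite addrC -lerBrDr.
    have := tmax tT xh sT (ltW yr); rewrite /doubled.
    have := lipx t tI (x + h) x; rewrite [x + h - x]addrC addKr ler_norml => /andP[k1 _].
    have -> : - (p + q) * h - (al + del) * h ^+ 2 =
      (al * (x - y) ^+ 2 + del * x ^+ 2) - (al * (x + h - y) ^+ 2 + del * (x + h) ^+ 2).
      by rewrite /p /q; ring.
    move: (al * _) (al * _) (del * _) (del * _) (al * _) (eta * _) => *; lra.
  by rewrite normrN => k1; have := ler_normB (p + q) q; rewrite addrK =>
    /le_trans; apply; rewrite lerD2r.
have : `|p| <= L.
  apply: (@small_slope _ _ al _ (rho - `|y|)) => [||h hr].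
  - by rewrite subr_gt0.
  - exact: ltW.
  have yh : `|y + h| <= rho by apply: le_trans (ler_normD _ _) _; rewrite addrC -lerBrDr.
  have := tmax tT (ltW xr) sT yh; rewrite /doubled.
  have := lipx s sI (y + h) y; rewrite [y + h - y]addrC addKr ler_norml => /andP[_ k1].
  have -> : p * h - al * h ^+ 2 = al * (x - y) ^+ 2 - al * (x - (y + h)) ^+ 2.
    by rewrite /p; ring.
  move: (al * _) (al * _) (del * _) (al * _) (eta * _) => *; lra.
by move=> h; apply: le_trans h _; rewrite lerDl.
Qed.

Let near_box (t0 x0 : R) : 0 < t0 < T' -> `|x0| < rho ->
  \forall w \near (t0, x0), 0 <= w.1 <= T' /\ `|w.2| <= rho.
Proof.
move=> /andP[t00 t0T] x0r.
have cn : continuous (fun w : R * R => `|w.2|).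
  exact: cts_comp (@norm_continuous _ R) (cts_snd (@cts_id (R * R)%type)).
near=> w; split.
  apply/andP; split; apply/ltW.
    by near: w; apply: (@cvgr_gt _ _ _ _ fst t0) => //; exact: cvg_fst.
  by near: w; apply: (@cvgr_lt _ _ _ _ fst t0) => //; exact: cvg_fst.
by apply/ltW; near: w; apply: (cvgr_lt _ (cn (t0, x0))).
Unshelve. all: by end_near. Qed.

Let sub_at : 2 * al * (t - s) + eta * (T - t) ^- 2 + H (p + q) <= 0.
Proof.
have tx_strip : open_strip T (t, x).
  by case/andP: tT' => k1 k2; rewrite /open_strip/= k1 (lt_trans k2 T'T).
have ad r : 0 < r < T -> is_derive r (1 : R)
    (fun r => al * (r - s) ^+ 2 + eta * (T - r)^-1)
    (2 * al * (r - s) + eta * (T - r) ^- 2).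
  move=> /andP[_ rT]; have A := is_derive_parabola al s r.
  by have := is_deriveD A (is_derive_barrier eta rT).
have ac r : 0 < r < T ->
    {for r, continuous (fun r => 2 * al * (r - s) + eta * (T - r) ^- 2)}.
  by move=> /andP[_ rT]; exact: barrier_cts.
have bd r : is_derive r (1 : R) (fun r => al * (r - y) ^+ 2 + del * (r - 0) ^+ 2)
    (2 * al * (r - y) + 2 * del * (r - 0)).
  by have := is_deriveD (is_derive_parabola al y r) (is_derive_parabola del 0 r).
have bc : continuous (fun r : R => 2 * al * (r - y) + 2 * del * (r - 0)) by cts.
have [_ subP] := sub.
have := subP _ _ (separated_C1 ad ac bd bc) tx_strip.
rewrite (separated_dt ad bd tx_strip) (separated_dx ad bd tx_strip)/= subr0.
apply; have := near_box tT' xr; apply: filterS => -[t' x'] /= [t'T x'r].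
have := tmax t'T x'r sT (ltW yr); rewrite /doubled !subr0.
move: (al * _) (al * _) (del * _) (eta * _) (al * _) (al * _) (del * _) (eta * _) => *; lra.
Qed.

Let sup_at : 0 <= 2 * al * (t - s) + H p.
Proof.
have sy_strip : open_strip T (s, y).
  by case/andP: sT' => k1 k2; rewrite /open_strip/= k1 (lt_trans k2 T'T).
have ad r : 0 < r < T -> is_derive r (1 : R) (fun r => - al * (r - t) ^+ 2)
    (2 * - al * (r - t)).
  by move=> _; exact: is_derive_parabola.
have ac r : 0 < r < T -> {for r, continuous (fun r => 2 * - al * (r - t))}.
  move=> _; have c : continuous (fun r => 2 * - al * (r - t)) by cts.
  exact: c.
have bd r : is_derive r (1 : R) (fun r => - al * (r - x) ^+ 2) (2 * - al * (r - x)).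
  exact: is_derive_parabola.
have bc : continuous (fun r : R => 2 * - al * (r - x)) by cts.
have [_ supP] := sup.
have := supP _ _ (separated_C1 ad ac bd bc) sy_strip.
rewrite (separated_dt ad bd sy_strip) (separated_dx ad bd sy_strip)/=.
have -> : 2 * - al * (s - t) = 2 * al * (t - s) by ring.
have -> : 2 * - al * (y - x) = p by rewrite /p; ring.
apply; have := near_box sT' yr; apply: filterS => -[s' y'] /= [s'T y'r].
have := tmax tT (ltW xr) s'T y'r; rewrite /doubled.
have e1 (c d : R) : - al * (c - d) ^+ 2 = - (al * (d - c) ^+ 2) by ring.
rewrite !e1.
move: (al * _) (al * _) (del * _) (eta * _) (al * _) (al * _) => *; lra.
Qed.

(** The two equations hold at the maximum with slopes that differ by q only, while
    the barrier at time T contributes a strict difference. *)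
Lemma doubled_strict : eta * (T - t) ^- 2 <= H p - H (p + q).
Proof. by have := sub_at; have := sup_at; lra. Qed.

End InteriorMaximum.

(** The size of the gap fixes eta; del makes the slope q of the space confinement
    negligible; finally al brings the two points so close together that the
    initial order excludes the initial time. *)
Lemma comparison_interior t1 x1 : 0 < t1 < T -> a (t1, x1) <= b (t1, x1).
Proof.
move=> /andP[t10 t1T]; rewrite leNgt; apply/negP => ba.
have TT := T0; have [C C0 Cab] := difference_growth.
pose theta := a (t1, x1) - b (t1, x1).
have th0 : 0 < theta by rewrite subr_gt0.
have t1I : 0 <= t1 <= T by lra.
have thC : theta <= C by have := Cab t1 x1 t1 x1 t1I t1I; rewrite subrr normr0 addr0 mulr1.
have [C2 [C2E C20 CC2]] : exists C2, [/\ C * (C + 2) = C2, 0 < C2 & C <= C2].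
  by exists (C * (C + 2)); split => //; nra.
have C21 : 0 < C2 + 1 by lra.
have [eta [eta0 eta1 etaE]] : exists eta, [/\ 0 < eta, eta / (T - t1) = theta / 4 &
    4 * eta = theta * (T - t1)].
  exists (theta * (T - t1) / 4); split; first by nra.
    by field; rewrite gt_eqF; lra.
  by field.
have [kap [kap0 kapE]] : exists kap, 0 < kap /\ kap * (2 * (C2 + 1)) = eta.
  exists (eta / (2 * (C2 + 1))); split; first by rewrite divr_gt0//; lra.
  by rewrite divfK// gt_eqF//; lra.
have kap1 : kap < T - t1 by nra.
have L0 : 0 <= L.
  by case: spatial => h; exact: lip_ge0 (h t1 t1I).
have [Lam Lam0 HLam] := locally_lipschitz_on (L + 1) Hl.
have T20 : 0 < T ^+ 2 by rewrite exprn_gt0.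
have [om [om0 om1 om2]] : exists om, [/\ 0 < om, om <= 2^-1 & Lam * om * T ^+ 2 < eta].
  exists (Num.min 2^-1 (eta / (T ^+ 2 * (2 * Lam + 1)))); split.
  - by rewrite lt_min invr_gt0 ltr0n/= divr_gt0// mulr_gt0//; lra.
  - by rewrite ge_min lexx.
  have : Num.min 2^-1 (eta / (T ^+ 2 * (2 * Lam + 1))) <= eta / (T ^+ 2 * (2 * Lam + 1)).
    by rewrite ge_min lexx orbT.
  have om0 : 0 < Num.min 2^-1 (eta / (T ^+ 2 * (2 * Lam + 1))).
    by rewrite lt_min invr_gt0 ltr0n/= divr_gt0// mulr_gt0//; lra.
  move: (Num.min _ _) om0 => om om0.
  have k1 : 0 < om * T ^+ 2 by rewrite mulr_gt0.
  have k2 : 0 <= Lam * om * T ^+ 2 by rewrite mulr_ge0 ?mulr_ge0// ltW.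
  rewrite ler_pdivlMr ?mulr_gt0//; last by lra.
  have -> : om * (T ^+ 2 * (2 * Lam + 1)) = 2 * (Lam * om * T ^+ 2) + om * T ^+ 2 by ring.
  move: (Lam * om * T ^+ 2) (om * T ^+ 2) k1 k2 => *; lra.
have x10 : 0 <= x1 ^+ 2 by exact: sqr_ge0.
have [del [del0 del1 del2]] : exists del, [/\ 0 < del, del * x1 ^+ 2 <= theta / 4 &
    del * (4 * C2) <= om ^+ 2].
  exists (Num.min (theta / (4 * (x1 ^+ 2 + 1))) (om ^+ 2 / (4 * (C2 + 1)))).
  have m0 : 0 < Num.min (theta / (4 * (x1 ^+ 2 + 1))) (om ^+ 2 / (4 * (C2 + 1))).
    by rewrite lt_min !divr_gt0 ?exprn_gt0//; lra.
  have m1 : Num.min (theta / (4 * (x1 ^+ 2 + 1))) (om ^+ 2 / (4 * (C2 + 1))) <=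
    theta / (4 * (x1 ^+ 2 + 1)) by rewrite ge_min lexx.
  have m2 : Num.min (theta / (4 * (x1 ^+ 2 + 1))) (om ^+ 2 / (4 * (C2 + 1))) <=
    om ^+ 2 / (4 * (C2 + 1)) by rewrite ge_min lexx orbT.
  move: (Num.min _ _) m0 m1 m2 => m m0; rewrite !ler_pdivlMr; try by lra.
  by move=> m1 m2; split => //; lra.
have th4 : 0 < theta / 4 by lra.
have [da da0 hda] := uca th4; have [db db0 hdb] := ucb th4.
have [d [d0 dkap dda ddb]] : exists d, [/\ 0 < d, d <= kap, d <= da & d <= db].
  exists (Num.min kap (Num.min da db)).
  by rewrite !lt_min kap0 da0 db0 !ge_min !lexx !orbT.
have d20 : 0 < d ^+ 2 by rewrite exprn_gt0.
have [al [al1 ald]] : exists al, 1 <= al /\ C2 < al * d ^+ 2.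
  exists (1 + (C2 + 1) / d ^+ 2); split; first by rewrite lerDl divr_ge0 ?ltW.
  by rewrite mulrDl divfK ?gt_eqF//;
    clear - R T L H a b T0 Hl uca ucb sub sup init spatial d20; lra.
have al0 : 0 < al by exact: lt_le_trans al1.
have x1n := normr_ge0 x1.
have C2d : 0 <= C2 / del by rewrite divr_ge0 ?ltW.
pose rho := `|x1| + 3 + C2 / del + C.
have [T' T'E] : exists T', T' = T - kap by exists (T - kap).
have t1T' : 0 <= t1 <= T' by rewrite T'E;
  clear - R T L H a b T0 Hl uca ucb sub sup init spatial t10 kap1; lra.
have T'0 : 0 < T' < T by rewrite T'E;
  clear - R T L H a b T0 Hl uca ucb sub sup init spatial t10 kap1 kap0; lra.
have x1r : `|x1| <= rho by rewrite /rho;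
  clear - R T L H a b T0 Hl uca ucb sub sup init spatial C2d C0; lra.
have [||t [x [s [y [tT' xr sT' yr tmax]]]]] := @doubled_max_exists al del eta T' rho => //.
  by apply: le_trans x1r.
have low : theta / 2 <= doubled al del eta t x s y.
  apply: le_trans (tmax _ _ _ _ t1T' x1r t1T' x1r).
  rewrite /doubled (subrr x1) (subrr t1) expr0n/= !mulr0 !add0r eta1 -/theta.
  by clear - R T L H a b T0 Hl uca ucb sub sup init spatial del1; lra.
clearbody theta.
have tT : 0 <= t <= T by clear - R T L H a b T0 Hl uca ucb sub sup init spatial tT' T'0; lra.
have sT : 0 <= s <= T by clear - R T L H a b T0 Hl uca ucb sub sup init spatial sT' T'0; lra.
have tkap : kap <= T - t by clear - R T L H a b T0 Hl uca ucb sub sup init spatial tT' T'E; lra.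
have Tt0 : 0 < T - t by clear - R T L H a b T0 Hl uca ucb sub sup init spatial tkap kap0; lra.
have dx0 : 0 <= del * x ^+ 2 by rewrite mulr_ge0 ?sqr_ge0// ltW.
have et0 : 0 <= eta * (T - t)^-1 by rewrite mulr_ge0 ?invr_ge0// ltW.
have pen0 : 0 <= al * (x - y) ^+ 2 + al * (t - s) ^+ 2 + del * x ^+ 2 + eta * (T - t)^-1.
  by rewrite !addr_ge0// mulr_ge0 ?sqr_ge0// ltW.
have low2 : theta / 2 <= a (t, x) - b (s, y).
  by move: low; rewrite /doubled; clear - R T L H a b T0 Hl uca ucb sub sup init spatial pen0; lra.
have [|DC] := @penalties_bounded R C al (x - y) (t - s) (del * x ^+ 2) (eta * (T - t)^-1) C0 al1 dx0 et0.
  have := Cab t x s y tT sT; move: low; rewrite /doubled;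
    clear - R T L H a b T0 Hl uca ucb sub sup init spatial th0.
  move: (al * _ + _ + _ + _) => *; lra.
rewrite C2E => aD aE ax ae.
have Dd := sqr_small al0 d0 ald aD; have Ed := sqr_small al0 d0 ald aE.
have xlt := weighted_sqr_bound del0 (ltW C20) ax.
have z0 : 0 <= (0 : R) <= T by clear - R T L H a b T0 Hl uca ucb sub sup init spatial TT; lra.
have tpos : 0 < t.
  rewrite lt_neqAle; case/andP: tT => -> _; rewrite andbT; apply/eqP => t_0.
  have := hdb 0 x s y z0 sT; rewrite [in X in X -> _]t_0.
  move=> /(_ (lt_le_trans Ed ddb) (lt_le_trans Dd ddb)); rewrite ltr_norml => /andP[_ h].
  by have := init x; rewrite t_0;
    clear - R T L H a b T0 Hl uca ucb sub sup init spatial h low2 th0; lra.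
have spos : 0 < s.
  rewrite lt_neqAle; case/andP: sT => -> _; rewrite andbT; apply/eqP => s_0.
  have := hda t x 0 y tT z0; rewrite [in X in X -> _]s_0.
  move=> /(_ (lt_le_trans Ed dda) (lt_le_trans Dd dda)); rewrite ltr_norml => /andP[_ h].
  by have := init y; rewrite s_0;
    clear - R T L H a b T0 Hl uca ucb sub sup init spatial h low2 th0; lra.
have etaC : eta <= C2 * (T - t) by move: ae; rewrite ler_pdivrMr.
(* The factor 2 leaves room for s, which is only close to t. *)
have t2kap : 2 * kap < T - t by clear - R T L H a b T0 Hl uca ucb sub sup init spatial etaC kapE kap0 C20 Tt0; nra.
have tlt : t < T' by rewrite T'E;
  clear - R T L H a b T0 Hl uca ucb sub sup init spatial t2kap kap0; lra.
have slt : s < T'.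
  by move: Ed; rewrite T'E ltr_norml;
    clear - R T L H a b T0 Hl uca ucb sub sup init spatial t2kap kap0 dkap => /andP[? ?]; lra.
have ylt : `|y| <= `|x| + `|x - y|.
  have {1}-> : y = x - (x - y) by ring.
  exact: ler_normB.
have xrho : `|x| < rho by rewrite /rho;
  clear - R T L H a b T0 Hl uca ucb sub sup init spatial xlt x1n C0; lra.
have yrho : `|y| < rho by rewrite /rho;
  clear - R T L H a b T0 Hl uca ucb sub sup init spatial xlt ylt DC x1n; lra.
have tT'' : 0 < t < T' by rewrite tpos tlt.
have sT'' : 0 < s < T' by rewrite spos slt.
have T'T : T' < T by case/andP: T'0.
have slope := doubled_slope al0 del0 T'T tT'' sT'' xrho yrho tmax.
have strict := doubled_strict T'T tT'' sT'' xrho yrho tmax.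
move: slope strict; set p := 2 * al * (x - y); set q := 2 * del * x => slope strict.
have qom : `|q| <= om.
  rewrite -ler_sqr ?nnegrE ?(ltW om0)// (real_normK (num_real q)).
  apply: le_trans del2.
  have -> : q ^+ 2 = del * (4 * (del * x ^+ 2)) by rewrite /q; ring.
  by rewrite ler_wpM2l ?(ltW del0)//;
    clear - R T L H a b T0 Hl uca ucb sub sup init spatial ax; lra.
have pq : `|p + q| <= L + 1.
  by apply: le_trans (ler_normD _ _) _;
    clear - R T L H a b T0 Hl uca ucb sub sup init spatial slope qom om1; lra.
have pp : `|p| <= L + 1 by clear - R T L H a b T0 Hl uca ucb sub sup init spatial slope qom om1; lra.
have := HLam p (p + q) pp pq; rewrite opprD addNKr normrN ler_norml => /andP[_ h4].
have h5 : Lam * `|q| <= Lam * om by rewrite ler_wpM2l.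
have h6 : eta <= Lam * om * (T - t) ^+ 2.
  have : eta * (T - t) ^- 2 <= Lam * om by clear - R T L H a b T0 Hl uca ucb sub sup init spatial strict h4 h5; lra.
  by rewrite ler_pdivrMr// exprn_gt0.
have h7 : Lam * om * (T - t) ^+ 2 <= Lam * om * T ^+ 2.
  rewrite ler_wpM2l ?mulr_ge0 ?(ltW om0)// ler_sqr ?nnegrE; [|exact: ltW|exact: ltW].
  by clear - R T L H a b T0 Hl uca ucb sub sup init spatial tpos; lra.
by clear - R T L H a b T0 Hl uca ucb sub sup init spatial h6 h7 om2; lra.
Qed.

Lemma comparison_strip z : closed_strip T z -> a z <= b z.
Proof.
have TT := T0; case: z => t x /= tT; rewrite /closed_strip/= in tT.
apply/ler_addgt0Pr => e e0.
have e2 : 0 < e / 2 by lra.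
have [da da0 hda] := uca e2; have [db db0 hdb] := ucb e2.
pose d := Num.min (T / 2) (Num.min da db).
have d0 : 0 < d by rewrite !lt_min da0 db0 !andbT; lra.
have dT : d <= T / 2 by rewrite ge_min lexx.
have dda : d <= da by rewrite !ge_min lexx orbT.
have ddb : d <= db by rewrite !ge_min lexx !orbT.
clearbody d.
pose t' := Num.max (d / 2) (Num.min t (T - d / 2)).
have t'T : 0 < t' < T.
  by rewrite /t';
    clear - R T L H a b T0 Hl uca ucb sub sup init spatial TT d0 dT tT; split_minmax; lra.
have tt' : `|t - t'| < d.
  by rewrite ltr_norml /t';
    clear - R T L H a b T0 Hl uca ucb sub sup init spatial TT d0 dT tT; split_minmax; lra.
have t'T' : 0 <= t' <= T by lra.
have := comparison_interior x t'T.
have xx : `|x - x| < d by rewrite subrr normr0.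
have := hda t x t' x tT t'T' (lt_le_trans tt' dda) (lt_le_trans xx dda).
have := hdb t x t' x tT t'T' (lt_le_trans tt' ddb) (lt_le_trans xx ddb).
by rewrite !ltr_norml; lra.
Qed.

End Comparison.

(** A cluster point of an ultrafilter is a limit. *)
Lemma bounded_ultra_cvg (R : realType) (F : set_system nat) (g : nat -> R) (l B : R) :
  UltraFilter F -> (forall n, `|g n - l| <= B) -> cvg (g n @[n --> F]).
Proof.
move=> FU gB.
have gF : F (g @^-1` `[l - B, l + B]%classic).
  by apply: (@filterE _ F) => n; have := gB n; rewrite ler_distl /= in_itv.
have [p [_ pF]] := @segment_compact R (l - B) (l + B) (g n @[n --> F]) _ gF.
apply: cvgP (p) _ => A Ap.
have [//|nA] := in_ultra_setVsetC (g @^-1` A) FU.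
by have [y []] := pF (~` A) A nA Ap.
Qed.

Lemma cvg_dist_near (R : realType) (F : set_system nat) (g : nat -> R) e :
  Filter F -> cvg (g n @[n --> F]) -> 0 < e ->
  \forall n \near F, `|g n - lim (g n @[n --> F])| <= e.
Proof.
by move=> FF cg e0; move/cvgrPdist_le: cg => /(_ e e0); apply: filterS => n; rewrite distrC.
Qed.

Section Ultralimit.
Variables (R : realType) (T L k : R) (v H G : R -> R) (zeta : nat -> seq R).
Variable (F : set_system nat).
Hypotheses (T0 : 0 < T) (Lv : lip L v) (Hl : locally_lipschitz H) (kG : lip k G).
Hypothesis GH : forall p, `|p| <= L + 1 -> G p = H p.
Hypothesis zetaP : forall n, path <%R 0 (zeta n) /\ last 0 (zeta n) = T.
Variable mu : nat -> R.
Hypothesis mu0 : forall n, 0 <= mu n.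
Hypothesis zeta_mu : forall n, gaps_le (mu n) 0 (zeta n).
Hypothesis FU : UltraFilter F.
Hypothesis mu_cvg : forall e, 0 < e -> \forall n \near F, mu n <= e.

Local Notation V := (speed G L k).

Let f n (z : R * R) := iterated_minmax H 0 (zeta n) v z.1 z.2.

(** Along an ultrafilter every bounded sequence converges, so no subsequence has
    to be extracted. *)
Definition ultralimit (z : R * R) : R := lim (f n z @[n --> F]).
Local Notation u := ultralimit.

Let V0 : 0 <= V.
Proof.
have L0 := lip_ge0 Lv; have k0 := lip_ge0 kG.
by rewrite addr_ge0// mulr_ge0//; lra.
Qed.

Let f_space n t x y : `|f n (t, x) - f n (t, y)| <= L * `|x - y|.
Proof. exact: (iterated_lip Hl kG GH (zeta n) 0 t Lv). Qed.

Let f_time n t s x : 0 <= t <= T -> 0 <= s <= T ->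
  `|f n (t, x) - f n (s, x)| <= V * `|t - s| + 2 * V * mu n.
Proof.
have [zp zl] := zetaP n.
have h a b : 0 <= a -> a <= b -> b <= T ->
    `|f n (b, x) - f n (a, x)| <= V * (b - a) + 2 * V * mu n.
  move=> a0 ab bT; apply: (iterated_time Hl kG GH x (mu0 n) (zeta_mu n) zp a0 ab _ Lv).
  by rewrite zl.
move=> /andP[t1 t2] /andP[s1 s2]; have [ts|/ltW st] := leP t s.
  rewrite distrC (distrC t) (ger0_norm (x := s - t)) ?subr_ge0//; exact: h.
by rewrite (ger0_norm (x := t - s)) ?subr_ge0//; exact: h.
Qed.

Let f_initial n t x : 0 <= t -> `|f n (t, x) - v x| <= V * t.
Proof.
move=> t0; have [zp _] := zetaP n.
by have := iterated_speed Hl kG GH x zp t0 Lv; rewrite subr0.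
Qed.

Let f_cvg z : 0 <= z.1 -> cvg (f n z @[n --> F]).
Proof.
case: z => t x /= t0; apply: (@bounded_ultra_cvg _ _ _ (v x) (V * t)) => // n.
exact: f_initial.
Qed.

Let f_near z e : 0 <= z.1 -> 0 < e -> \forall n \near F, `|f n z - u z| <= e.
Proof. by move=> z0 e0; apply: cvg_dist_near => //; exact: f_cvg. Qed.

Lemma ultralimit_initial x : u (0, x) = v x.
Proof.
have e n : f n (0, x) = v x.
  apply/eqP; rewrite -subr_eq0 -normr_le0.
  by apply: le_trans (f_initial n x (lexx 0)) _; rewrite mulr0.
rewrite /ultralimit; under eq_fun do rewrite e.
exact: lim_cst.
Qed.

Lemma ultralimit_lip t : 0 <= t -> lip L (fun x => u (t, x)).
Proof.
move=> t0 x y; apply/ler_addgt0Pr => e e0.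
have e2 : 0 < e / 2 by lra.
have [n [n1 n2]] : exists n, `|f n (t, x) - u (t, x)| <= e / 2 /\ `|f n (t, y) - u (t, y)| <= e / 2.
  apply: (@filter_ex _ F); apply: filterI; exact: f_near.
have := f_space n t x y; move: n1 n2; rewrite !ler_norml.
by move: (L * _) => c; lra.
Qed.

(** The defect of the iterated minmax in time is proportional to the mesh. *)
Lemma ultralimit_time t s x : 0 <= t <= T -> 0 <= s <= T ->
  `|u (t, x) - u (s, x)| <= V * `|t - s|.
Proof.
move=> tT sT; apply/ler_addgt0Pr => e e0.
have e4 : 0 < e / 4 by lra.
have VV := V0; have V1 : 0 < 4 * V + 1 by lra.
have em : 0 < e / (4 * V + 1) by rewrite divr_gt0.
have [t0 _] := andP tT; have [s0 _] := andP sT.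
have [n [[n1 n2] n3]] : exists n, (`|f n (t, x) - u (t, x)| <= e / 4 /\
    `|f n (s, x) - u (s, x)| <= e / 4) /\ mu n <= e / (4 * V + 1).
  apply: (@filter_ex _ F); apply: filterI; last exact: mu_cvg.
  apply: filterI; exact: f_near.
have n4 : 2 * V * mu n <= e / 2.
  have m0 := mu0 n; rewrite ler_pdivlMr// in n3; nra.
have := f_time n x tT sT; move: n1 n2; rewrite !ler_norml.
by move: (V * _) => c; lra.
Qed.

Lemma ultralimit_uc : uc_strip T u.
Proof.
move=> e e0; have L0 := lip_ge0 Lv; have VV := V0.
have LV : 0 < L + V + 1 by lra.
exists (e / (L + V + 1)); first by rewrite divr_gt0.
move=> t x s y tT sT; rewrite !ltr_pdivlMr// => ts xy.
have [t0 _] := andP tT.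
have h1 := ultralimit_lip t0 x y; have h2 := ultralimit_time y tT sT.
rewrite -(subrKA (u (t, y))); apply: le_lt_trans (ler_normD _ _) _.
have k1 := normr_ge0 (t - s); have k2 := normr_ge0 (x - y).
apply: le_lt_trans (lerD h1 h2) _; nra.
Qed.

(** Pointwise convergence spreads to a neighbourhood by equicontinuity, and K is
    covered by finitely many such neighbourhoods. *)
Lemma ultralimit_uniform K : compact K -> K `<=` closed_strip T -> forall e, 0 < e ->
  \forall n \near F, forall z, K z -> `|f n z - u z| < e.
Proof.
move=> cK KT e e0.
have FF : Filter F by exact: filter_filter.
have := (near_covering_withinP K).2 ((compact_near_coveringP K).1 cK) nat F
  (fun n z => `|f n z - u z| < e) FF; apply => -[t x] Kz.
have L0 := lip_ge0 Lv; have VV := V0.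
have tT : 0 <= t <= T := KT _ Kz.
pose d := e / (8 * (L + V + 1)).
have LV : 0 < 8 * (L + V + 1) by lra.
have d0 : 0 < d by rewrite divr_gt0.
have dE : d * (8 * (L + V + 1)) = e by rewrite /d divfK// gt_eqF.
have e4 : 0 < e / 4 by lra.
have t0 : 0 <= (t, x).1 by case/andP: tT.
near=> z n => Kz'.
have ts : `|t - z.1| < d.
  by near: z; apply: (@cvgr_dist_lt _ _ _ _ _ fst t) => //; exact: cvg_fst.
have xy : `|x - z.2| < d.
  by near: z; apply: (@cvgr_dist_lt _ _ _ _ _ snd x) => //; exact: cvg_snd.
have n1 : `|f n (t, x) - u (t, x)| <= e / 4 by near: n; exact: f_near.
have n2 : mu n <= d by near: n; exact: mu_cvg.
have zT : 0 <= z.1 <= T := KT _ Kz'.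
have [z0 _] := andP zT.
rewrite (surjective_pairing z); move: (z.1) (z.2) ts xy zT z0 => s y ts xy sT s0.
have h1 := f_space n s x y; have h2 := f_time n x tT sT.
have h3 := ultralimit_lip s0 x y; have h4 := ultralimit_time x tT sT.
have b1 : L * `|x - y| <= L * d by rewrite ler_wpM2l// ltW.
have b2 : V * `|t - s| <= V * d by rewrite ler_wpM2l// ltW.
have b3 : V * mu n <= V * d by rewrite ler_wpM2l.
have b4 : L * d * 8 + V * d * 8 < e by rewrite -dE; lra.
move: h1 h2 h3 h4 n1; rewrite !ler_norml ltr_norml -!mulrA.
move: (L * _) (V * _) (V * _) (L * _) (V * _) b1 b2 b3 b4 => c1 c2 c3 c4 c5 b1 b2 b3 b4.
move: (f _ _) (f _ _) (f _ _) (u _) (u _) (u _) => *; lra.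
Unshelve. all: by end_near. Qed.

(** Where u is touched by a smooth function, u stays on one side of a cone with
    small opening over the tangent plane; this cone is a barrier for the iterated
    minmax. *)
Lemma ultralimit_touching eps psi z : eps = 1 \/ eps = -1 ->
  open_strip T z -> differentiable psi z ->
  (\forall w \near z, eps * (u w - psi w) <= eps * (u z - psi z)) ->
  eps * (dt psi z + H (dx psi z)) <= 0.
Proof.
case: z => t0 x0 eps1 z0T dpsi touch.
have L0 := lip_ge0 Lv; have k0 := lip_ge0 kG; have VV := V0.
have ee : eps * eps = 1 by case: eps1 => ->; rewrite ?mulr1// mulrNN mulr1.
have en : `|eps| = 1 by case: eps1 => ->; rewrite ?normrN normr1.
set pt := dt psi (t0, x0); set p := dx psi (t0, x0).
have [t00 t0T] : 0 < t0 /\ t0 < T by exact/andP.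
have cone kappa : 0 < kappa -> exists2 r, 0 < r & forall t x, `|t - t0| < r -> `|x - x0| < r ->
    eps * u (t, x) <= eps * (u (t0, x0) + ((t - t0) * pt + (x - x0) * p)) +
      kappa * (`|t - t0| + `|x - x0|).
  move=> kappa0.
  have near2 : nbhs ((t0, x0) : R * R) (fun w =>
      (eps * (u w - psi w) <= eps * (u (t0, x0) - psi (t0, x0))) /\
      `|psi w - psi (t0, x0) - ((w.1 - t0) * pt + (w.2 - x0) * p)| <=
         kappa * (`|w.1 - t0| + `|w.2 - x0|)).
    exact: filterI touch (diff_expansion dpsi kappa0).
  move/nbhs_ballP: near2 => [r /= r0 hr].
  exists r => // t x tr xr.
  have tx : ball ((t0, x0) : R * R) r (t, x).
    split; first by rewrite -[ball _ _ _]/(is_true (`|t0 - t| < r)) distrC.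
    by rewrite -[ball _ _ _]/(is_true (`|x0 - x| < r)) distrC.
  have /= [h1] := hr _ tx.
  rewrite ler_norml; move: (kappa * _) ((t - t0) * pt + _) => c d.
  by case: eps1 h1 => ->; rewrite ?mul1r ?mulN1r => h1 /andP[? ?]; lra.
have pL : `|p| <= L.
  apply/ler_addgt0Pr => kappa kappa0; have [r r0 hr] := cone kappa kappa0.
  have h2 h : `|h| < r -> - (eps * p * h) <= (L + kappa) * `|h|.
    move=> hr'; have := hr t0 (x0 + h); rewrite subrr normr0 [x0 + h - x0]addrC addKr.
    move=> /(_ r0 hr'); have := ultralimit_lip (ltW t00) (x0 + h) x0.
    rewrite [x0 + h - x0]addrC addKr mul0r !add0r ler_norml mulrDl.
    rewrite mulrDr [h * p]mulrC mulrA.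
    move: (L * _) (kappa * _) (eps * p * h) => c d b.
    by case: eps1 => ->; rewrite ?mul1r ?mulN1r; lra.
  have r2 : `|r / 2| < r by rewrite ger0_norm; lra.
  have r2' : `|- (r / 2)| < r by rewrite normrN.
  have := h2 _ r2; have := h2 _ r2'; rewrite normrN (ger0_norm (x := r / 2)); last by lra.
  have -> : `|p| = `|eps * p| by rewrite normrM en mul1r.
  move: (eps * p) => q h3 h4.
  rewrite ler_norml; apply/andP; split; nra.
have GpH : G p = H p by apply: GH; lra.
rewrite -GpH -[leRHS]addr0.
apply/ler_addgt0Pr => e e0; rewrite !add0r.
pose kappa := e / (2 + 2 * k).
have k2 : 0 < 2 + 2 * k by lra.
have kappa0 : 0 < kappa by rewrite divr_gt0.
have kappaE : kappa * (2 + 2 * k) = e by rewrite /kappa divfK// gt_eqF.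
clearbody kappa.
have [r r0 hr] := cone kappa kappa0.
pose h := Num.min t0 (r / (2 * k + 2)).
have h0 : 0 < h by rewrite lt_min t00 divr_gt0//; lra.
have ht : h <= t0 by rewrite ge_min lexx.
have hkr : h * (2 * k + 2) <= r.
  have : h <= r / (2 * k + 2) by rewrite ge_min lexx orbT.
  by rewrite ler_pdivlMr//; lra.
clearbody h.
have hr1 : h < r by nra.
pose rho := 2 * k * h.
have rho0 : 0 <= rho by rewrite /rho; nra.
have rhor : rho < r by rewrite /rho; nra.
pose eta := kappa * h / 3.
have eta0 : 0 < eta by rewrite /eta; nra.
(* The extreme value of G on the slopes of the cone, up to its Lipschitz constant. *)
pose m := G p - eps * (2 * kappa * k).
pose K := (`[t0 - h, t0]%classic `*` `[x0 - rho, x0 + rho]%classic : set (R * R)).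
have cK : compact K by apply: compact_setX; exact: segment_compact.
have KT : K `<=` closed_strip T.
  by move=> [t x] [/= + _]; rewrite /closed_strip/= in_itv/=; lra.
have Vm : 0 < V + `|m| + 1 by have := normr_ge0 m; lra.
have [n [[n1 n2] n3]] : exists n, ((forall z, K z -> `|f n z - u z| < eta) /\
    mu n <= eta / (V + `|m| + 1)) /\ mu n <= h.
  apply: (@filter_ex _ F); apply: filterI; last exact: mu_cvg.
  by apply: filterI; [exact: ultralimit_uniform|apply: mu_cvg; rewrite divr_gt0].
have {}n2 : (V + `|m|) * mu n <= eta.
  move: n2; rewrite ler_pdivlMr// => n2; have := mu0 n; lra.
pose phi x := u (t0, x0) - h * pt + (x - x0) * p + eps * (kappa * (h + `|x - x0|) + eta).
have philip : lip kappa (fun y => phi y - p * y).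
  move=> a b; rewrite /phi.
  have -> : u (t0, x0) - h * pt + (a - x0) * p + eps * (kappa * (h + `|a - x0|) + eta) - p * a -
    (u (t0, x0) - h * pt + (b - x0) * p + eps * (kappa * (h + `|b - x0|) + eta) - p * b) =
    eps * (kappa * (`|a - x0| - `|b - x0|)) by ring.
  rewrite normrM en mul1r normrM (ger0_norm (ltW kappa0)) ler_wpM2l ?(ltW kappa0)//.
  apply: le_trans (ler_dist_dist _ _) _.
  by rewrite opprB addrA subrK.
have mG y : `|y - p| <= 2 * kappa -> eps * m <= eps * G y.
  move=> yp; have := kG y p.
  have : k * `|y - p| <= k * (2 * kappa) by rewrite ler_wpM2l.
  rewrite /m mulrBr [eps * (eps * _)]mulrA ee mul1r ler_norml.
  move: (k * `|_|) => c ? /andP[? ?].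
  by case: eps1 => ->; rewrite ?mul1r ?mulN1r; lra.
have [zp zl] := zetaP n.
have below x : `|x - x0| <= k * (t0 - (t0 - h) + mu n) ->
    eps * iterated_minmax H 0 (zeta n) v (t0 - h) x <= eps * phi x.
  move=> xx.
  have xrho : `|x - x0| <= rho.
    apply: le_trans xx _; rewrite /rho; have := ler_wpM2l k0 n3; lra.
  have th : `|t0 - h - t0| < r by rewrite addrC addKr normrN gtr0_norm.
  have := hr (t0 - h) x th (le_lt_trans xrho rhor).
  have Kx : K (t0 - h, x).
    rewrite /K/=; split; rewrite /= in_itv/=; first by lra.
    by move: xrho; rewrite ler_norml; lra.
  have := n1 _ Kx; rewrite -/(f n (t0 - h, x)).
  rewrite [t0 - h - t0]addrC addKr normrN (gtr0_norm h0) ltr_norml /phi.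
  set c := kappa * _; set d := (x - x0) * p; move: (f n _) (u (t0 - h, x)) => a b /andP[k3 k4].
  rewrite mulrDr [eps * (u (t0, x0) - _ + _ + _)]mulrDr [eps * (eps * _)]mulrA ee mul1r mulNr.
  by case: eps1 => ->; rewrite ?mul1r ?mulN1r; lra.
have rt1 : 0 <= t0 - h by lra.
have rt2 : t0 - h <= t0 by lra.
have rt3 : t0 <= last 0 (zeta n) by rewrite zl ltW.
have := iterated_barrier_from Hl kG GH (mu0 n) (zeta_mu n) eps1 zp rt1 rt2 rt3 Lv philip kappa0
  mG below.
have K0 : K (t0, x0) by rewrite /K/=; split; rewrite /= in_itv/=; lra.
have := n1 _ K0; rewrite -/(f n (t0, x0)).
rewrite /phi subrr mul0r addr0 normr0 addr0 ltr_norml (_ : t0 - (t0 - h) = h); last by ring.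
move: (f n _) => a /andP[k3 k4].
have -> : eps * (u (t0, x0) - h * pt + eps * (kappa * h + eta) - h * m) =
  eps * u (t0, x0) - h * (eps * (pt + G p)) + (eps * eps) * (kappa * h + eta)
   + (eps * eps) * (h * (2 * kappa * k)) by rewrite /m; ring.
rewrite ee !mul1r => k5.
have k6 : h * (eps * (pt + G p)) <= h * e.
  have eE : h * e = 2 * (kappa * h) + h * (2 * kappa * k) by rewrite -kappaE; ring.
  have etaE : kappa * h = 3 * eta by rewrite /eta; field.
  rewrite eE; move: k5; case: eps1 => ->; rewrite ?mul1r ?mulN1r; lra.
by rewrite ler_pM2l in k6.
Qed.

Lemma ultralimit_cauchy : cauchy_viscosity_solution T H v u.
Proof.
have cu : {within open_strip T, continuous u}.
  apply: (@subspace_eq_continuous _ _ _ (fun z => u (clamp_time T z.1, z.2))); last first.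
    by apply: continuous_subspaceT; exact: (uc_strip_continuous T0 ultralimit_uc).
  move=> [t x]; rewrite inE => /andP[/= t1 t2].
  by rewrite clamp_time_id// !ltW.
split; last exact: ultralimit_initial.
  by apply/unif_continuous_strip; exact: ultralimit_uc.
split; split => // psi z psiC1 zT near_max.
  have [dz _] := psiC1 z zT.
  rewrite -[leLHS]mul1r; apply: (ultralimit_touching (or_introl erefl) zT dz).
  by apply: filterS near_max => w; rewrite !mul1r.
have [dz _] := psiC1 z zT.
rewrite -oppr_le0 -mulN1r; apply: (ultralimit_touching (or_intror erefl) zT dz).
by apply: filterS near_max => w; rewrite !mulN1r lerN2.
Qed.

End Ultralimit.

(** * Convergence *)
Section Subdivisions.
Variable R : realType.
Implicit Types (s : seq R) (h a b : R).

Lemma mesh_ge0 a s : 0 <= mesh a s.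
Proof.
by rewrite /mesh; elim/big_ind: _ => // x y x0 y0; rewrite le_max x0.
Qed.

Lemma gaps_le_mesh a s : gaps_le (mesh a s) a s.
Proof.
have : forall i, (i < size s)%N -> nth 0 s i - nth 0 (a :: s) i <= mesh a s.
  move=> i si; apply: le_trans (ler_norm _) _.
  by apply: (le_bigmax 0 (fun i : 'I_(size s) => `|nth 0 s i - nth 0 (a :: s) i|) (Ordinal si)).
move: (mesh a s) => mu; elim: s a => //= b s ih a h.
rewrite (h 0)//=; apply: ih => i si; exact: (h i.+1).
Qed.

Lemma partition_exists (n : nat) h a b : 0 < h -> a < b -> b - a <= n.+1%:R * h ->
  exists s, [/\ path <%R a s, last a s = b & gaps_le h a s].
Proof.
move=> h0; elim: n a => [|n ih] a ab.
  by rewrite mul1r => bh; exists [:: b]; rewrite /= ab bh.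
have [bh _|hb] := leP (b - a) h; first by exists [:: b]; rewrite /= ab bh.
rewrite -[n.+2]addn1 natrD mulrDl mul1r => bn.
have [||s [ps ls gs]] := ih (a + h); [by lra|by lra|].
exists ((a + h) :: s); split => //=; first by rewrite ps ltrDl h0.
by rewrite gs [a + h]addrC addrK lexx.
Qed.

End Subdivisions.

Lemma cauchy_viscosity_unique (R : realType) (T L : R) (H v : R -> R) (u w : R * R -> R) :
  0 < T -> locally_lipschitz H ->
  cauchy_viscosity_solution T H v u -> (forall t, 0 <= t -> lip L (fun x => u (t, x))) ->
  cauchy_viscosity_solution T H v w -> {in closed_strip T, w =1 u}.
Proof.
move=> T0 Hl [/unif_continuous_strip uu [usub usup] u0] uL.
move=> [/unif_continuous_strip wu [wsub wsup] w0] z; rewrite inE => zT.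
have uL' : forall t, 0 <= t <= T -> lip L (fun x => u (t, x)).
  by move=> t /andP[t0 _]; exact: uL.
apply: le_anti; apply/andP; split.
- apply: (comparison_strip T0 Hl wu uu wsub usup _ (or_intror uL') zT).
  by move=> x; rewrite u0 w0.
- apply: (comparison_strip T0 Hl uu wu usub wsup _ (or_introl uL') zT).
  by move=> x; rewrite u0 w0.
Qed.

Lemma frequently_ultra (B : set nat) : ~ (\forall n \near \oo, ~ B n) ->
  exists F : set_system nat, [/\ UltraFilter F, F B & \oo `<=` F].
Proof.
move=> nB.
have PF : ProperFilter (within B \oo).
  apply: Build_ProperFilter_ex => A BA.
  apply: contrapT => nA; apply: nB.
  by move: BA; rewrite /within/=; apply: filterS => n Bn nBn; apply: nA; exists n; exact: Bn.
have [F [FU BF]] := ultraFilterLemma PF.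
exists F; split => //; first by apply: BF; apply: nearW.
by move=> A oA; apply: BF; apply: filterS oA => n.
Qed.

Theorem theorem3p13 (R : realType) (v H : R -> R) (T : R)
    (v_lip : lipschitz v) (H_lip : locally_lipschitz H) (T_gt0 : 0 < T) :
  exists u : R * R -> R,
    [/\ cauchy_viscosity_solution T H v u,
        forall w : R * R -> R, cauchy_viscosity_solution T H v w ->
          {in closed_strip T, w =1 u} &
        forall zeta : nat -> seq R,
          (forall n, itv_partition 0 T (zeta n)) ->
          mesh 0 (zeta n) @[n --> \oo] --> (0 : R) ->
          forall K : set (R * R), compact K -> K `<=` closed_strip T ->
            {uniform K,
              (fun n z => iterated_minmax H 0 (zeta n) v z.1 z.2) @ \oo --> u}].
Proof.
have [L Lv] := lipschitz_lip v_lip; have L0 := lip_ge0 Lv.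
have [G [k [kG _ GHL]]] := truncation_exists L H_lip.
have GH p : `|p| <= L + 1 -> G p = H p by move=> pL; apply: GHL; rewrite (ger0_norm L0).
have /choice[zeta0 zeta0P] (n : nat) : exists s : seq R,
    [/\ path <%R 0 s, last 0 s = T & gaps_le n.+1%:R^-1 0 s].
  have n0 : 0 < n.+1%:R :> R by rewrite ltr0n.
  apply: (@partition_exists _ (Num.truncn (T * n.+1%:R))) => //.
  rewrite subr0 ler_pdivlMr//; apply/ltW.
  by have /andP[] := truncn_itv (mulr_ge0 (ltW T_gt0) (ltW n0)).
have [F0 [F0U F0oo]] := ultraFilterLemma (eventually_filter : ProperFilter \oo).
have zeta0_path n : path <%R 0 (zeta0 n) /\ last 0 (zeta0 n) = T by case: (zeta0P n).
have zeta0_gaps n : gaps_le n.+1%:R^-1 0 (zeta0 n) by case: (zeta0P n).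
have small0 e : 0 < e -> \forall n \near F0, n.+1%:R^-1 <= e :> R.
  move=> e0; apply: F0oo; near=> n.
  rewrite ltW//; near: n; exact: near_infty_natSinv_lt (PosNum e0).
have inv_ge0 n : 0 <= n.+1%:R^-1 :> R by [].
pose u := ultralimit v H zeta0 F0.
have u_sol : cauchy_viscosity_solution T H v u.
  exact: (ultralimit_cauchy T_gt0 Lv H_lip kG GH zeta0_path inv_ge0 zeta0_gaps F0U small0).
have u_lip t : 0 <= t -> lip L (fun x => u (t, x)).
  exact: (ultralimit_lip Lv H_lip kG GH zeta0_path F0U).
exists u; split => //.
  by move=> w w_sol; exact: (cauchy_viscosity_unique T_gt0 H_lip u_sol u_lip).
move=> zeta zetaP mesh0 K cK KT.
have zeta_path n : path <%R 0 (zeta n) /\ last 0 (zeta n) = T.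
  by have [zp /eqP zl] := zetaP n.
move=> P /uniform_nbhs[E [entE EP]].
have [e e0 eE] : exists2 e, 0 < e & forall a b : R, `|b - a| < e -> E (a, b).
  move: entE; rewrite -entourage_ballE => -[e e0 eE]; exists e => // a b ab.
  by apply: eE; rewrite /= /ball/= distrC.
(* If uniform convergence failed, some ultrafilter would contain the bad indices;
   but the ultralimit along it is again u. *)
apply: contrapT => notP.
pose B := [set n | ~ forall z, K z -> `|iterated_minmax H 0 (zeta n) v z.1 z.2 - u z| < e].
have [|F [FU FB ooF]] := @frequently_ultra B.
  move=> near_good; apply: notP; rewrite nbhs_simpl/=.
  apply: filterS near_good => n /contrapT good; apply: EP => z Kz; apply: eE.
  exact: good.
have small d : 0 < d -> \forall n \near F, mesh 0 (zeta n) <= d.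
  move=> d0; apply: ooF; move/cvgrPdist_le: mesh0 => /(_ d d0).
  by apply: filterS => n; rewrite sub0r normrN ger0_norm ?mesh_ge0.
have gaps n : gaps_le (mesh 0 (zeta n)) 0 (zeta n) := gaps_le_mesh 0 (zeta n).
have pos n : 0 <= mesh 0 (zeta n) := mesh_ge0 0 (zeta n).
have w_sol := ultralimit_cauchy T_gt0 Lv H_lip kG GH zeta_path pos gaps FU small.
have wu := cauchy_viscosity_unique T_gt0 H_lip u_sol u_lip w_sol.
have good := ultralimit_uniform Lv H_lip kG GH zeta_path pos gaps FU small cK KT e0.
have [n [Bn nK]] := filter_ex (filterI FB good).
apply: Bn => z Kz.
by rewrite -(wu z) ?inE; [exact: nK|exact: KT].
Unshelve. all: by end_near. Qed.
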